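(* Assume (C1)–(C3) and $n\ge d$. Then the natural map $B\wr\mathcal H(d)\to\operatorname{End}_{\mathbf S_{n,d}}(V_n^{\otimes d})$ (right action) is an isomorphism, where $\mathbf S_{n,d}=\operatorname{End}_{B\wr\mathcal H(d)}(V_n^{\otimes d})$; thus $\mathbf S_{n,d}$ and $B\wr\mathcal H(d)$ are mutual centralizers on $V_n^{\otimes d}$.
   Context: $\Bbbk$ field, $F$ unital finite-dimensional $\Bbbk$-algebra, $B=F[x]$ or $F[x^{\pm1}]$, $d\ge2$; $B^{\otimes m}\cong F^{\otimes m}[x_1,\dots,x_m]$ (or Laurent). $\sigma$ = flip. For $Y\in B\otimes B$, $Y_k$ is $Y$ placed in slots $k,k+1$; $\phi_k$ = $\phi$ acting on slots $k,k+1$. Weak Frobenius: $\Delta\in F\otimes F$ with $(a\otimes b)\Delta=\Delta(b\otimes a)$; $W(F)^{\mathfrak S_2}$: those with $\sigma(\Delta)=\Delta$. $\partial^\beta(f)=(\beta f-\sigma(f)\beta)/(x_1-x_2)$. $B\wr\mathcal H(d)$: generated by $B^{\otimes d}$ and $H_1,\dots,H_{d-1}$ with braid relations, $H_i^2=S_iH_i+R_i$, $H_ib=\sigma_i(b)H_i+\rho_i(b)$; polynomial type: $R\in F\otimes F$ central, $\sigma(R)=R$; $\beta=\sum_{i,j\in\{0,1\}}\Delta^{ij}x_1^ix_2^j$, $\Delta^{ij}\in W(F)^{\mathfrak S_2}$, $(\Delta^{00}\otimes1)(1\otimes\Delta^{11})=(\Delta^{01}\otimes1)(1\otimes\Delta^{10})$;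 $\sigma$ flip, $\rho=\partial^\beta$, $S=\Delta^{10}-\Delta^{01}$. (C1) $\alpha\in F\otimes F$ with $\alpha\bar\alpha=R$, $\bar\alpha=\sigma(\alpha)+S$; (C2) $\alpha$, all $\Delta^{ij}$ central; (C3) $\alpha(x_1-x_2)+\beta$ not a zero divisor in $B\otimes B$. $V_n=\bigoplus_{i=1}^nv_iB$; $V_n^{\otimes d}$ is the free right $B^{\otimes d}$-module with basis $v_{\underline i}$, $\underline i\in\{1,\dots,n\}^d$, made into a right $B\wr\mathcal H(d)$-module by $(v_{\underline i}b)H_k=v_{\underline i\cdot s_k}\sigma_k(b)+v_{\underline i}\rho_k(b)$ if $i_k<i_{k+1}$; $=v_{\underline i}\bar\alpha_k\sigma_k(b)+v_{\underline i}\rho_k(b)$ if $i_k=i_{k+1}$; $=v_{\underline i\cdot s_k}R_k\sigma_k(b)+v_{\underline i}(\rho_k(b)+S_k\sigma_k(b))$ if $i_k>i_{k+1}$ ($\underline i\cdot s_k$ swaps entries $k,k+1$). The wreath Schur algebra is $\mathbf S_{n,d}=\operatorname{End}_{B\wr\mathcal H(d)}(V_n^{\otimes d})$. *)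

(* Defs.v *)
From HB Require Import structures.
From mathcomp Require Import all_boot all_fingroup all_algebra all_field.
From mathcomp Require Import finmap.
From Stdlib Require Import ClassicalEpsilon.
Set Implicit Arguments. Unset Strict Implicit. Unset Printing Implicit Defensive.
Import GRing.Theory.
Local Open Scope ring_scope.

Section WreathSchur.
Variables (k : fieldType) (F : falgType k).

Definition rdim := \dim (fullv : {vspace F}).
Definition eF : rdim.-tuple F := vbasis fullv.
Definition cst (a b c : 'I_rdim) : k := coord eF c (tnth eF a * tnth eF b).

(* F^{(x)m}: coordinates on the basis e_{t_0} (x) ... (x) e_{t_(m-1)} *)
Definition TP m := {ffun m.-tuple 'I_rdim -> k}.

Definition tpmul m (f g : TP m) : TP m :=
  [ffun c => \sum_(a : m.-tuple 'I_rdim) \sum_(b : m.-tuple 'I_rdim)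
     f a * g b * \prod_(i < m) cst (tnth a i) (tnth b i) (tnth c i)].
Definition tpone m : TP m := [ffun c => \prod_(i < m) coord eF (tnth c i) 1].

Definition pure2 (u v : F) : TP 2 :=
  [ffun t => coord eF (tnth t ord0) u * coord eF (tnth t ord_max) v].

(* place Y in F^{(x)m} into the slots s(0),...,s(m-1) of F^{(x)m'}
   (1 in the other slots); s is meant to be injective *)
Definition placeF m m' (s : 'I_m -> 'I_m') (Y : TP m) : TP m' :=
  [ffun c => Y [tuple tnth c (s j) | j < m] *
             \prod_(i < m' | i \notin codom s) coord eF (tnth c i) 1].

(* permutation of tensor slots: the content of slot i moves to slot p i *)
Definition permF m (p : 'S_m) (Y : TP m) : TP m :=
  [ffun t => Y [tuple tnth t (p i) | i < m]].

Definition flipF (Y : TP 2) : TP 2 := permF (tperm ord0 ord_max) Y.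

Definition centralF m (Y : TP m) : Prop := forall Z : TP m, tpmul Y Z = tpmul Z Y.

Definition weakFrob (D : TP 2) : Prop :=
  forall u v : F, tpmul (pure2 u v) D = tpmul D (pure2 v u).
Definition weakFrobSym (D : TP 2) : Prop := weakFrob D /\ flipF D = D.

Definition K m := (m.-tuple int).
Definition BT m := @fsfun (K m) (TP m) (fun _ => 0).

Definition addK m (a b : K m) : K m := [tuple tnth a i + tnth b i | i < m].
Definition oppK m (a : K m) : K m := [tuple - tnth a i | i < m].
Definition zeroK m : K m := [tuple 0 | i < m].
Definition unitK m (i : 'I_m) : K m := [tuple (if j == i then 1 else 0) | j < m].

Definition mkB m (S : {fset K m}) (h : K m -> TP m) : BT m :=
  fsfun_of_fun fsfun_key S h (fun _ => 0).

Definition zeroB m : BT m := mkB fset0%fset (fun _ => 0).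
Definition addB m (f g : BT m) : BT m :=
  mkB (finsupp f `|` finsupp g)%fset (fun z => f z + g z).
Definition oppB m (f : BT m) : BT m := mkB (finsupp f) (fun z => - f z).
Definition subB m (f g : BT m) : BT m := addB f (oppB g).
Definition mulB m (f g : BT m) : BT m :=
  mkB [fset addK a b | a in finsupp f, b in finsupp g]%fset
      (fun z => \sum_(a <- finsupp f) \sum_(b <- finsupp g | addK a b == z)
                   tpmul (f a) (g b)).
Definition monB m (c : TP m) (z : K m) : BT m := mkB [fset z]%fset (fun _ => c).
Definition oneB m : BT m := monB (tpone m) (zeroK m).
Definition constB m (c : TP m) : BT m := monB c (zeroK m).
Definition xB m (i : 'I_m) : BT m := monB (tpone m) (unitK i).

(* membership in B^{(x)m}: Laurent case everything, polynomial case
   only nonnegative exponents *)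
Definition inB (lau : bool) m (f : BT m) : bool :=
  lau || all (fun z : K m => all (fun e : int => 0 <= e) z) (finsupp f).

(* permuting tensor slots of B^{(x)m} (content of slot i goes to slot p i) *)
Definition permK m (p : 'S_m) (z : K m) : K m := [tuple tnth z ((p^-1)%g i) | i < m].
Definition permB m (p : 'S_m) (f : BT m) : BT m :=
  mkB [fset permK p z | z in finsupp f]%fset (fun z => permF p (f (permK (p^-1)%g z))).

Definition placeK m m' (s : 'I_m -> 'I_m') (z : K m) : K m' :=
  [tuple (if [pick j | s j == i] is Some j then tnth z j else 0) | i < m'].
Definition placeB m m' (s : 'I_m -> 'I_m') (f : BT m) : BT m' :=
  mkB [fset placeK s z | z in finsupp f]%fset
      (fun y => \sum_(z <- finsupp f | placeK s z == y) placeF s (f z)).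

Definition beta (D00 D01 D10 D11 : TP 2) : BT 2 :=
  addB (addB (constB D00) (mulB (constB D10) (xB ord0)))
       (addB (mulB (constB D01) (xB ord_max))
             (mulB (constB D11) (mulB (xB ord0) (xB ord_max)))).

(* slots k, k+1 of {0,..,d-1} for k : 'I_d.-1 *)
Definition slo d (i : 'I_d.-1) : 'I_d :=
  Ordinal (leq_trans (ltn_ord i) (leq_pred d)).
Definition shi d (i : 'I_d.-1) : 'I_d :=
  Ordinal (eq_ind _ is_true (ltn_ord i) _ (ltn_predRL i d)).
Definition slots d (i : 'I_d.-1) (j : 'I_2) : 'I_d :=
  if j == ord0 then slo i else shi i.

Definition sigk d (i : 'I_d.-1) (f : BT d) : BT d := permB (tperm (slo i) (shi i)) f.
Definition placeFk d (i : 'I_d.-1) (Y : TP 2) : BT d := constB (placeF (slots i) Y).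

(* rho_k = partial^beta on slots k,k+1:
   the (unique, when it exists) q with (x_k - x_{k+1}) q = beta_k f - sigma_k(f) beta_k *)
Definition rhok d (bt : BT 2) (i : 'I_d.-1) (f : BT d) : BT d :=
  let bk := placeB (slots i) bt in
  epsilon (inhabits (zeroB d))
    (fun q => mulB (subB (xB (slo i)) (xB (shi i))) q
              = subB (mulB bk f) (mulB (sigk i f) bk)).

Definition wreath_rels (lau : bool) d (Rk Sk : 'I_d.-1 -> BT d)
    (rho : 'I_d.-1 -> BT d -> BT d)
    (A : pzRingType) (iota : BT d -> A) (H : 'I_d.-1 -> A) : Prop :=
  [/\ (forall f g, inB lau f -> inB lau g -> iota (addB f g) = iota f + iota g),
      (forall f g, inB lau f -> inB lau g -> iota (mulB f g) = iota f * iota g) &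
      iota (oneB d) = 1] /\
  [/\ (forall i j : 'I_d.-1, nat_of_ord j = i.+1 -> H i * H j * H i = H j * H i * H j),
      (forall i j : 'I_d.-1, (i.+1 < j)%N -> H i * H j = H j * H i),
      (forall i, H i * H i = iota (Sk i) * H i + iota (Rk i)) &
      (forall i f, inB lau f -> H i * iota f = iota (sigk i f) * H i + iota (rho i f))].

(* A (with iota, H) is the algebra presented by generators B^{(x)d}, H_i
   and the relations above: it satisfies them and is initial among rings
   with such data *)
Definition is_wreath lau d Rk Sk rho (A : pzRingType) (iota : BT d -> A)
    (H : 'I_d.-1 -> A) : Prop :=
  wreath_rels lau Rk Sk rho iota H /\
  forall (A' : pzRingType) (iota' : BT d -> A') (H' : 'I_d.-1 -> A'),
    wreath_rels lau Rk Sk rho iota' H' ->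
    exists f : {rmorphism A -> A'},
      ((forall b, inB lau b -> f (iota b) = iota' b) /\ (forall i, f (H i) = H' i)) /\
      (forall g : {rmorphism A -> A'},
         (forall b, inB lau b -> g (iota b) = iota' b) -> (forall i, g (H i) = H' i) ->
         g =1 f).

Definition Rkw d (R : TP 2) (i : 'I_d.-1) : BT d := placeFk i R.
Definition Skw d (D01 D10 : TP 2) (i : 'I_d.-1) : BT d := placeFk i (D10 - D01).

(* v = sum_i v_i (v i), i in {0..n-1}^d *)
Definition Vt n d := {ffun d.-tuple 'I_n -> BT d}.
Definition inV lau n d (v : Vt n d) : bool := [forall j, inB lau (v j)].
Definition addV n d (v w : Vt n d) : Vt n d := [ffun j => addB (v j) (w j)].
Definition actBV n d (v : Vt n d) (b : BT d) : Vt n d := [ffun j => mulB (v j) b].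

Definition swapT n d (i : 'I_d.-1) (j : d.-tuple 'I_n) : d.-tuple 'I_n :=
  [tuple tnth j (tperm (slo i) (shi i) x) | x < d].

(* the action of H_i (extended additively), computed componentwise:
   component j collects the terms v_j(...) coming from v_j b_j and
   from v_{j s_i} b_{j s_i} *)
Definition actHV n d (Rk Sk abark : 'I_d.-1 -> BT d) (rho : 'I_d.-1 -> BT d -> BT d)
    (i : 'I_d.-1) (v : Vt n d) : Vt n d :=
  [ffun j =>
    let jl := tnth j (slo i) in let jh := tnth j (shi i) in
    let bj := v j in let bs := v (swapT i j) in
    let own :=
      if (jl < jh)%N then rho i bj
      else if jl == jh then addB (mulB (abark i) (sigk i bj)) (rho i bj)
      else addB (rho i bj) (mulB (Sk i) (sigk i bj)) in
    let other :=
      if (jh < jl)%N then sigk i bs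
      else if (jl < jh)%N then mulB (Rk i) (sigk i bs)
      else zeroB d in
    addB own other].

Definition is_module lau n d (A : pzRingType) (iota : BT d -> A) (H : 'I_d.-1 -> A)
    (hact : 'I_d.-1 -> Vt n d -> Vt n d) (act : Vt n d -> A -> Vt n d) : Prop :=
  [/\ (forall v a, inV lau v -> inV lau (act v a)),
      (forall v, inV lau v -> act v 1 = v) &
      (forall v a b, inV lau v -> act v (a * b) = act (act v a) b)] /\
  [/\ (forall v a b, inV lau v -> act v (a + b) = addV (act v a) (act v b)),
      (forall v w a, inV lau v -> inV lau w -> act (addV v w) a = addV (act v a) (act w a)),
      (forall v b, inV lau v -> inB lau b -> act v (iota b) = actBV v b) &
      (forall v i, inV lau v -> act v (H i) = hact i v)].

Definition is_EndA lau n d (A : pzRingType) (act : Vt n d -> A -> Vt n d)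
    (phi : Vt n d -> Vt n d) : Prop :=
  [/\ (forall v, inV lau v -> inV lau (phi v)),
      (forall v w, inV lau v -> inV lau w -> phi (addV v w) = addV (phi v) (phi w)) &
      (forall v a, inV lau v -> phi (act v a) = act (phi v) a)].

Definition is_EndS lau n d (A : pzRingType) (act : Vt n d -> A -> Vt n d)
    (psi : Vt n d -> Vt n d) : Prop :=
  [/\ (forall v, inV lau v -> inV lau (psi v)),
      (forall v w, inV lau v -> inV lau w -> psi (addV v w) = addV (psi v) (psi w)) &
      (forall phi, is_EndA lau act phi -> forall v, inV lau v -> psi (phi v) = phi (psi v))].

Definition nzdB lau (z : BT 2) : Prop :=
  forall y : BT 2, inB lau y -> y != zeroB 2 ->
    mulB z y != zeroB 2 /\ mulB y z != zeroB 2.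

End WreathSchur.

(* Main.v *)
Require Import Defs.
From HB Require Import structures.
From mathcomp Require Import all_boot all_order all_fingroup all_algebra all_field.
From mathcomp Require Import finmap.
From mathcomp Require Import zify ring ssrAC boolp.
From Stdlib Require Import ClassicalEpsilon.
Set Implicit Arguments. Unset Strict Implicit. Unset Printing Implicit Defensive.
Import GRing.Theory.
Local Open Scope ring_scope.

(** Write [A] for the wreath algebra and [V] for the tensor space. Let [M] be the space of
    [B^(x)d]-valued functions on the symmetric group, acted on by operators [T_k] as in the
    weight space of [(1, ..., d)]. Every weakly increasing [l : {1..d} -> {1..n}] gives a map
    [f_l : V -> M], [f_l(v)_w = c_(l,w) v_(l o w)], where [c_(l,w)] is the product of the [alpha_pq]
    over the pairs [p < q] with [l(w p) = l(w q)] and [w p < w q]. These maps commute with the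
    [T_k], and they are jointly injective: every tuple is [l o w] for some [(l, w)] with
    [c_(l,w) = 1], namely with [w] decreasing on ties. So it suffices to verify the relations of
    [A] on [M]. There [(x_k - x_(k+1)) T_k = beta_k + N_k] with [N_k] semilinear, and the braid
    relation follows from that of the intertwiners [N_k] and a Yang-Baxter identity for [beta].

    As [n >= d], [M] embeds into [V] as the weight space generated by [v_omega], and
    [theta(m) = sum_w H_w m_w] is an [A]-linear map [M -> A] with [v_omega theta(m) = m] and
    [theta(v_omega a) = a]; this gives faithfulness. If [psi] commutes with [End_A(V)], then
    [v |-> v_omega a theta(v)] shows that [psi] is the action of [theta(psi(v_omega))] on [M],
    and the [f_l] transport this to all of [V]. *)

(** * Tensor powers of [F] *)

(** Two obstacles shape the proof. [F] is noncommutative, but all coefficients (the placed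
    [Delta^ij], [R], [alpha], and the [x_i]) are central, so computations are done over the centre
    of [B^(x)d]. The weak Frobenius property says that a placed central [Delta^ij] does not see the
    exchange of its two slots of [F]; this makes [beta f - sigma(f) beta] divisible by
    [x_k - x_(k+1)]. On [V] each operator has three cases, and a braid relation would multiply them,
    while on [M] there are no ties. The factors [c_(l,w)] bridge the two: at a tie,
    [alpha bar(alpha) = R] settles the ascents of [w] and [bar(alpha) = sigma(alpha) + S] the
    descents. Fractions are avoided: identities are multiplied by differences of variables, which
    act injectively. Operators are defined with Laurent exponents, and [inB] cuts out the polynomial
    case. Finally [A] is known only by its universal property. The action is therefore a ring
    morphism into an endomorphism ring, and a statement on all of [A] is proved by showing that it
    defines a subring containing the generators. *)

Section TensorPower.
Variables (k : fieldType) (F : falgType k).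
Implicit Types m : nat.

Definition pure m (u : 'I_m -> F) : TP F m :=
  [ffun c => \prod_(i < m) coord (eF F) (tnth c i) (u i)].

Lemma eF_coordK (x : F) : x = \sum_i coord (eF F) i x *: tnth (eF F) i.
Proof.
rewrite {1}(coord_vbasis (memvf x)); apply: eq_bigr => i _.
by rewrite (tnth_nth 0).
Qed.

Lemma coord_eF (a b : 'I_(rdim F)) : coord (eF F) a (tnth (eF F) b) = (b == a)%:R.
Proof.
rewrite (tnth_nth 0) coord_free ?(basis_free (vbasisP _)) //.
Qed.

Definition scT m (x : k) (f : TP F m) : TP F m := [ffun c => x * f c].
Local Notation "x *t f" := (scT x f) (at level 40).

Lemma scT0 m (f : TP F m) : 0 *t f = 0.
Proof. by apply/ffunP => c; rewrite !ffunE mul0r. Qed.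

Lemma TP_pure_expand m (f : TP F m) :
  f = \sum_t f t *t pure (fun i => tnth (eF F) (tnth t i)).
Proof.
apply/ffunP => c; rewrite sum_ffunE (bigD1 c) //= [X in _ = _ + X]big1 => [|t tc].
  by rewrite !ffunE big1 ?addr0 => [|i _]; rewrite ?coord_eF ?eqxx ?mulr1.
rewrite !ffunE; have [i ni]: exists i, tnth t i != tnth c i.
  apply/existsP; apply: contraNT tc; rewrite negb_exists => /forallP h.
  by apply/eqP/eq_from_tnth => i; apply/eqP; have := h i; rewrite negbK.
by rewrite (bigD1 i) //= coord_eF (negPf ni) mul0r mulr0.
Qed.

(** Identities between multilinear expressions are checked with this on decomposable tensors, where
    products, placements and permutations act slot by slot. *)
Lemma TP_ind m (P : TP F m -> Prop) :
  P 0 -> (forall f g, P f -> P g -> P (f + g)) ->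
  (forall c u, P (c *t pure u)) -> forall f, P f.
Proof.
move=> P0 PD Pu f; rewrite (TP_pure_expand f).
by elim/big_ind: _ => // t _; apply: Pu.
Qed.

Lemma tpmulDl m (f g h : TP F m) : tpmul (f + g) h = tpmul f h + tpmul g h.
Proof.
apply/ffunP => c; rewrite !ffunE -big_split; apply: eq_bigr => a _ /=.
rewrite -big_split; apply: eq_bigr => b _ /=.
by rewrite ffunE !mulrDl.
Qed.

Lemma tpmulDr m (f g h : TP F m) : tpmul h (f + g) = tpmul h f + tpmul h g.
Proof.
apply/ffunP => c; rewrite !ffunE -big_split; apply: eq_bigr => a _ /=.
rewrite -big_split; apply: eq_bigr => b _ /=.
by rewrite ffunE mulrDr !mulrDl.
Qed.

Lemma tpmulZl m x (f g : TP F m) : tpmul (x *t f) g = x *t tpmul f g.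
Proof.
apply/ffunP => c; rewrite !ffunE [RHS]mulr_sumr; apply: eq_bigr => a _ /=.
rewrite mulr_sumr; apply: eq_bigr => b _ /=.
by rewrite ffunE -!mulrA.
Qed.

Lemma tpmulZr m x (f g : TP F m) : tpmul f (x *t g) = x *t tpmul f g.
Proof.
apply/ffunP => c; rewrite !ffunE [RHS]mulr_sumr; apply: eq_bigr => a _ /=.
rewrite mulr_sumr; apply: eq_bigr => b _ /=.
by rewrite ffunE -!mulrA mulrCA.
Qed.

Lemma tpmul0l m (g : TP F m) : tpmul 0 g = 0.
Proof. by have := tpmulZl 0 0 g; rewrite !scT0. Qed.

Lemma tpmul0r m (g : TP F m) : tpmul g 0 = 0.
Proof. by have := tpmulZr 0 g 0; rewrite !scT0. Qed.

Lemma coord_mul (x y : F) c :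
  coord (eF F) c (x * y) =
  \sum_a \sum_b coord (eF F) a x * coord (eF F) b y * cst a b c.
Proof.
rewrite {1}(eF_coordK x) {1}(eF_coordK y) mulr_suml linear_sum /=.
apply: eq_bigr => a _; rewrite mulr_sumr linear_sum; apply: eq_bigr => b _.
by rewrite -scalerAl -scalerAr !linearZ /= mulrA.
Qed.

Lemma sum_tuple_prod m (T : finType) (G : 'I_m -> T -> k) :
  \sum_(a : m.-tuple T) \prod_(i < m) G i (tnth a i) = \prod_(i < m) \sum_x G i x.
Proof.
rewrite bigA_distr_bigA /=.
rewrite (reindex (fun f : {ffun 'I_m -> T} => [tuple f i | i < m])) /=.
  by apply: eq_bigr => f _; apply: eq_bigr => i _; rewrite tnth_mktuple.
exists (fun a : m.-tuple T => [ffun i => tnth a i]) => a _.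
  by apply/ffunP => i; rewrite ffunE tnth_mktuple.
by apply: eq_from_tnth => i; rewrite tnth_mktuple ffunE.
Qed.

(** The sum over multi-indices of a product over slots factors, leaving [coord_mul] in each slot. *)
Lemma tpmul_pure m (u v : 'I_m -> F) :
  tpmul (pure u) (pure v) = pure (fun i => u i * v i).
Proof.
apply/ffunP => c; rewrite !ffunE.
under [RHS]eq_bigr do rewrite coord_mul.
rewrite -[RHS]sum_tuple_prod; apply: eq_bigr => a _.
rewrite -sum_tuple_prod; apply: eq_bigr => b _.
by rewrite !ffunE -!big_split.
Qed.

Lemma tpone_pure m : tpone F m = pure (fun _ => 1).
Proof. by []. Qed.

Lemma eq_pure m (u v : 'I_m -> F) : u =1 v -> pure u = pure v.
Proof. by move=> uv; apply/ffunP => c; rewrite !ffunE; apply: eq_bigr => i _; rewrite uv. Qed.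

Lemma tpmulA m (f g h : TP F m) : tpmul f (tpmul g h) = tpmul (tpmul f g) h.
Proof.
elim/TP_ind: f => [|f f' IH IH'|x u]; rewrite ?tpmul0l // ?tpmulDl ?IH ?IH' //.
rewrite !tpmulZl; congr (_ *t _).
elim/TP_ind: g => [|f f' IH IH'|x' v]; rewrite ?(tpmul0l, tpmul0r) // ?(tpmulDl, tpmulDr) ?IH ?IH' //.
rewrite ?(tpmulZr, tpmulZl); congr (_ *t _).
elim/TP_ind: h => [|f f' IH IH'|x'' w]; rewrite ?(tpmul0l, tpmul0r) // ?(tpmulDl, tpmulDr) ?IH ?IH' //.
by rewrite ?tpmulZr !tpmul_pure; congr (_ *t _); apply: eq_pure => i; rewrite mulrA.
Qed.

Lemma tpmul1l m (f : TP F m) : tpmul (tpone F m) f = f.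
Proof.
elim/TP_ind: f => [|f f' IH IH'|x u]; rewrite ?tpmul0r // ?tpmulDr ?IH ?IH' //.
by rewrite tpmulZr tpone_pure tpmul_pure; congr (_ *t _); apply: eq_pure => i; rewrite mul1r.
Qed.

Lemma tpmul1r m (f : TP F m) : tpmul f (tpone F m) = f.
Proof.
elim/TP_ind: f => [|f f' IH IH'|x u]; rewrite ?tpmul0l // ?tpmulDl ?IH ?IH' //.
by rewrite tpmulZl tpone_pure tpmul_pure; congr (_ *t _); apply: eq_pure => i; rewrite mulr1.
Qed.

Section Place.
Variables (m m' : nat) (s : 'I_m -> 'I_m') (s_inj : injective s).

Lemma placeFD (f g : TP F m) : placeF s (f + g) = placeF s f + placeF s g.
Proof. by apply/ffunP => c; rewrite !ffunE mulrDl. Qed.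

Lemma placeFZ x (f : TP F m) : placeF s (x *t f) = x *t placeF s f.
Proof. by apply/ffunP => c; rewrite !ffunE -mulrA. Qed.

Lemma placeF0 : placeF s (0 : TP F m) = 0.
Proof. by have := placeFZ 0 0; rewrite !scT0. Qed.

Definition spread (u : 'I_m -> F) (i : 'I_m') : F :=
  if [pick j | s j == i] is Some j then u j else 1.

Lemma spread_in u j : spread u (s j) = u j.
Proof.
rewrite /spread; case: pickP => [j' /eqP/s_inj-> //|/(_ j)].
by rewrite eqxx.
Qed.

Lemma spread_out u i : i \notin codom s -> spread u i = 1.
Proof.
rewrite /spread; case: pickP => // j /eqP <-.
by rewrite codom_f.
Qed.

Lemma placeF_pure u : placeF s (pure u) = pure (spread u).
Proof.
apply/ffunP => c; rewrite !ffunE [RHS](bigID (mem (codom s))) /=; congr (_ * _).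
  rewrite [RHS](reindex_omap s (fun i => [pick j | s j == i])) /=; last first.
    move=> i /codomP[j ->]; case: pickP => [j' /eqP|/(_ j)]; last by rewrite eqxx.
    by move/s_inj ->.
  apply: eq_big => j; last by rewrite tnth_mktuple spread_in.
  rewrite codom_f; case: pickP => [j' /eqP /s_inj -> |/(_ j)]; last by rewrite eqxx.
  by rewrite eqxx.
by apply: eq_bigr => i /spread_out ->.
Qed.

Lemma placeFM (f g : TP F m) : placeF s (tpmul f g) = tpmul (placeF s f) (placeF s g).
Proof.
elim/TP_ind: f => [|f f' IH IH'|x u]; rewrite ?(tpmul0l, placeF0) ?(tpmulDl, placeFD) ?IH ?IH' //.
rewrite ?(placeFZ, tpmulZl); congr (_ *t _).
elim/TP_ind: g => [|f f' IH IH'|y v]; rewrite ?(tpmul0r, placeF0) ?(tpmulDr, placeFD) ?IH ?IH' //.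
rewrite ?(placeFZ, tpmulZr); congr (_ *t _).
rewrite tpmul_pure !placeF_pure tpmul_pure; apply: eq_pure => i.
by rewrite /spread; case: pickP => [j _|_]; rewrite ?mulr1.
Qed.

Definition unspread (z : 'I_m' -> F) (i : 'I_m') : F := if i \in codom s then 1 else z i.

Lemma pure_split z :
  pure z = tpmul (placeF s (pure (fun j => z (s j)))) (pure (unspread z)).
Proof.
rewrite placeF_pure tpmul_pure; apply: eq_pure => i; rewrite /unspread.
have [/codomP[j ->]|iN] := boolP (i \in codom s); first by rewrite spread_in mulr1.
by rewrite spread_out // mul1r.
Qed.

Lemma placeF_unspread_comm (Y : TP F m) z :
  tpmul (placeF s Y) (pure (unspread z)) = tpmul (pure (unspread z)) (placeF s Y).
Proof.
elim/TP_ind: Y => [|f f' IH IH'|x u];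
  rewrite ?(placeF0, tpmul0l, tpmul0r) ?(placeFD, tpmulDl, tpmulDr) ?IH ?IH' //.
rewrite ?(placeFZ, tpmulZl, tpmulZr) placeF_pure !tpmul_pure; congr (_ *t _).
apply: eq_pure => i; rewrite /unspread.
have [_|iN] := boolP (i \in codom s); first by rewrite mulr1 mul1r.
by rewrite spread_out // mulr1 mul1r.
Qed.

(** [pure_split] factors a pure tensor into a part in the slots of [s], handled by the centrality of
    [Y], and a part in the remaining slots, which commutes with anything placed along [s]. *)
Lemma placeF_central (Y : TP F m) : centralF Y -> centralF (placeF s Y).
Proof.
move=> cY Z; elim/TP_ind: Z => [|f f' IH IH'|x u];
  rewrite ?(tpmul0l, tpmul0r) ?(tpmulDl, tpmulDr) ?IH ?IH' //.
rewrite ?(tpmulZl, tpmulZr) (pure_split u); congr (_ *t _).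
by rewrite tpmulA -placeFM cY placeFM -tpmulA placeF_unspread_comm tpmulA.
Qed.
End Place.

Lemma placeF_comp m1 m2 m3 (s : 'I_m2 -> 'I_m3) (t : 'I_m1 -> 'I_m2) (Y : TP F m1) :
  injective s -> injective t -> placeF s (placeF t Y) = placeF (s \o t) Y.
Proof.
move=> si ti; have sti := inj_comp si ti.
elim/TP_ind: Y => [|f f' IH IH'|x u]; rewrite ?placeF0 ?placeFD ?IH ?IH' // !placeFZ !placeF_pure //.
congr (_ *t _); apply: eq_pure => i.
have [/codomP[j ->]|iN] := boolP (i \in codom (s \o t)); first by rewrite spread_in //= !spread_in.
rewrite [RHS]spread_out //.
have [/codomP[j ij]|iN'] := boolP (i \in codom s); last by rewrite spread_out.
rewrite ij spread_in // spread_out //; apply: contra iN => /codomP[l jl].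
by rewrite ij jl; apply/codomP; exists l.
Qed.

Lemma eq_placeF m m' (s t : 'I_m -> 'I_m') (Y : TP F m) : s =1 t -> placeF s Y = placeF t Y.
Proof.
move=> st; apply/ffunP => c; rewrite !ffunE; congr (_ * _).
  by congr (Y _); apply: eq_from_tnth => i; rewrite !tnth_mktuple st.
by apply: eq_bigl => i; rewrite (eq_codom st).
Qed.

Section Perm.
Variables (m : nat).
Implicit Types (p : 'S_m).

Lemma permFD p (f g : TP F m) : permF p (f + g) = permF p f + permF p g.
Proof. by apply/ffunP => c; rewrite !ffunE. Qed.
Lemma permFZ p x (f : TP F m) : permF p (x *t f) = x *t permF p f.
Proof. by apply/ffunP => c; rewrite !ffunE. Qed.
Lemma permF0 p : permF p (0 : TP F m) = 0.
Proof. by apply/ffunP => c; rewrite !ffunE. Qed.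

Lemma permF_pure p u : permF p (pure u) = pure (fun i => u ((p^-1)%g i)).
Proof.
apply/ffunP => c; rewrite !ffunE [RHS](reindex_inj (@perm_inj _ p)).
by apply: eq_bigr => i _; rewrite tnth_mktuple permK.
Qed.

Lemma permFM p (f g : TP F m) : permF p (tpmul f g) = tpmul (permF p f) (permF p g).
Proof.
elim/TP_ind: f => [|f f' IH IH'|x u]; rewrite ?(tpmul0l, permF0) ?(tpmulDl, permFD) ?IH ?IH' //.
rewrite ?(permFZ, tpmulZl); congr (_ *t _).
elim/TP_ind: g => [|f f' IH IH'|y v]; rewrite ?(tpmul0r, permF0) ?(tpmulDr, permFD) ?IH ?IH' //.
by rewrite ?(permFZ, tpmulZr) tpmul_pure !permF_pure tpmul_pure.
Qed.

Lemma permF_one p : permF p (tpone F m) = tpone F m.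
Proof. by rewrite !tpone_pure permF_pure. Qed.

Lemma permF_comp p q (f : TP F m) : permF q (permF p f) = permF (p * q)%g f.
Proof.
apply/ffunP => c; rewrite !ffunE; congr (f _).
by apply: eq_from_tnth => i; rewrite !tnth_mktuple permM.
Qed.

Lemma permF_id (f : TP F m) : permF 1%g f = f.
Proof.
apply/ffunP => c; rewrite !ffunE; congr (f _).
by apply: eq_from_tnth => i; rewrite !tnth_mktuple perm1.
Qed.
End Perm.

Lemma permF_placeF m m' (s : 'I_m -> 'I_m') (p : 'S_m') (Y : TP F m) :
  permF p (placeF s Y) = placeF (p \o s) Y.
Proof.
apply/ffunP => c; rewrite !ffunE; congr (_ * _).
  by congr (Y _); apply: eq_from_tnth => i; rewrite !tnth_mktuple.
rewrite [RHS](reindex_inj (@perm_inj _ p)); apply: eq_big => i; last by rewrite tnth_mktuple.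
congr (~~ _); apply/codomP/codomP => -[j jE]; exists j; first by rewrite jE.
exact: perm_inj jE.
Qed.

(** Permutations of the slots move [slots i], which is [pairI (slo i) (shi i)], to arbitrary ordered
    pairs, including non-neighbours and pairs with [p > q]. *)
Definition pairI m (p q : 'I_m) (j : 'I_2) : 'I_m := if j == ord0 then p else q.

Lemma pairI_inj m (p q : 'I_m) : p != q -> injective (pairI p q).
Proof.
move=> pq i j; rewrite /pairI; case: ifP => i0; case: ifP => j0.
- by rewrite (eqP i0) (eqP j0).
- by move/eqP; rewrite (negPf pq).
- by move/eqP; rewrite eq_sym (negPf pq).
move=> _; apply/val_inj; case: i i0 => -[|[|i]] // hi _; case: j j0 => -[|[|j]] //.
Qed.

Lemma comp_pairI m m' (f : 'I_m -> 'I_m') (p q : 'I_m) :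
  f \o pairI p q =1 pairI (f p) (f q).
Proof. by move=> j; rewrite /= /pairI; case: ifP. Qed.

Lemma codom_pairI m (p q i : 'I_m) : (i \in codom (pairI p q)) = (i == p) || (i == q).
Proof.
apply/codomP/orP => [[j ->]|[] /eqP ->].
- by rewrite /pairI; case: ifP => _; [left|right].
- by exists ord0.
- by exists ord_max.
Qed.

Lemma placeF_flip m (p q : 'I_m) (Y : TP F 2) :
  placeF (pairI q p) Y = placeF (pairI p q) (flipF Y).
Proof.
apply/ffunP => c; rewrite !ffunE; congr (_ * _).
  congr (Y _); apply: eq_from_tnth => i; rewrite !tnth_mktuple /pairI.
  case: tpermP => [->|->|] //; case: i => -[|[|i]] //= hi h0 h1.
    by case: h0; apply/val_inj.
  by case: h1; apply/val_inj.
by apply: eq_bigl => i; rewrite !codom_pairI orbC.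
Qed.

Lemma pure2E (u : 'I_2 -> F) : pure u = pure2 (u ord0) (u ord_max).
Proof.
apply/ffunP => c; rewrite !ffunE !big_ord_recl big_ord0 mulr1.
by have -> : lift ord0 ord0 = ord_max :> 'I_2 by apply/val_inj.
Qed.

(* The weak Frobenius condition for central [D] says that [D] placed in slots [p, q] absorbs the
   exchange of these slots. *)
Lemma placeF_weakFrob m (p q : 'I_m) (D : TP F 2) (Z : TP F m) :
  p != q -> centralF D -> weakFrob D ->
  tpmul (placeF (pairI p q) D) Z = tpmul (placeF (pairI p q) D) (permF (tperm p q) Z).
Proof.
move=> pq cD fD; have s_inj := pairI_inj pq; elim/TP_ind: Z => [|f f' IH IH'|x z];
  rewrite ?(permF0, tpmul0r) ?(permFD, tpmulDr) ?IH ?IH' //.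
rewrite ?(permFZ, tpmulZr) (pure_split s_inj z); congr (_ *t _).
rewrite permFM permF_placeF tpmulA -placeFM // cD.
rewrite (eq_placeF _ (comp_pairI _ _ _)) tpermL tpermR [placeF (pairI q p) _]placeF_flip.
rewrite tpmulA -placeFM //.
congr (tpmul (placeF _ _) _).
  by rewrite /flipF permF_pure !pure2E /= fD tpermV tpermL tpermR.
rewrite permF_pure; apply: eq_pure => i; rewrite /unspread tpermV !codom_pairI.
case: tpermP => [->|->|/eqP/negPf -> /eqP/negPf -> //]; by rewrite !eqxx ?orbT.
Qed.
End TensorPower.

(** * The ring [F^(x)m[x_1^(+-1), ..., x_m^(+-1)]] *)

Local Notation permK := Defs.permK.

Section ExponentVectors.
Variable m : nat.
Implicit Types a b c : K m.

Lemma addKC a b : addK a b = addK b a.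
Proof. by apply: eq_from_tnth => i; rewrite !tnth_mktuple addrC. Qed.
Lemma addKA a b c : addK a (addK b c) = addK (addK a b) c.
Proof. by apply: eq_from_tnth => i; rewrite !tnth_mktuple addrA. Qed.
Lemma add0K a : addK (zeroK m) a = a.
Proof. by apply: eq_from_tnth => i; rewrite !tnth_mktuple add0r. Qed.
Lemma addKN a b : addK a (addK b (oppK a)) = b.
Proof. by apply: eq_from_tnth => i; rewrite !tnth_mktuple addrC subrK. Qed.
Lemma addKNN a b : addK (addK a b) (oppK a) = b.
Proof. by apply: eq_from_tnth => i; rewrite !tnth_mktuple addrC addKr. Qed.
Lemma oppKD a b : oppK (addK a b) = addK (oppK a) (oppK b).
Proof. by apply: eq_from_tnth => i; rewrite !tnth_mktuple opprD. Qed.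
Lemma oppK0 : oppK (zeroK m) = zeroK m.
Proof. by apply: eq_from_tnth => i; rewrite !tnth_mktuple oppr0. Qed.

Lemma permKD (p : 'S_m) a b : permK p (addK a b) = addK (permK p a) (permK p b).
Proof. by apply: eq_from_tnth => i; rewrite !tnth_mktuple. Qed.
Lemma permK0 (p : 'S_m) : permK p (zeroK m) = zeroK m.
Proof. by apply: eq_from_tnth => i; rewrite !tnth_mktuple. Qed.
Lemma permK_comp (p q : 'S_m) a : permK q (permK p a) = permK (p * q)%g a.
Proof. by apply: eq_from_tnth => i; rewrite !tnth_mktuple invMg permM. Qed.
Lemma permK_id a : permK 1%g a = a.
Proof. by apply: eq_from_tnth => i; rewrite !tnth_mktuple invg1 perm1. Qed.
Lemma permK_unit (p : 'S_m) i : permK p (unitK i) = unitK (p i).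
Proof.
apply: eq_from_tnth => j; rewrite !tnth_mktuple.
by rewrite (canF_eq (perm.permKV p)).
Qed.
End ExponentVectors.

Section LaurentRing.
Variables (k : fieldType) (F : falgType k) (m : nat).
Local Notation TP := (TP F m).
Local Notation BT := (BT F m).
Implicit Types (f g h : BT) (z a b : K m) (c : TP).

Lemma mkBE (S : {fset K m}) (h : K m -> TP) z :
  (mkB S h : BT) z = if z \in S then h z else 0.
Proof. exact: fsfun_fun. Qed.

Lemma zeroBE z : zeroB F m z = 0.
Proof. by rewrite mkBE. Qed.

Lemma BTP f g : (forall z, f z = g z) -> f = g.
Proof. by move=> fg; apply/fsfunP. Qed.

Lemma notin_supp f z : z \notin finsupp f -> f z = 0.
Proof. by rewrite memNfinsupp => /eqP. Qed.

Lemma addBE f g z : addB f g z = f z + g z.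
Proof.
rewrite mkBE; case: ifP => //; rewrite in_fsetU => /negbT; rewrite negb_or => /andP[zf zg].
by rewrite !notin_supp ?addr0.
Qed.

Lemma oppBE f z : oppB f z = - f z.
Proof. by rewrite mkBE; case: ifPn => // zf; rewrite notin_supp ?oppr0. Qed.

Lemma addBA : associative (@addB k F m).
Proof. by move=> f g h; apply: BTP => z; rewrite !addBE addrA. Qed.
Lemma addBC : commutative (@addB k F m).
Proof. by move=> f g; apply: BTP => z; rewrite !addBE addrC. Qed.
Lemma add0B : left_id (zeroB F m) (@addB k F m).
Proof. by move=> f; apply: BTP => z; rewrite addBE zeroBE add0r. Qed.
Lemma addNB : left_inverse (zeroB F m) (@oppB k F m) (@addB k F m).
Proof. by move=> f; apply: BTP => z; rewrite addBE oppBE zeroBE addNr. Qed.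

HB.instance Definition _ := Choice.on BT.
HB.instance Definition _ := GRing.isZmodule.Build BT addBA addBC add0B addNB.

Lemma BTD f g z : (f + g) z = f z + g z. Proof. exact: addBE. Qed.
Lemma BTN f z : (- f) z = - f z. Proof. exact: oppBE. Qed.
Lemma BT0 z : (0 : BT) z = 0. Proof. exact: zeroBE. Qed.

Lemma supp_sum (V : zmodType) f (E : {fset K m}) (G : K m -> TP -> V) :
  (forall z, G z 0 = 0) -> {subset finsupp f <= E} ->
  \sum_(z <- finsupp f) G z (f z) = \sum_(z <- E) G z (f z).
Proof.
move=> G0 /fsubsetP fE; apply: big_fset_incl => // z _ zf.
by rewrite notin_supp.
Qed.

(** For each [a] only the exponent [b = z - a] can contribute. Outside the declared support of the
    product all terms vanish, so no side condition on [z] remains. *)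
Lemma mulBE f g z :
  mulB f g z = \sum_(a <- finsupp f) tpmul (f a) (g (addK z (oppK a))).
Proof.
have inner a : \sum_(b <- finsupp g | addK a b == z) tpmul (f a) (g b) =
   tpmul (f a) (g (addK z (oppK a))).
  have E b : (addK a b == z) = (b == addK z (oppK a)).
    by apply/eqP/eqP => [<-|->]; rewrite ?addKNN ?addKN.
  under eq_bigl do rewrite E.
  have [zg|zg] := boolP (addK z (oppK a) \in finsupp g); last first.
    rewrite (notin_supp zg) tpmul0r big_seq_cond big_pred0 // => b.
    by apply: contraNF zg => /andP[bg /eqP <-].
  by rewrite -big_filter filter_pred1_uniq ?fset_uniq // big_seq1.
rewrite mkBE; case: ifPn => [_|zN]; first by apply: eq_bigr => a _; apply: inner.
rewrite big_seq big1 // => a af; have [zg|zg] := boolP (addK z (oppK a) \in finsupp g).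
  by case/negP: zN; rewrite -(addKN a z); apply: in_imfset2.
by rewrite (notin_supp zg) tpmul0r.
Qed.

Lemma mulBE_sub f g z (E : {fset K m}) : {subset finsupp f <= E} ->
  mulB f g z = \sum_(a <- E) tpmul (f a) (g (addK z (oppK a))).
Proof.
move=> fE; rewrite mulBE.
by apply: (supp_sum (G := fun a c => tpmul c (g (addK z (oppK a))))) => // a; rewrite tpmul0l.
Qed.

Lemma mulBDr f g h : mulB f (g + h) = mulB f g + mulB f h.
Proof.
apply: BTP => z; rewrite BTD !mulBE -big_split; apply: eq_bigr => a _ /=.
by rewrite BTD tpmulDr.
Qed.

Lemma mulBDl f g h : mulB (f + g) h = mulB f h + mulB g h.
Proof.
apply: BTP => z; rewrite BTD.
have sub1 : {subset finsupp f <= (finsupp f `|` finsupp g)%fset} by apply/fsubsetP/fsubsetUl.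
have sub2 : {subset finsupp g <= (finsupp f `|` finsupp g)%fset} by apply/fsubsetP/fsubsetUr.
have sub3 : {subset finsupp (f + g) <= (finsupp f `|` finsupp g)%fset}.
  move=> y; rewrite in_fsetU; apply: contraLR; rewrite negb_or => /andP[yf yg].
  by rewrite memNfinsupp BTD !notin_supp ?addr0.
rewrite (mulBE_sub _ _ sub1) (mulBE_sub _ _ sub2) (mulBE_sub _ _ sub3) -big_split /=.
by apply: eq_bigr => a _; rewrite BTD tpmulDl.
Qed.

Lemma monBE c z y : monB c z y = if y == z then c else 0.
Proof. by rewrite mkBE in_fset1. Qed.

Lemma mul_monBE c a g z : mulB (monB c a) g z = tpmul c (g (addK z (oppK a))).
Proof.
rewrite (@mulBE_sub _ _ _ [fset a]%fset) ?big_seq_fset1 ?monBE ?eqxx // => y.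
by rewrite in_fset1; apply: contraTT => /negPf ya; rewrite memNfinsupp monBE ya.
Qed.

Lemma mul_monB c c' a b : mulB (monB c a) (monB c' b) = monB (tpmul c c') (addK a b).
Proof.
apply: BTP => z; rewrite mul_monBE !monBE.
have -> : (addK z (oppK a) == b) = (z == addK a b).
  by apply/eqP/eqP => [<-|->]; rewrite ?addKNN ?addKN.
by case: ifP => // _; rewrite tpmul0r.
Qed.

Lemma BTsum (I : Type) (r : seq I) P (G : I -> BT) z :
  (\sum_(i <- r | P i) G i) z = \sum_(i <- r | P i) G i z.
Proof. by elim/big_rec2: _ => [|i x y _ <-]; rewrite ?BT0 ?BTD. Qed.

Lemma monB_expand f : f = \sum_(z <- finsupp f) monB (f z) z.
Proof.
apply: BTP => y; rewrite BTsum; under eq_bigr do rewrite monBE eq_sym.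
rewrite -big_mkcond /=; have [yf|yf] := boolP (y \in finsupp f).
  by rewrite -big_filter filter_pred1_uniq ?fset_uniq // big_seq1.
by rewrite notin_supp // big_seq_cond big_pred0 // => b; apply: contraNF yf => /andP[bf /eqP <-].
Qed.

Lemma BT_ind (P : BT -> Prop) :
  P 0 -> (forall f g, P f -> P g -> P (f + g)) -> (forall c z, P (monB c z)) ->
  forall f, P f.
Proof.
by move=> P0 PD Pm f; rewrite (monB_expand f); elim/big_ind: _.
Qed.

Lemma mul0B f : mulB 0 f = 0.
Proof. by apply: (@addrI _ (mulB 0 f)); rewrite -mulBDl !addr0. Qed.
Lemma mulB0 f : mulB f 0 = 0.
Proof. by apply: (@addrI _ (mulB f 0)); rewrite -mulBDr !addr0. Qed.

Lemma mulBA : associative (@mulB k F m).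
Proof.
move=> f g h; elim/BT_ind: f => [|f f' IH IH'|c a]; rewrite ?mul0B // ?mulBDl ?IH ?IH' //.
elim/BT_ind: g => [|f f' IH IH'|c' b]; rewrite ?(mul0B, mulB0) // ?(mulBDl, mulBDr) ?IH ?IH' //.
apply: BTP => z; rewrite mul_monB !mul_monBE tpmulA; congr (tpmul _ (h _)).
by rewrite -addKA oppKD.
Qed.

Lemma mul1B : left_id (oneB F m) (@mulB k F m).
Proof.
by move=> f; apply: BTP => z; rewrite mul_monBE tpmul1l oppK0 addKC add0K.
Qed.

Lemma mulB1 : right_id (oneB F m) (@mulB k F m).
Proof.
elim/BT_ind => [|f f' IH IH'|c a]; rewrite ?mul0B // ?mulBDl ?IH ?IH' //.
by rewrite mul_monB tpmul1r addKC add0K.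
Qed.

Lemma mulBDl' : left_distributive (@mulB k F m) +%R.
Proof. by move=> f g h; rewrite mulBDl. Qed.
Lemma mulBDr' : right_distributive (@mulB k F m) +%R.
Proof. by move=> f g h; rewrite mulBDr. Qed.

HB.instance Definition _ := GRing.Zmodule_isPzRing.Build BT mulBA mul1B mulB1 mulBDl' mulBDr'.

Lemma monBM c c' a b : monB c a * monB c' b = monB (tpmul c c') (addK a b).
Proof. exact: mul_monB. Qed.
Lemma monBD c c' a : monB (c + c') a = monB c a + monB c' a.
Proof. by apply: BTP => z; rewrite BTD !monBE; case: ifP => // _; rewrite addr0. Qed.
Lemma monB0 a : monB (0 : TP) a = 0.
Proof. by apply: BTP => z; rewrite BT0 monBE; case: ifP. Qed.
Lemma constBM c c' : constB (tpmul c c') = constB c * constB c'.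
Proof. by rewrite /constB monBM add0K. Qed.
Lemma constBD c c' : constB (c + c') = constB c + constB c'.
Proof. exact: monBD. Qed.
Lemma constB_central c : centralF c -> forall f, constB c * f = f * constB c.
Proof.
move=> cc; elim/BT_ind => [|f f' IH IH'|c' a]; rewrite ?(mul0r, mulr0) ?(mulrDl, mulrDr) ?IH ?IH' //.
by rewrite !monBM addKC cc.
Qed.

Lemma xB_central (i : 'I_m) f : xB F i * f = f * xB F i.
Proof.
elim/BT_ind: f => [|f f' IH IH'|c' a]; rewrite ?(mul0r, mulr0) ?(mulrDl, mulrDr) ?IH ?IH' //.
by rewrite !monBM addKC tpmul1l tpmul1r.
Qed.

Lemma mul_xB (i : 'I_m) f z : (xB F i * f) z = f (addK z (oppK (unitK i))).
Proof. by rewrite [LHS]mul_monBE tpmul1l. Qed.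

Lemma permBE (p : 'S_m) f z : permB p f z = permF p (f (permK (p^-1)%g z)).
Proof.
rewrite mkBE; case: ifPn => // zN; rewrite notin_supp ?permF0 //.
apply: contra zN => zf; rewrite -[z]permK_id -(mulVg p) -permK_comp.
exact: in_imfset.
Qed.

Lemma permBD (p : 'S_m) : {morph permB (k := k) (F := F) p : f g / f + g}.
Proof. by move=> f g; apply: BTP => z; rewrite BTD !permBE BTD permFD. Qed.

Lemma permB0 (p : 'S_m) : permB p (0 : BT) = 0.
Proof. by apply: (@addrI _ (permB p 0)); rewrite -permBD !addr0. Qed.

Lemma permBN (p : 'S_m) f : permB p (- f) = - permB p f.
Proof. by apply: (@addrI _ (permB p f)); rewrite -permBD !subrr permB0. Qed.

Lemma permB_mon (p : 'S_m) c z : permB p (monB c z) = monB (permF p c) (permK p z).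
Proof.
apply: BTP => y; rewrite permBE !monBE.
have -> : (permK p^-1 y == z) = (y == permK p z).
  by apply/eqP/eqP => [<-|->]; rewrite permK_comp ?mulVg ?mulgV permK_id.
by case: ifP => // _; rewrite permF0.
Qed.

Lemma permBM (p : 'S_m) : {morph permB (k := k) (F := F) p : f g / f * g}.
Proof.
move=> f g; elim/BT_ind: f => [|f f' IH IH'|c a]; rewrite ?(mul0r, permB0) // ?(mulrDl, permBD) ?IH ?IH' //.
elim/BT_ind: g => [|f f' IH IH'|c' b]; rewrite ?(mulr0, permB0) // ?(mulrDr, permBD) ?IH ?IH' //.
by rewrite monBM !permB_mon monBM permFM permKD.
Qed.

Lemma permB1 (p : 'S_m) : permB p (1 : BT) = 1.
Proof. by rewrite [LHS]permB_mon permF_one permK0. Qed.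

Lemma permB_comp (p q : 'S_m) f : permB q (permB p f) = permB (p * q)%g f.
Proof. by apply: BTP => z; rewrite !permBE permF_comp permK_comp invMg. Qed.

Lemma permB_id f : permB 1%g f = f.
Proof. by apply: BTP => z; rewrite permBE permF_id invg1 permK_id. Qed.

Lemma permB_tpermK (p q : 'I_m) : involutive (permB (k := k) (F := F) (tperm p q)).
Proof. by move=> f; rewrite permB_comp tperm2 permB_id. Qed.

Lemma permB_x (p : 'S_m) (i : 'I_m) : permB p (xB F i) = xB F (p i).
Proof. by rewrite permB_mon permF_one permK_unit. Qed.

Lemma permB_const (p : 'S_m) c : permB p (constB c) = constB (permF p c).
Proof. by rewrite permB_mon permK0. Qed.

Section Nonneg.
Variable lau : bool.

Definition nnK z := lau || all (fun e : int => 0 <= e) z.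

Lemma inB_supp f : inB lau f = all nnK (finsupp f).
Proof.
rewrite /inB /nnK; case: (lau) => //=.
by rewrite all_predT.
Qed.

Lemma inBP f : reflect (forall z, f z != 0 -> nnK z) (inB lau f).
Proof.
rewrite inB_supp; apply: (iffP allP) => h z; last by rewrite mem_finsupp; apply: h.
by move=> fz; apply: h; rewrite mem_finsupp.
Qed.

Lemma nnKP z : reflect (forall i, lau || (0 <= tnth z i)) (nnK z).
Proof.
rewrite /nnK; case: (lau) => /=; first by constructor.
by apply: (iffP all_tnthP).
Qed.

Lemma nnKD a b : nnK a -> nnK b -> nnK (addK a b).
Proof.
move=> /nnKP ha /nnKP hb; apply/nnKP => i; have := ha i; have := hb i.
by case: (lau) => //= ? ?; rewrite tnth_mktuple; lia.
Qed.

Lemma inB_mon c z : nnK z -> inB lau (monB c z).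
Proof. by move=> zn; apply/inBP => y; rewrite monBE; have [->|_] := eqVneq y z; rewrite ?eqxx. Qed.

Lemma inB0 : inB lau (0 : BT).
Proof. by apply/inBP => z; rewrite BT0 eqxx. Qed.

Lemma inBD f g : inB lau f -> inB lau g -> inB lau (f + g).
Proof.
move=> /inBP hf /inBP hg; apply/inBP => z; rewrite BTD.
have [fz|fz _] := eqVneq (f z) 0; last exact: hf.
by rewrite fz add0r; apply: hg.
Qed.

Lemma inBN f : inB lau f -> inB lau (- f).
Proof. by move=> /inBP hf; apply/inBP => z; rewrite BTN oppr_eq0; apply: hf. Qed.

Lemma inB_ind (P : BT -> Prop) :
  P 0 -> (forall f g, P f -> P g -> P (f + g)) -> (forall c z, nnK z -> P (monB c z)) ->
  forall f, inB lau f -> P f.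
Proof.
move=> P0 PD Pm f; rewrite inB_supp => /allP hf; rewrite (monB_expand f) big_seq.
by elim/big_ind: _ => // z zf; apply: Pm; apply: hf.
Qed.

Lemma inBM f g : inB lau f -> inB lau g -> inB lau (f * g).
Proof.
move=> + hg; move: f; apply: inB_ind => [|f1 f2|c a ha]; first by rewrite mul0r inB0.
  by rewrite mulrDl; apply: inBD.
move: g hg; apply: inB_ind => [|g1 g2|c' b hb]; first by rewrite mulr0 inB0.
  by rewrite mulrDr; apply: inBD.
by rewrite monBM inB_mon ?nnKD.
Qed.

Lemma inB_const c : inB lau (constB c).
Proof. by apply/inB_mon/nnKP => i; rewrite tnth_mktuple orbT. Qed.

Lemma inB1 : inB lau (1 : BT).
Proof. exact: inB_const. Qed.

Lemma inB_x (i : 'I_m) : inB lau (xB F i).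
Proof. by apply/inB_mon/nnKP => j; rewrite tnth_mktuple; case: ifP; rewrite orbT. Qed.

Lemma inB_perm (p : 'S_m) f : inB lau f -> inB lau (permB p f).
Proof.
move: f; apply: inB_ind => [|f1 f2|c z hz]; first by rewrite permB0 inB0.
  by rewrite permBD; apply: inBD.
by rewrite permB_mon inB_mon //; apply/nnKP => i; rewrite tnth_mktuple; apply: (nnKP _ hz).
Qed.
End Nonneg.

(** The equation makes [f] invariant under the exponent shift by [e_p - e_q]. A nonzero value would
    recur at infinitely many exponents, as the entry at [p] grows along the orbit, against finite
    support. *)
Lemma xB_sub_lreg (p q : 'I_m) f : p != q -> (xB F p - xB F q) * f = 0 -> f = 0.
Proof.
move=> pq h; apply: BTP => z; rewrite BT0.
pose sh z := addK (addK z (unitK p)) (oppK (unitK q)).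
have step y : f (sh y) = f y.
  have := congr1 (fun g : BT => g (addK y (unitK p))) h.
  rewrite /= mulrBl BTD BTN BT0 !mul_xB => /eqP; rewrite subr_eq0 => /eqP <-.
  by congr (f _); apply: eq_from_tnth => i; rewrite !tnth_mktuple addrK.
apply/eqP/negPn/negP => fz.
have it n : f (iter n sh z) = f z by elim: n => //= n IH; rewrite step.
have itp n : tnth (iter n sh z) p = tnth z p + n%:Z.
  elim: n => [|n IH] /=; first by rewrite addr0.
  rewrite !tnth_mktuple IH eqxx (negPf pq) /=; lia.
have : (size [seq iter n sh z | n <- iota 0 (size (finsupp f)).+1] <= size (finsupp f))%N.
  apply: uniq_leq_size; last by move=> y /mapP[n _ ->]; rewrite mem_finsupp it.
  rewrite map_inj_uniq ?iota_uniq // => a b /(congr1 (fun y : K m => tnth y p)).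
  by rewrite !itp; lia.
by rewrite size_map size_iota ltnn.
Qed.

(* Telescoping [x_p^r - x_q^r]. *)
Lemma xB_sub_dvd_step lau (p q : 'I_m) c (r : nat) (z : K m) :
  p != q -> nnK lau z -> (lau || (r%:Z <= tnth z p)) ->
  exists2 h, inB lau h & (xB F p - xB F q) * h =
     monB c z - monB c [tuple tnth z i + r%:Z * (tnth (unitK q) i - tnth (unitK p) i) | i < m].
Proof.
move=> pq; elim: r z => [|r IH] z hz hr.
  exists 0; first exact: inB0.
  rewrite mulr0; apply/esym/eqP; rewrite subr_eq0; apply/eqP; congr monB.
  by apply: eq_from_tnth => i; rewrite tnth_mktuple mul0r addr0.
(* The first term of the quotient is [c x^z1], since [(x_p - x_q) c x^z1 = c x^z - c x^z2]; the
   entry of [z2] at [p] is one less, which feeds the induction. The bound on [r] keeps [z1]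
   nonnegative in the polynomial case. *)
pose z1 : K m := addK z (oppK (unitK p)); pose z2 := addK z1 (unitK q).
have hz1 : nnK lau z1.
  apply/nnKP => i; have := nnKP _ _ hz i; move: hr; rewrite !tnth_mktuple.
  by case: (lau) => //=; case: eqP => [->|_]; lia.
have hz2 : nnK lau z2.
  apply/nnKP => i; have := nnKP _ _ hz1 i.
  have -> : tnth z2 i = tnth z1 i + (if i == q then 1 else 0) by rewrite !tnth_mktuple.
  by case: (lau) => //=; case: eqP => _; lia.
have [||h hh hE] := IH z2; first exact: hz2.
  move: hr; case: (lau) => //=; rewrite !tnth_mktuple eqxx (negPf pq); lia.
exists (monB c z1 + h); first by apply: inBD => //; apply: inB_mon.
rewrite mulrDr hE mulrBl !monBM !tpmul1l.
have -> : addK (unitK p) z1 = z by rewrite addKN.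
rewrite [addK (unitK q) z1]addKC addrA subrK; congr (_ - monB c _).
by apply: eq_from_tnth => i; rewrite !tnth_mktuple; do 2!case: eqP => _; lia.
Qed.

Lemma xB_sub_dvd lau (p q : 'I_m) c (z : K m) : p != q -> nnK lau z ->
  exists2 h, inB lau h & (xB F p - xB F q) * h = monB c z - monB c (permK (tperm p q) z).
Proof.
(* Transposing the entries means moving [z_p - z_q] units from [p] to [q], which telescopes when
   [z_q <= z_p]. The other case exchanges [p] and [q] and negates the quotient. *)
have main (p' q' : 'I_m) z' : p' != q' -> nnK lau z' -> tnth z' q' <= tnth z' p' ->
    exists2 h, inB lau h & (xB F p' - xB F q') * h = monB c z' - monB c (permK (tperm p' q') z').
  move=> pq hz le; have rE : (`|tnth z' p' - tnth z' q'|%N)%:Z = tnth z' p' - tnth z' q' by lia.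
  have [|h hh hE] := @xB_sub_dvd_step lau p' q' c `|tnth z' p' - tnth z' q'|%N z' pq hz.
    rewrite rE; have := nnKP _ _ hz q'; case: (lau) => //=; lia.
  exists h; rewrite ?hE // rE; congr (_ - monB c _).
  apply: eq_from_tnth => i; rewrite !tnth_mktuple tpermV.
  have qp : (q' == p') = false by rewrite eq_sym (negPf pq).
  by case: tpermP => [->|->|/eqP/negPf ip /eqP/negPf iq];
     rewrite ?eqxx ?(negPf pq) ?qp ?ip ?iq; lia.
move=> pq hz; have [le|/Order.POrderTheory.ltW le] := Order.TotalTheory.leP (tnth z q) (tnth z p); first exact: main.
have [|h hh hE] := main q p z _ hz le; first by rewrite eq_sym.
exists (- h); first exact: inBN.
rewrite mulrN -mulNr opprB hE.
by rewrite [tperm q p]tpermC.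
Qed.
End LaurentRing.

(** * The centre of [B^(x)m] as a ring of scalars *)

Section Center.
Variables (k : fieldType) (F : falgType k) (m : nat).
Local Notation BT := (BT F m).

Definition centralB : {pred BT} := [pred z : BT | `[< forall f : BT, z * f = f * z >]].

Lemma centralBP (z : BT) : reflect (forall f : BT, z * f = f * z) (z \in centralB).
Proof. exact: asboolP. Qed.

Lemma centralB_subring : subring_closed centralB.
Proof.
split=> [|x y /centralBP hx /centralBP hy|x y /centralBP hx /centralBP hy];
  apply/centralBP => f.
- by rewrite mul1r mulr1.
- by rewrite mulrBl mulrBr hx hy.
- by rewrite -mulrA hy mulrA hx mulrA.
Qed.


(** A commutative ring of scalars containing every coefficient of the action formulas; over it,
    identities between coefficients are accessible to [ring] although [F] is noncommutative. *)
Record center := Center { center_val : BT; _ : center_val \in centralB }.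
HB.instance Definition _ := [isSub for center_val].
HB.instance Definition _ := [Choice of center by <:].
HB.instance Definition _ := GRing.SubChoice_isSubPzRing.Build BT centralB center centralB_subring.

Lemma center_mulC : @commutative center center *%R.
Proof.
move=> x y; apply: val_inj; rewrite !rmorphM.
by apply/centralBP; apply: valP.
Qed.
HB.instance Definition _ := GRing.PzRing_hasCommutativeMul.Build center center_mulC.

Lemma val_ZM (a b : center) : val (a * b) = val a * val b. Proof. exact: rmorphM. Qed.
Lemma val_ZD (a b : center) : val (a + b) = val a + val b. Proof. exact: rmorphD. Qed.
Lemma val_ZB (a b : center) : val (a - b) = val a - val b. Proof. exact: rmorphB. Qed.
Lemma val_Z1 : val (1 : center) = 1. Proof. exact: rmorph1. Qed.

Definition scaleZ (z : center) (f : BT) : BT := val z * f.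
Lemma scaleZA (a b : center) (v : BT) : scaleZ a (scaleZ b v) = scaleZ (a * b) v.
Proof. by rewrite /scaleZ val_ZM mulrA. Qed.
Lemma scaleZ1 : left_id 1 scaleZ.
Proof. by move=> v; rewrite /scaleZ val_Z1 mul1r. Qed.
Lemma scaleZDr : right_distributive scaleZ +%R.
Proof. by move=> a u v; rewrite /scaleZ mulrDr. Qed.
Lemma scaleZDl (v : BT) : {morph scaleZ^~ v : a b / a + b}.
Proof. by move=> a b; rewrite /scaleZ val_ZD mulrDl. Qed.
HB.instance Definition _ :=
  GRing.Zmodule_isLmodule.Build center BT scaleZA scaleZ1 scaleZDr scaleZDl.

Lemma scaleZE (z : center) (f : BT) : z *: f = val z * f.
Proof. by []. Qed.


(** On a noncentral argument the result is the default [0]; hence the centrality hypotheses in most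
    rules for [cZ]. *)
Definition toZ (f : BT) : center := insubd (0 : center) f.

Lemma toZK (f : BT) : f \in centralB -> val (toZ f) = f.
Proof. exact: insubdK. Qed.

Lemma toZ_val (z : center) : toZ (val z) = z.
Proof. exact: valKd. Qed.

Lemma scaleZAr (z : center) (f g : BT) : z *: (f * g) = f * (z *: g).
Proof. by rewrite !scaleZE !mulrA (centralBP _ (valP z)). Qed.

Lemma scaleZAl (z : center) (f g : BT) : z *: (f * g) = (z *: f) * g.
Proof. by rewrite !scaleZE mulrA. Qed.

Lemma permB_central (w : 'S_m) (z : BT) : z \in centralB -> permB w z \in centralB.
Proof.
move/centralBP => hz; apply/centralBP => f.
have -> : f = permB w (permB (w^-1)%g f) by rewrite permB_comp mulVg permB_id.
by rewrite -!permBM hz.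
Qed.

Definition permZ (w : 'S_m) (z : center) : center := Center (permB_central w (valP z)).

Lemma val_permZ w z : val (permZ w z) = permB w (val z). Proof. by []. Qed.

Fact permZ_additive w : zmod_morphism (permZ w).
Proof. by move=> a b; apply: val_inj; rewrite val_ZB !val_permZ val_ZB permBD permBN. Qed.
Fact permZ_multiplicative w : monoid_morphism (permZ w).
Proof.
split; first by apply: val_inj; exact: permB1.
by move=> a b; apply: val_inj; rewrite val_ZM !val_permZ val_ZM permBM.
Qed.
HB.instance Definition _ w := GRing.isZmodMorphism.Build center center (permZ w) (permZ_additive w).
HB.instance Definition _ w := GRing.isMonoidMorphism.Build center center (permZ w) (permZ_multiplicative w).

Lemma permBZ w (z : center) (f : BT) : permB w (z *: f) = permZ w z *: permB w f.
Proof. by rewrite !scaleZE permBM. Qed.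

Definition xZ (i : 'I_m) : center := toZ (xB F i).
Definition cZ (Y : TP F 2) (p q : 'I_m) : center := toZ (constB (placeF (pairI p q) Y)).

Lemma val_xZ i : val (xZ i) = xB F i.
Proof. by rewrite toZK //; apply/centralBP => f; apply: xB_central. Qed.

Lemma permZ_x w i : permZ w (xZ i) = xZ (w i).
Proof. by apply: val_inj; rewrite val_permZ !val_xZ permB_x. Qed.

Section Pair.
Variables (p q : 'I_m).
Hypothesis pq : p != q.

Lemma val_cZ Y : centralF Y -> val (cZ Y p q) = constB (placeF (pairI p q) Y).
Proof.
move=> cY; rewrite toZK //; apply/centralBP => f; apply: constB_central.
exact/placeF_central/cY/pairI_inj.
Qed.

Lemma permZ_c w Y : centralF Y -> permZ w (cZ Y p q) = cZ Y (w p) (w q).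
Proof.
move=> cY; rewrite -[LHS]toZ_val val_permZ val_cZ // permB_const permF_placeF.
by rewrite (eq_placeF _ (comp_pairI _ _ _)).
Qed.

Lemma cZ_flip Y : cZ Y q p = cZ (flipF Y) p q.
Proof. by rewrite /cZ placeF_flip. Qed.

Lemma flipF_central (Y : TP F 2) : centralF Y -> centralF (flipF Y).
Proof.
have flK : involutive (@flipF k F) by move=> y; rewrite /flipF permF_comp tperm2 permF_id.
by move=> cY y; rewrite -[y]flK /flipF -!permFM; congr permF; apply: cY.
Qed.

Lemma cZM Y Y' : centralF Y -> centralF Y' -> cZ (tpmul Y Y') p q = cZ Y p q * cZ Y' p q.
Proof.
move=> cY cY'; apply: val_inj; rewrite val_ZM !val_cZ //.
  by rewrite (placeFM (pairI_inj pq)) constBM.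
by move=> y; rewrite -tpmulA cY' tpmulA cY tpmulA.
Qed.

Lemma centralF_D (Y Y' : TP F 2) : centralF Y -> centralF Y' -> centralF (Y + Y').
Proof. by move=> cY cY' y; rewrite tpmulDl tpmulDr cY cY'. Qed.

Lemma centralF_N (Y : TP F 2) : centralF Y -> centralF (- Y).
Proof.
move=> cY y; apply: (@addrI _ (tpmul Y y)); rewrite -tpmulDl cY -tpmulDr.
by rewrite !subrr tpmul0l tpmul0r.
Qed.

Lemma cZD Y Y' : centralF Y -> centralF Y' -> cZ (Y + Y') p q = cZ Y p q + cZ Y' p q.
Proof.
move=> cY cY'; apply: val_inj; rewrite val_ZD !val_cZ //; last exact: centralF_D.
by rewrite placeFD constBD.
Qed.

Lemma cZN Y : centralF Y -> cZ (- Y) p q = - cZ Y p q.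
Proof.
move=> cY; have := cZD cY (centralF_N cY); rewrite subrr => h.
apply: (@addrI _ (cZ Y p q)); rewrite -h subrr; apply: val_inj.
rewrite val_cZ ?placeF0; first exact: monB0.
by move=> y; rewrite tpmul0l tpmul0r.
Qed.

(** The coefficient is permuted while the exponent stays: the weak Frobenius property concerns [F],
    not the variables. *)
Lemma cZ_absorb_mon Y c z : centralF Y -> weakFrob Y ->
  cZ Y p q *: monB c z = cZ Y p q *: monB (permF (tperm p q) c) z.
Proof.
by move=> cY fY; rewrite !scaleZE val_cZ // !monBM placeF_weakFrob.
Qed.

End Pair.

(** Constants have exponent zero, so for them exchanging the slots of the coefficient is the whole
    permutation. *)
Lemma cZ_absorb (Y Y' : TP F 2) p q r s : centralF Y -> weakFrob Y -> centralF Y' -> p != q -> r != s ->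
  cZ Y p q * cZ Y' r s = cZ Y p q * cZ Y' (tperm p q r) (tperm p q s).
Proof.
move=> cY fY cY' pq rs; rewrite -permZ_c //; apply: val_inj; rewrite !val_ZM val_permZ -!scaleZE.
by rewrite val_cZ // permB_const; apply: cZ_absorb_mon.
Qed.

(** The hypothesis sits in three consecutive slots; placing it along [0, 1, 2 -> p, q, r] transports
    it to any three distinct slots, in any order. *)
Lemma cZ_rel (D00 D01 D10 D11 : TP F 2) p q r :
    centralF D00 -> centralF D01 -> centralF D10 -> centralF D11 ->
    tpmul (placeF (fun j : 'I_2 => widen_ord (isT : (2 <= 3)%N) j) D00)
          (placeF (fun j : 'I_2 => lift ord0 j : 'I_3) D11)
    = tpmul (placeF (fun j : 'I_2 => widen_ord (isT : (2 <= 3)%N) j) D01)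
          (placeF (fun j : 'I_2 => lift ord0 j : 'I_3) D10) ->
    p != q -> p != r -> q != r ->
  cZ D00 p q * cZ D11 q r = cZ D01 p q * cZ D10 q r.
Proof.
move=> c00 c01 c10 c11 h pq pr qr.
pose s (j : 'I_3) : 'I_m := if j == 0 :> nat then p else if j == 1 :> nat then q else r.
have s_inj : injective s.
  have [qp rp rq] : [/\ q != p, r != p & r != q] by rewrite ![_ == p]eq_sym [r == q]eq_sym.
  by move=> [[|[|[|i]]] hi] [[|[|[|j]]] hj] //=; rewrite /s /= => /eqP;
    rewrite ?(negPf pq, negPf pr, negPf qr, negPf qp, negPf rp, negPf rq) // => _; apply/val_inj.
have E1 (Y : TP F 2) : placeF (pairI p q) Y =
    placeF s (placeF (fun j : 'I_2 => widen_ord (isT : (2 <= 3)%N) j) Y).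
  rewrite placeF_comp //; first by apply: eq_placeF => -[[|[|]]].
  by move=> a b /(congr1 val) /= ab; apply/val_inj.
have E2 (Y : TP F 2) : placeF (pairI q r) Y = placeF s (placeF (fun j : 'I_2 => lift ord0 j : 'I_3) Y).
  by rewrite (placeF_comp _ s_inj (@lift_inj _ _)); apply: eq_placeF => -[[|[|]]].
apply: val_inj; rewrite !val_ZM !val_cZ // -!constBM !E1 !E2 -!placeFM //.
by rewrite h.
Qed.

Lemma scale_xZ_sub_lreg p q (f : BT) : p != q -> (xZ p - xZ q) *: f = 0 -> f = 0.
Proof. by move=> pq; rewrite scaleZE val_ZB !val_xZ; apply: xB_sub_lreg. Qed.
End Center.

(** * Yang-Baxter identities *)

Section YangBaxter.
(* The index [i : 'I_4] encodes the exponents of [x_1^a x_2^b]: [0, 1, 2, 3] stand for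
   [(a, b) = (0,0), (0,1), (1,0), (1,1)]. *)
Variables (Z : comPzRingType) (I : eqType) (D : 'I_4 -> I -> I -> Z) (R : I -> I -> Z) (x : I -> Z).

Definition d0 : 'I_4 := @Ordinal 4 0 isT.
Definition d1 : 'I_4 := @Ordinal 4 1 isT.
Definition d2 : 'I_4 := @Ordinal 4 2 isT.
Definition d3 : 'I_4 := @Ordinal 4 3 isT.

(** What the datum leaves in the centre: symmetry under the flip, the relation of polynomial type,
    and absorption, by which a factor [D i p q] identifies the slots [p] and [q] of the other
    factor. *)
Hypothesis D_sym : forall i p q, p != q -> D i q p = D i p q.
Hypothesis D_abs : forall i j p q r, p != q -> p != r -> q != r ->
  D i p q * D j p r = D i p q * D j q r.
Hypothesis D_rel : forall p q r, p != q -> p != r -> q != r ->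
  D d0 p q * D d3 q r = D d1 p q * D d2 q r.
Hypothesis R_sym : forall p q, p != q -> R q p = R p q.
Hypothesis R_abs : forall i p q r, p != q -> p != r -> q != r ->
  D i p q * R p r = D i p q * R q r.

Definition mono (i : 'I_4) (a b : Z) := a ^+ (1 < i)%N * b ^+ odd i.
(** The variables are arguments separate from the slots, so that absorption can change the slots
    while the variables stay in place. *)
Definition bb p q a b := \sum_i D i p q * mono i a b.
Definition ybeta p q := bb p q (x p) (x q).
Definition xdiff p q := x p - x q.
Definition sdiff p q := D d2 p q - D d1 p q.

Lemma bbE p q a b :
  bb p q a b = D d0 p q + D d1 p q * b + D d2 p q * a + D d3 p q * (a * b).
Proof.
rewrite /bb !big_ord_recl big_ord0 /mono /= !expr0 !expr1 !mulr1 !mul1r addr0 !addrA.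
have -> : lift ord0 (lift ord0 (lift ord0 ord0)) = d3 by apply/val_inj.
have -> : lift ord0 (lift ord0 ord0) = d2 by apply/val_inj.
have -> : lift ord0 ord0 = d1 by apply/val_inj.
by have -> : ord0 = d0 by apply/val_inj.
Qed.

Lemma bb_sym p q a b : p != q -> bb q p a b = bb p q a b.
Proof. by move=> pq; apply: eq_bigr => i _; rewrite D_sym. Qed.

(** The origin of [S = Delta^10 - Delta^01]: it is the divided difference of [beta] under the
    exchange of slots. *)
Lemma bet_swap p q : p != q -> ybeta q p = ybeta p q - sdiff p q * xdiff p q.
Proof. by move=> pq; rewrite /ybeta bb_sym // !bbE /sdiff /xdiff; ring. Qed.

Lemma dlN p q : xdiff q p = - xdiff p q.
Proof. by rewrite /xdiff opprB. Qed.

Lemma bb_mulE p q p' q' a b c e : bb p q a b * bb p' q' c e =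
  \sum_i \sum_j (D i p q * D j p' q') * (mono i a b * mono j c e).
Proof.
rewrite /bb mulr_suml; apply: eq_bigr => i _; rewrite mulr_sumr; apply: eq_bigr => j _.
by rewrite mulrACA.
Qed.

Section Triple.
Variables (p q r : I).
Hypotheses (pq : p != q) (pr : p != r) (qr : q != r).

Let qp : q != p. Proof. by rewrite eq_sym. Qed.
Let rp : r != p. Proof. by rewrite eq_sym. Qed.
Let rq : r != q. Proof. by rewrite eq_sym. Qed.

Lemma D_abs2 i j : D i p r * D j q r = D i p q * D j p r.
Proof. by rewrite mulrC -(D_sym i pr) -D_abs // (D_sym i pq) mulrC -D_abs. Qed.

(** By absorption the two factors may sit on any two of the three pairs, so the coefficient indices
    can trade places. *)
Lemma D_exch i j : D i p q * D j p r = D j p q * D i p r.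
Proof. by rewrite -[RHS]D_abs2 mulrC (D_abs j i pr pq rq) (D_sym i qr). Qed.

Lemma bb_abs a b c e : bb p q a b * bb q r c e = bb p q a b * bb p r c e.
Proof.
rewrite !bb_mulE; apply: eq_bigr => i _; apply: eq_bigr => j _.
by rewrite D_abs.
Qed.

Lemma bb_abs2 a b c e : bb p r a b * bb q r c e = bb p q a b * bb p r c e.
Proof.
rewrite !bb_mulE; apply: eq_bigr => i _; apply: eq_bigr => j _.
by rewrite D_abs2.
Qed.

(* Products over two different pairs of slots behave like [(u + v a) (s + t b) (u + v c) (s + t e)]. *)
Definition ww a b c e :=
  D d0 p q * D d0 p r + D d0 p q * D d1 p r * (b + e) + D d0 p q * D d2 p r * (a + c)
  + D d0 p q * D d3 p r * ((a + c) * (b + e)) + D d1 p q * D d1 p r * (b * e)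
  + D d1 p q * D d3 p r * ((a + c) * (b * e)) + D d2 p q * D d2 p r * (a * c)
  + D d2 p q * D d3 p r * ((b + e) * (a * c)) + D d3 p q * D d3 p r * (a * c * (b * e)).

Lemma bb_pq_pr a b c e : bb p q a b * bb p r c e = ww a b c e.
Proof.
have h12 : D d1 p q * D d2 p r = D d0 p q * D d3 p r by rewrite !D_abs // D_rel.
have h21 : D d2 p q * D d1 p r = D d0 p q * D d3 p r by rewrite D_exch.
set rhs := RHS; rewrite !bbE.
(* Seven of the sixteen terms of the product deviate from [ww]. Five corrections vanish by [D_exch];
   those at [b * c] and [a * e] need [D_rel], which turns the coefficients [d1], [d2] into [d0],
   [d3]. *)
transitivity (rhs
  + (D d1 p q * D d0 p r - D d0 p q * D d1 p r) * b
  + (D d2 p q * D d0 p r - D d0 p q * D d2 p r) * a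
  + (D d3 p q * D d0 p r - D d0 p q * D d3 p r) * (a * b)
  + (D d3 p q * D d1 p r - D d1 p q * D d3 p r) * (a * b * e)
  + (D d3 p q * D d2 p r - D d2 p q * D d3 p r) * (a * b * c)
  + (D d1 p q * D d2 p r - D d0 p q * D d3 p r) * (b * c)
  + (D d2 p q * D d1 p r - D d0 p q * D d3 p r) * (a * e)); first by rewrite /rhs /ww; ring.
rewrite h12 h21 (D_exch d1 d0) (D_exch d2 d0) (D_exch d3 d0) (D_exch d3 d1) (D_exch d3 d2).
by rewrite !subrr !mul0r !addr0.
Qed.

Lemma bb_pq_qr a b c e : bb p q a b * bb q r c e = ww a b c e.
Proof. by rewrite bb_abs bb_pq_pr. Qed.

Lemma bb_pr_qr a b c e : bb p r a b * bb q r c e = ww a b c e.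
Proof. by rewrite bb_abs2 bb_pq_pr. Qed.

(** [ww] is symmetric in [a], [c] and in [b], [e]. Two exchanges of arguments between factors carry
    one side into the other. *)
Lemma bet_cube : ybeta p q * ybeta r p * ybeta q r = ybeta r q * ybeta p r * ybeta q p.
Proof.
rewrite /ybeta (bb_sym _ _ pq) (bb_sym _ _ pr) (bb_sym _ _ qr).
rewrite bb_pq_pr (_ : ww _ _ _ _ = ww (x p) (x p) (x r) (x q)); last by rewrite /ww; ring.
rewrite -bb_pq_qr mulrAC bb_pq_qr (_ : ww _ _ _ _ = ww (x q) (x p) (x p) (x r)).
  by rewrite -bb_pq_pr; ring.
by rewrite /ww; ring.
Qed.

Ltac ww_ring := rewrite /ybeta ?(bb_sym _ _ pq) ?(bb_sym _ _ pr) ?(bb_sym _ _ qr)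
  ?bb_pq_pr ?bb_pq_qr ?bb_pr_qr /ww /xdiff; ring.

(** With [r_pq = ybeta p q / xdiff p q] this reads [r_pq r_qr = r_pr r_qr - r_qp r_pr], an
    associative Yang-Baxter equation; its companion below reads
    [r_pq r_qr = r_pq r_pr - r_pr r_rq]. *)
Lemma yang_baxter : ybeta p q * ybeta q r * xdiff p r = ybeta q p * ybeta p r * xdiff q r + ybeta p r * ybeta q r * xdiff p q.
Proof. ww_ring. Qed.

Lemma yang_baxter' : ybeta p q * ybeta q r * xdiff p r = ybeta p q * ybeta p r * xdiff q r + ybeta p r * ybeta r q * xdiff p q.
Proof. ww_ring. Qed.

(* [ncoef (a < b) p q] and [rcoef (a < b) p q] are the coefficients of the intertwiner of slots [p, q]
   on a vector with values [a], [b] in these slots. *)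
Definition ncoef (e : bool) p q := - (if e then ybeta p q else ybeta q p).
Definition rcoef (e : bool) p q := xdiff p q * (if e then R p q else 1).

Lemma bb_R a b : bb p q a b * R p r = bb p q a b * R q r.
Proof. by rewrite /bb !mulr_suml; apply: eq_bigr => i _; rewrite mulrAC R_abs // mulrAC. Qed.

Lemma gg_R e : ncoef e p q * R p r = ncoef e p q * R q r.
Proof. by rewrite /ncoef /ybeta (bb_sym _ _ pq) !mulNr; case: e; rewrite bb_R. Qed.

(** The Boolean condition says that [e1], [e2], [e3] are the comparisons of [p, q], of [q, r] and of
    [p, r] in some total order: it excludes just the two cyclic patterns. *)
Lemma gg_quad1 (e1 e2 e3 : bool) : (e1 && e2 ==> e3) && (e3 ==> e1 || e2) ->
  ncoef e1 p q * ncoef e2 p r * xdiff q r + xdiff p q * (ncoef e3 p r * ncoef (~~ e1) q r) =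
  ncoef e3 p q * ncoef e2 q r * xdiff p r.
Proof. by case: e1 e2 e3 => -[] [] //= _; rewrite /ncoef !mulrNN; ww_ring. Qed.

Lemma gg_quad2 (e1 e2 e3 : bool) : (e1 && e2 ==> e3) && (e3 ==> e1 || e2) ->
  ncoef e1 p q * ncoef e3 q r * xdiff p r =
  ncoef e1 p r * ncoef e2 q r * xdiff p q + xdiff q r * (ncoef (~~ e2) p q * ncoef e3 p r).
Proof. by case: e1 e2 e3 => -[] [] //= _; rewrite /ncoef !mulrNN; ww_ring. Qed.

End Triple.

(** * Scalar identities behind the braid relation *)

Section Braid.
Variables (p q r : I).
Hypotheses (pq : p != q) (pr : p != r) (qr : q != r).

Let qp : q != p. Proof. by rewrite eq_sym. Qed.
Let rp : r != p. Proof. by rewrite eq_sym. Qed.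
Let rq : r != q. Proof. by rewrite eq_sym. Qed.

Let gpq e : ncoef e p q * R p r = ncoef e p q * R q r. Proof. exact: gg_R. Qed.
Let gpr e : ncoef e p r * R p q = ncoef e p r * R q r.
Proof. by rewrite gg_R // (R_sym qr). Qed.
Let gqr e : ncoef e q r * R p q = ncoef e q r * R p r.
Proof. by rewrite -(R_sym pq) gg_R // (R_sym pr). Qed.

(** In this family the suffix names the rearrangement of three entries at which the coefficients of
    the two triple products of intertwiners are compared. For the longest one, [cba], commutativity
    suffices. *)
Lemma braid_abc (e1 e2 e3 : bool) :
  ncoef e1 p q * ncoef e2 p r * ncoef e1 q r + rcoef e1 p q * ncoef e3 p r * rcoef (~~ e1) q r =
  ncoef e2 q r * ncoef e1 p r * ncoef e2 p q + rcoef e2 q r * ncoef e3 p r * rcoef (~~ e2) p q.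
Proof.
have -> : rcoef e1 p q * ncoef e3 p r * rcoef (~~ e1) q r = xdiff p q * xdiff q r * (ncoef e3 p r * R p q).
  by rewrite /rcoef; case: e1 => /=; [ring|rewrite gpr; ring].
have -> : rcoef e2 q r * ncoef e3 p r * rcoef (~~ e2) p q = xdiff p q * xdiff q r * (ncoef e3 p r * R p q).
  by rewrite /rcoef; case: e2 => /=; [rewrite gpr; ring|ring].
congr (_ + _); have cube := bet_cube pq pr qr.
case: e1 e2 => -[]; rewrite /ncoef; [ring| | |ring].
  by transitivity (- (ybeta p q * ybeta r p * ybeta q r)); [ring|rewrite cube; ring].
by transitivity (- (ybeta r q * ybeta p r * ybeta q p)); [ring|rewrite -cube; ring].
Qed.

Lemma braid_bac (e1 e2 e3 : bool) : (e1 && e2 ==> e3) && (e3 ==> e1 || e2) ->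
  ncoef e1 p q * ncoef e2 p r * rcoef e1 q r + rcoef e1 p q * ncoef e3 p r * ncoef (~~ e1) q r =
  ncoef e2 q r * rcoef e1 p r * ncoef e3 p q.
Proof.
move=> h; have := gg_quad1 pq pr qr h; rewrite /rcoef; case: e1 {h} => /= h.
  have -> : ncoef true p q * ncoef e2 p r * (xdiff q r * R q r) + xdiff p q * R p q * ncoef e3 p r * ncoef false q r =
    (ncoef true p q * R q r) * ncoef e2 p r * xdiff q r + xdiff p q * ncoef e3 p r * (ncoef false q r * R p q) by ring.
  by rewrite -gpq gqr; transitivity (ncoef e3 p q * ncoef e2 q r * xdiff p r * R p r); [rewrite -h; ring|ring].
by transitivity (ncoef e3 p q * ncoef e2 q r * xdiff p r); [rewrite -h; ring|ring].
Qed.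

Lemma braid_acb (e1 e2 e3 : bool) : (e1 && e2 ==> e3) && (e3 ==> e1 || e2) ->
  ncoef e1 p q * rcoef e2 p r * ncoef e3 q r =
  ncoef e2 q r * ncoef e1 p r * rcoef e2 p q + rcoef e2 q r * ncoef e3 p r * ncoef (~~ e2) p q.
Proof.
move=> h; have := gg_quad2 pq pr qr h; rewrite /rcoef; case: e2 {h} => /= h.
  have -> : ncoef true q r * ncoef e1 p r * (xdiff p q * R p q) + xdiff q r * R q r * ncoef e3 p r * ncoef false p q =
    (ncoef true q r * R p q) * ncoef e1 p r * xdiff p q + xdiff q r * ncoef e3 p r * (ncoef false p q * R q r) by ring.
  by rewrite -gpq gqr; transitivity (ncoef e1 p q * ncoef e3 q r * xdiff p r * R p r); [ring|rewrite h; ring].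
by transitivity (ncoef e1 p q * ncoef e3 q r * xdiff p r); [ring|rewrite h; ring].
Qed.

Lemma braid_cab (e1 e2 e3 : bool) :
  ncoef e1 p q * rcoef e2 p r * rcoef e3 q r = rcoef e2 q r * rcoef e3 p r * ncoef e1 p q.
Proof.
transitivity (xdiff p r * xdiff q r * (ncoef e1 p q * (if e2 then R p r else 1) * (if e3 then R q r else 1))).
  by rewrite /rcoef; ring.
transitivity (xdiff p r * xdiff q r * (ncoef e1 p q * (if e2 then R q r else 1) * (if e3 then R p r else 1)));
  last by rewrite /rcoef; ring.
by congr (_ * _); case: e2 e3 => -[]; [exact: mulrAC|rewrite !mulr1 gpq|rewrite !mulr1 gpq|].
Qed.

Lemma braid_bca (e1 e2 e3 : bool) :
  rcoef e1 p q * rcoef e3 p r * ncoef e2 q r = ncoef e2 q r * rcoef e1 p r * rcoef e3 p q.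
Proof.
transitivity (xdiff p q * xdiff p r * (ncoef e2 q r * (if e1 then R p q else 1) * (if e3 then R p r else 1))).
  by rewrite /rcoef; ring.
transitivity (xdiff p q * xdiff p r * (ncoef e2 q r * (if e1 then R p r else 1) * (if e3 then R p q else 1)));
  last by rewrite /rcoef; ring.
by congr (_ * _); case: e1 e3 => -[]; [exact: mulrAC|rewrite !mulr1 gqr|rewrite !mulr1 gqr|].
Qed.

(** Minus the scalar by which the square of the intertwiner acts, see [N_sq]. *)
Definition nnorm a b := R a b * xdiff a b ^+ 2 - ybeta a b * ybeta b a.

(** This matches the coefficients of the vector itself in the two expansions given by
    [braid_expand]. *)
Lemma braid_scalar :
  ybeta p q ^+ 2 * ybeta q r * xdiff p r * xdiff q r + ybeta p r * xdiff q r ^+ 2 * nnorm p q =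
  ybeta q r ^+ 2 * ybeta p q * xdiff p r * xdiff p q + ybeta p r * xdiff p q ^+ 2 * nnorm q r.
Proof.
have R13 : ybeta p r * R p q = ybeta p r * R q r.
  by have := gpr true; rewrite /ncoef !mulNr => /oppr_inj.
have Y := yang_baxter pq pr qr; have Y' := yang_baxter' pq pr qr.
transitivity ((ybeta p q * ybeta q r * xdiff p r) * ybeta p q * xdiff q r
   + (ybeta p r * R p q) * xdiff q r ^+ 2 * xdiff p q ^+ 2 - ybeta p r * xdiff q r ^+ 2 * ybeta p q * ybeta q p).
  by rewrite /nnorm; ring.
transitivity ((ybeta p q * ybeta q r * xdiff p r) * ybeta q r * xdiff p q
   + (ybeta p r * R q r) * xdiff p q ^+ 2 * xdiff q r ^+ 2 - ybeta p r * xdiff p q ^+ 2 * ybeta q r * ybeta r q);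
  last by rewrite /nnorm; ring.
by rewrite {1}Y R13 Y'; ring.
Qed.
End Braid.
End YangBaxter.

(** * From the braid relation of intertwiners to that of the operators *)

Section BraidExpansion.
Variables (Z : comPzRingType) (M : lmodType Z).

Definition semilin (s : Z -> Z) (N : M -> M) :=
  (forall u v, N (u + v) = N u + N v) /\ (forall z v, N (z *: v) = s z *: N v).

(** The [a] stand for differences and the [b] for values of [beta], indexed by slots, so that
    [T = (b + N) / a]. The multiplier clears all denominators, also those whose indices get permuted
    on passing through [N1] and [N2]. *)
Lemma braid_expand (s1 s2 : {rmorphism Z -> Z}) (T1 T2 N1 N2 : M -> M)
    (a12 a13 a23 b12 b13 b23 b21 n12 : Z) (v : M) :
  semilin s1 N1 -> semilin s2 N2 ->
  (forall v, a12 *: T1 v = b12 *: v + N1 v) ->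
  (forall v, a23 *: T2 v = b23 *: v + N2 v) ->
  s1 a12 = - a12 -> s1 a13 = a23 -> s1 a23 = a13 -> s1 b23 = b13 -> s1 b13 = b23 -> s1 b12 = b21 ->
  s2 a23 = - a23 -> s2 a13 = a12 -> s2 a12 = a13 -> s2 b12 = b13 ->
  (forall v, N1 (N1 v) = - (n12 *: v)) ->
  (a12 ^+ 2 * a23 ^+ 2 * a13) *: T1 (T2 (T1 v)) =
    (b12 ^+ 2 * b23 * a13 * a23 + b13 * a23 ^+ 2 * n12) *: v
    + (b12 * b23 * a13 * a23 - b13 * b21 * a23 ^+ 2) *: N1 v
    + (b12 * b13 * a12 * a23) *: N2 v
    + (b12 * a12 * a23) *: N2 (N1 v) + (b23 * a12 * a23) *: N1 (N2 v)
    + (a12 * a23) *: N1 (N2 (N1 v)).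
Proof.
move=> [N1D N1Z] sN2; have [N2D N2Z] := sN2.
move=> HT1 HT2 s1a12 s1a13 s1a23 s1b23 s1b13 s1b12 s2a23 s2a13 s2a12 s2b12 NN.
set y := T1 v; set w := T2 y; pose Y := b12 *: v + N1 v.
have hY : a12 *: y = Y by exact: HT1.
have hw1 : (a12 * a23 ^+ 2 * a13) *: w = (b23 * a13 * a23) *: Y + (a12 * a23) *: N2 Y.
  have -> : a12 * a23 ^+ 2 * a13 = a12 * a13 * a23 * a23 by ring.
  rewrite -scalerA HT2 scalerDr scalerA; congr (_ + _).
    by rewrite -hY scalerA; congr (_ *: _); ring.
  rewrite -hY N2Z scalerA s2a12; congr (_ *: _); ring.
(* A second multiple of [w] is needed, because carrying the multiplier of [hw1] through [N1] turns
   it into [- a12 a13^2 a23]. *)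
have hw2 : (a12 * a13 ^+ 2 * a23) *: w = (a13 ^+ 2 * b23) *: Y + (a12 * a13) *: N2 Y.
  rewrite -scalerA HT2 scalerDr scalerA -hY N2Z !scalerA s2a12.
  by congr (_ *: _ + _ *: _); ring.
have -> : (a12 ^+ 2 * a23 ^+ 2 * a13) *: T1 w =
    b12 *: ((a12 * a23 ^+ 2 * a13) *: w) - N1 ((a12 * a13 ^+ 2 * a23) *: w).
  have -> : a12 ^+ 2 * a23 ^+ 2 * a13 = a12 * a23 ^+ 2 * a13 * a12 by ring.
  rewrite -scalerA HT1 scalerDr !scalerA N1Z -scaleNr; congr (_ *: _ + _ *: _); first ring.
  by rewrite !rmorphM ?rmorphXn /= s1a12 s1a13 s1a23; ring.
rewrite hw1 hw2 N1D !N1Z !rmorphM ?rmorphXn /= s1a12 s1a13 s1b23.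
rewrite /Y !N2D !N2Z s2b12 !N1D !N1Z s1b12 s1b13 NN.
rewrite !scalerDr !scalerN !scalerA opprD !opprD !opprK -!scaleNr.
rewrite !addrA [LHS](ACl ((1*6)*(2*5)*3*4*7*8)) /= -!scalerDl.
by congr (_ *: _ + _ *: _ + _ *: _ + _ *: _ + _ *: _ + _ *: _); ring.
Qed.

Lemma braid_of_intertwiners (s1 s2 : {rmorphism Z -> Z}) (T1 T2 N1 N2 : M -> M)
    (a12 a13 a23 b12 b13 b23 b21 b32 n12 n23 : Z) (v : M) :
  semilin s1 N1 -> semilin s2 N2 ->
  (forall v, a12 *: T1 v = b12 *: v + N1 v) ->
  (forall v, a23 *: T2 v = b23 *: v + N2 v) ->
  s1 a12 = - a12 -> s1 a13 = a23 -> s1 a23 = a13 -> s1 b23 = b13 -> s1 b13 = b23 -> s1 b12 = b21 ->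
  s2 a23 = - a23 -> s2 a13 = a12 -> s2 a12 = a13 -> s2 b12 = b13 -> s2 b13 = b12 -> s2 b23 = b32 ->
  (forall v, N1 (N1 v) = - (n12 *: v)) ->
  (forall v, N2 (N2 v) = - (n23 *: v)) ->
  (forall v, N1 (N2 (N1 v)) = N2 (N1 (N2 v))) ->
  b12 * b23 * a13 = b21 * b13 * a23 + b13 * b23 * a12 ->
  b12 * b23 * a13 = b12 * b13 * a23 + b13 * b32 * a12 ->
  b12 ^+ 2 * b23 * a13 * a23 + b13 * a23 ^+ 2 * n12 =
    b23 ^+ 2 * b12 * a13 * a12 + b13 * a12 ^+ 2 * n23 ->
  (a12 ^+ 2 * a23 ^+ 2 * a13) *: T1 (T2 (T1 v)) = (a12 ^+ 2 * a23 ^+ 2 * a13) *: T2 (T1 (T2 v)).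
Proof.
move=> sN1 sN2 HT1 HT2 s1a12 s1a13 s1a23 s1b23 s1b13 s1b12 s2a23 s2a13 s2a12 s2b12 s2b13 s2b23.
move=> NN1 NN2 NNN Y1 Y2 sc.
rewrite (braid_expand v sN1 sN2 HT1 HT2 s1a12 s1a13 s1a23 s1b23 s1b13 s1b12 s2a23 s2a13 s2a12 s2b12 NN1).
rewrite [in RHS](_ : a12 ^+ 2 * a23 ^+ 2 * a13 = a23 ^+ 2 * a12 ^+ 2 * a13); last by ring.
rewrite (braid_expand v sN2 sN1 HT2 HT1 s2a23 s2a13 s2a12 s2b12 s2b13 s2b23 s1a12 s1a13 s1a23 s1b23 NN2).
rewrite NNN [RHS](ACl (1*3*2*5*4*6)) /=.
congr (_ *: _ + _ *: _ + _ *: _ + _ *: _ + _ *: _ + _ *: _); [exact: sc| | |ring|ring|ring].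
  by rewrite Y1; ring.
by transitivity (b12 * b23 * a13 * a12 - b13 * b32 * a12 ^+ 2); [rewrite Y2; ring|ring].
Qed.
End BraidExpansion.

(** * Operators on functions on the symmetric group *)

Section Regular.
Variables (d : nat) (Z : comPzRingType) (B : lmodType Z).
Variables (Dz : 'I_4 -> 'I_d -> 'I_d -> Z) (Rz : 'I_d -> 'I_d -> Z) (xz : 'I_d -> Z).
Variables (permZ : 'S_d -> {rmorphism Z -> Z}) (permB : 'S_d -> B -> B) (rho : 'I_d.-1 -> B -> B).
Local Notation bet := (ybeta Dz xz).
Local Notation dl := (xdiff xz).
Local Notation sgen := (sdiff Dz).
Local Notation gg := (ncoef Dz xz).
Local Notation rr := (rcoef Rz xz).
Local Notation nn := (nnorm Dz Rz xz).
Local Notation sigk i := (permB (tperm (slo i) (shi i))).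

Hypothesis D_sym : forall i p q, p != q -> Dz i q p = Dz i p q.
Hypothesis D_abs : forall i j p q r, p != q -> p != r -> q != r ->
  Dz i p q * Dz j p r = Dz i p q * Dz j q r.
Hypothesis D_rel : forall p q r, p != q -> p != r -> q != r ->
  Dz d0 p q * Dz d3 q r = Dz d1 p q * Dz d2 q r.
Hypothesis R_sym : forall p q, p != q -> Rz q p = Rz p q.
Hypothesis R_abs : forall i p q r, p != q -> p != r -> q != r ->
  Dz i p q * Rz p r = Dz i p q * Rz q r.
Hypothesis permZ_D : forall w i p q, p != q -> permZ w (Dz i p q) = Dz i (w p) (w q).
Hypothesis permZ_R : forall w p q, p != q -> permZ w (Rz p q) = Rz (w p) (w q).
Hypothesis permZ_x : forall w p, permZ w (xz p) = xz (w p).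
Hypothesis permBD : forall w, {morph permB w : f g / f + g}.
Hypothesis permBZ : forall w z f, permB w (z *: f) = permZ w z *: permB w f.
Hypothesis permB_comp : forall w w' f, permB w' (permB w f) = permB (w * w')%g f.
Hypothesis permB_id : forall f, permB 1%g f = f.
Hypothesis rho_spec : forall i f, dl (slo i) (shi i) *: rho i f =
  bet (slo i) (shi i) *: f - bet (slo i) (shi i) *: sigk i f.
Hypothesis dl_inj : forall p q, p != q -> injective (fun f : B => dl p q *: f).

Lemma slo_neq_shi (i : 'I_d.-1) : slo i != shi i.
Proof. by apply/negP => /eqP/(congr1 val) /=; lia. Qed.

Lemma tperm_third (p q r : 'I_d) : p != r -> q != r -> tperm p q r = r.
Proof. by move=> pr qr; rewrite tpermD. Qed.

Lemma permZ_dl (w : 'S_d) p q : permZ w (dl p q) = dl (w p) (w q).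
Proof. by rewrite /xdiff rmorphB !permZ_x. Qed.
Lemma permZ_bet (w : 'S_d) p q : p != q -> permZ w (bet p q) = bet (w p) (w q).
Proof. by move=> pq; rewrite /ybeta !bbE !rmorphD !rmorphM /= !permZ_D // !permZ_x. Qed.
Lemma permZ_s (w : 'S_d) p q : p != q -> permZ w (sgen p q) = sgen (w p) (w q).
Proof. by move=> pq; rewrite /sdiff rmorphB !permZ_D. Qed.
Lemma permZ_gg (w : 'S_d) e p q : p != q -> permZ w (gg e p q) = gg e (w p) (w q).
Proof. by move=> pq; rewrite /ncoef rmorphN; case: e; rewrite permZ_bet // eq_sym. Qed.
Lemma permZ_rr (w : 'S_d) e p q : p != q -> permZ w (rr e p q) = rr e (w p) (w q).
Proof. by move=> pq; rewrite /rcoef rmorphM permZ_dl; case: e; rewrite ?permZ_R ?rmorph1. Qed.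

Lemma pB_tpermK (p q : 'I_d) : involutive (permB (tperm p q)).
Proof. by move=> f; rewrite permB_comp tperm2 permB_id. Qed.

Definition Mreg := {ffun 'S_d -> B}.
HB.instance Definition _ := GRing.Lmodule.on Mreg.
Implicit Types (m : Mreg) (w : 'S_d) (p q r s : 'I_d) (i j : 'I_d.-1).

(** [w p] is the entry in slot [p] of the tuple indexed by [w], so multiplication on the left
    exchanges two entries. *)
Definition stp p q (w : 'S_d) : 'S_d := (tperm p q * w)%g.
Definition Npq p q m : Mreg :=
  [ffun w : 'S_d => gg (w p < w q)%N p q *: permB (tperm p q) (m w)
           + rr (w p < w q)%N p q *: permB (tperm p q) (m (stp p q w))].

Definition asc i w := (w (slo i) < w (shi i))%N.
Definition si i w := stp (slo i) (shi i) w.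
Definition Treg i m : Mreg :=
  [ffun w : 'S_d => rho i (m w)
     + (if asc i w then 0 else sgen (slo i) (shi i) *: sigk i (m w))
     + (if asc i w then Rz (slo i) (shi i) *: sigk i (m (si i w)) else sigk i (m (si i w)))].

Lemma stpK p q : involutive (stp p q).
Proof. by move=> w; rewrite /stp mulgA tperm2 mul1g. Qed.

Lemma stp_l p q w : stp p q w p = w q. Proof. by rewrite permM tpermL. Qed.
Lemma stp_r p q w : stp p q w q = w p. Proof. by rewrite permM tpermR. Qed.
Lemma stp_o p q r w : p != r -> q != r -> stp p q w r = w r.
Proof. by move=> pr qr; rewrite permM tpermD. Qed.

Lemma asc_neg p q w : p != q -> (w q < w p)%N = ~~ (w p < w q)%N.
Proof.
by move=> pq; rewrite -leqNgt ltn_neqAle (inj_eq val_inj) (inj_eq perm_inj) eq_sym pq.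
Qed.

Lemma N_semilinear p q : p != q -> semilin (permZ (tperm p q)) (Npq p q).
Proof.
move=> pq; split=> [u v|z v]; apply/ffunP => w; rewrite !ffunE.
  by rewrite !permBD !scalerDr addrACA.
by rewrite !permBZ scalerDr !scalerA ![_ * permZ _ _]mulrC.
Qed.

(** At an ascent the component at [w] itself gets [- bet p q] from [rho]; at a descent the summand
    with [S] changes this to [- bet q p], by [bet_swap]. *)
Lemma dl_Treg i m :
  dl (slo i) (shi i) *: Treg i m = bet (slo i) (shi i) *: m + Npq (slo i) (shi i) m.
Proof.
have pq := slo_neq_shi i; apply/ffunP => w; rewrite !ffunE !scalerDr rho_spec /asc.
rewrite -!addrA; congr (_ + _); rewrite /ncoef /rcoef.
case: ifP => _; rewrite ?scaler0 ?add0r ?scalerA ?mulr1 ?scaleNr //.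
rewrite addrA; congr (_ + _); rewrite (bet_swap _ D_sym pq).
by rewrite -!scaleNr -scalerDl; congr (_ *: _); ring.
Qed.

Lemma dl_reg_inj p q : p != q -> injective (fun m => dl p q *: m).
Proof.
move=> pq m m' /ffunP h; apply/ffunP => w; apply: (dl_inj pq).
by have := h w; rewrite !ffunE.
Qed.

Lemma N_sq p q m : p != q -> Npq p q (Npq p q m) = - (nn p q *: m).
Proof.
move=> pq; have qp : q != p by rewrite eq_sym.
apply/ffunP => w; rewrite !ffunE stp_l stp_r stpK (asc_neg w pq).
rewrite !permBD !permBZ !pB_tpermK !scalerDr !scalerA !permZ_gg // !permZ_rr // tpermL tpermR.
rewrite -scaleNr [LHS](AC (2*2) ((1*4)*(2*3))) /= -!scalerDl.
rewrite (_ : gg _ p q * rr _ q p + _ = 0); last first.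
  rewrite /rcoef /ncoef (dlN _ p q); case: ifP => _ /=; rewrite ?(R_sym pq); ring.
rewrite scale0r addr0; congr (_ *: _).
rewrite /rcoef /ncoef /nnorm (dlN _ p q); case: ifP => _ /=; rewrite ?(R_sym pq); ring.
Qed.

Lemma asc_tri p q r w :
  (((w p < w q) && (w q < w r) ==> (w p < w r)) && ((w p < w r) ==> (w p < w q) || (w q < w r)))%N.
Proof. by apply/andP; split; apply/implyP; lia. Qed.

Lemma tperm_braid p q r : p != q -> p != r -> q != r ->
  (tperm p q * tperm q r * tperm p q = tperm q r * tperm p q * tperm q r)%g.
Proof.
move=> pq pr qr; have rq : r != q by rewrite eq_sym.
have tJ a b x : (tperm a b * x * tperm a b)%g = (x ^ tperm a b)%g.
  by rewrite /conjg tpermV mulgA.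
by rewrite !tJ !tpermJ tpermR tpermL !tperm_third // eq_sym.
Qed.

Lemma eq_scale6 (V : lmodType Z) (a1 a2 a3 a4 a5 a6 b1 b2 b3 b4 b5 b6 : Z) (x1 x2 x3 x4 x5 x6 : V) :
  a1 = b1 -> a2 = b2 -> a3 = b3 -> a4 = b4 -> a5 = b5 -> a6 = b6 ->
  a1 *: x1 + a2 *: x2 + a3 *: x3 + a4 *: x4 + a5 *: x5 + a6 *: x6 =
  b1 *: x1 + b2 *: x2 + b3 *: x3 + b4 *: x4 + b5 *: x5 + b6 *: x6.
Proof. by move=> -> -> -> -> -> ->. Qed.

(** Both sides are expanded over the six rearrangements of [w p], [w q], [w r] and compared
    coefficient by coefficient. That these three entries are linearly ordered gives the Boolean
    condition of the scalar identities. *)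
Lemma N_braid p q r m : p != q -> p != r -> q != r ->
  Npq p q (Npq q r (Npq p q m)) = Npq q r (Npq p q (Npq q r m)).
Proof.
move=> pq pr qr; have rp : r != p by rewrite eq_sym.
have rq : r != q by rewrite eq_sym.
have qp : q != p by rewrite eq_sym.
apply/ffunP => w; set s1 := stp p q; set s2 := stp q r.
have e1 : (w q < w p)%N = ~~ (w p < w q)%N by exact: asc_neg.
have e2 : (w r < w q)%N = ~~ (w q < w r)%N by exact: asc_neg.
have tri := asc_tri p q r w.
have ev1 u : (s1 u p = u q) * (s1 u q = u p) * (s1 u r = u r).
  by rewrite /s1 stp_l stp_r stp_o.
have ev2 u : (s2 u p = u p) * (s2 u q = u r) * (s2 u r = u q).
  by rewrite /s2 stp_l stp_r stp_o.
have tv := (tpermL p q, tpermR p q, tperm_third pr qr, tpermL q r, tpermR q r, tperm_third qp rp).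
have br (f : B) : permB (tperm q r) (permB (tperm p q) (permB (tperm q r) f)) =
    permB (tperm p q) (permB (tperm q r) (permB (tperm p q) f)).
  by rewrite !permB_comp ?mulgA tperm_braid.
have brs : s2 (s1 (s2 w)) = s1 (s2 (s1 w)).
  by rewrite /s1 /s2 /stp !mulgA tperm_braid.
pose X u := permB (tperm p q) (permB (tperm q r) (permB (tperm p q) (m u))).
set e1b := (w p < w q)%N in e1 tri *.
set e2b := (w q < w r)%N in e2 tri *.
set e3b := (w p < w r)%N in tri *.
transitivity (
  (gg e1b p q * gg e2b p r * gg e1b q r + rr e1b p q * gg e3b p r * rr (~~ e1b) q r) *: X w
  + (gg e1b p q * gg e2b p r * rr e1b q r + rr e1b p q * gg e3b p r * gg (~~ e1b) q r) *: X (s1 w)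
  + (gg e1b p q * rr e2b p r * gg e3b q r) *: X (s2 w)
  + (gg e1b p q * rr e2b p r * rr e3b q r) *: X (s1 (s2 w))
  + (rr e1b p q * rr e3b p r * gg e2b q r) *: X (s2 (s1 w))
  + (rr e1b p q * rr e3b p r * rr e2b q r) *: X (s1 (s2 (s1 w)))).
  rewrite !ffunE -/s1 -/s2 !(ev1, ev2) /s1 stpK -/s1 e1 -/e1b -/e2b -/e3b.
  rewrite !(permBD, permBZ, scalerDr, scalerA) !(permZ_gg, permZ_rr) //; rewrite !tv ?permZ_gg ?permZ_rr // ?tv -/s1.
  by rewrite -!/(X _) !scalerDl !addrA [LHS](ACl ((1*6)*(2*5)*3*4*7*8)) /= !addrA.
transitivity (
  (gg e2b q r * gg e1b p r * gg e2b p q + rr e2b q r * gg e3b p r * rr (~~ e2b) p q) *: X w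
  + (gg e2b q r * rr e1b p r * gg e3b p q) *: X (s1 w)
  + (gg e2b q r * gg e1b p r * rr e2b p q + rr e2b q r * gg e3b p r * gg (~~ e2b) p q) *: X (s2 w)
  + (rr e2b q r * rr e3b p r * gg e1b p q) *: X (s1 (s2 w))
  + (gg e2b q r * rr e1b p r * rr e3b p q) *: X (s2 (s1 w))
  + (rr e2b q r * rr e3b p r * rr e1b p q) *: X (s1 (s2 (s1 w)))).
  have Ds := D_sym; have Da := D_abs; have Dr := D_rel;
  have Rs := R_sym; have Ra := R_abs.
  apply: eq_scale6.
  - exact: braid_abc.
  - exact: braid_bac.
  - exact: braid_acb.
  - exact: braid_cab.
  - exact: braid_bca.
  - by ring.
apply/esym; rewrite !ffunE -/s1 -/s2 !(ev1, ev2) /s2 stpK -/s2 e2 -/e1b -/e2b -/e3b.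
rewrite !(permBD, permBZ, scalerDr, scalerA) !(permZ_gg, permZ_rr) //; rewrite !tv ?permZ_gg ?permZ_rr // ?tv -/s2.
rewrite !br brs -!/(X _) !scalerDl !addrA [LHS](ACl ((1*6)*3*(2*5)*7*4*8)) /= !addrA.
by [].
Qed.

Lemma N_comm p q r s m : p != q -> r != s -> p != r -> p != s -> q != r -> q != s ->
  Npq p q (Npq r s m) = Npq r s (Npq p q m).
Proof.
move=> pq rs pr ps qr qs.
have [rp rq sp sq] : [/\ r != p, r != q, s != p & s != q] by rewrite ![_ == p]eq_sym ![_ == q]eq_sym.
have tc : (tperm p q * tperm r s = tperm r s * tperm p q)%g.
  by rewrite [RHS]conjgC tpermJ !tperm_third.
apply/ffunP => w; rewrite !ffunE !stp_o //.
rewrite !(permBD, permBZ, scalerDr, scalerA) !(permZ_gg, permZ_rr) // !tperm_third //.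
have -> : stp p q (stp r s w) = stp r s (stp p q w) by rewrite /stp !mulgA tc.
have br (f : B) : permB (tperm p q) (permB (tperm r s) f) = permB (tperm r s) (permB (tperm p q) f).
  by rewrite !permB_comp tc.
rewrite !br [LHS](AC (2*2) ((1*3)*(2*4))) /=.
by congr (_ *: _ + _ *: _ + (_ *: _ + _ *: _)); ring.
Qed.

Lemma shi_eq_slo i j : nat_of_ord j = i.+1 -> shi i = slo j.
Proof. by move=> ij; apply/val_inj. Qed.

Lemma Treg_braid i j m : nat_of_ord j = i.+1 ->
  Treg i (Treg j (Treg i m)) = Treg j (Treg i (Treg j m)).
Proof.
move=> ij; have E := shi_eq_slo ij.
have pq := slo_neq_shi i; have qr := slo_neq_shi j.
have pr : slo i != shi j by apply/negP => /eqP/(congr1 val) /=; lia.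
set p := slo i in pq pr; set q := shi i in pq E *; set r := shi j in qr pr.
rewrite -E in qr.
have rp : r != p by rewrite eq_sym.
have rq : r != q by rewrite eq_sym.
have qp : q != p by rewrite eq_sym.
have tv := (tpermL p q, tpermR p q, tperm_third pr qr, tpermL q r, tpermR q r, tperm_third qp rp).
have Ds := D_sym; have Da := D_abs; have Dr := D_rel;
  have Rs := R_sym; have Ra := R_abs.
have H2 m' : dl q r *: Treg j m' = bet q r *: m' + Npq q r m' by have := dl_Treg j m'; rewrite -E.
have := @braid_of_intertwiners _ _ (permZ (tperm p q)) (permZ (tperm q r)) (Treg i) (Treg j)
  (Npq p q) (Npq q r) (dl p q) (dl p r) (dl q r) (bet p q) (bet p r) (bet q r) (bet q p) (bet r q)
  (nn p q) (nn q r) m (N_semilinear pq) (N_semilinear qr) (dl_Treg i) H2.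
rewrite /= !permZ_dl !permZ_bet // !tv => /(_ (dlN _ _ _) erefl erefl erefl erefl erefl (dlN _ _ _)
  erefl erefl erefl erefl erefl) H.
have {}H := H (fun v => N_sq v pq) (fun v => N_sq v qr) (fun v => N_braid v pq pr qr).
have {H} := H (yang_baxter _ Ds Da Dr pq pr qr) (yang_baxter' _ Ds Da Dr pq pr qr)
  (braid_scalar _ Ds Da Dr Rs Ra pq pr qr).
(* Each factor of the common multiplier acts injectively, so the factors are cancelled one at a
   time. *)
rewrite !expr2 -!scalerA.
by do 2!move/(dl_reg_inj pq); do 2!move/(dl_reg_inj qr); move/(dl_reg_inj pr).
Qed.

Lemma Treg_comm i j m : (i.+1 < j)%N -> Treg i (Treg j m) = Treg j (Treg i m).
Proof.
move=> ij; have pq := slo_neq_shi i; have rs := slo_neq_shi j.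
have [pr ps qr qs] : [/\ slo i != slo j, slo i != shi j, shi i != slo j & shi i != shi j].
  by split; apply/negP => /eqP/(congr1 val) /=; lia.
have expand a b (v : Mreg) : slo a != slo b -> slo a != shi b -> shi a != slo b -> shi a != shi b ->
  dl (slo b) (shi b) *: (dl (slo a) (shi a) *: Treg a (Treg b v)) =
  (bet (slo a) (shi a) * bet (slo b) (shi b)) *: v + bet (slo a) (shi a) *: Npq (slo b) (shi b) v
  + (bet (slo b) (shi b) *: Npq (slo a) (shi a) v + Npq (slo a) (shi a) (Npq (slo b) (shi b) v)).
  move=> h1 h2 h3 h4; have [Nadd NZ] := N_semilinear (slo_neq_shi a).
  have sc (y z : Z) (u : Mreg) : y *: (z *: u) = z *: (y *: u) by rewrite !scalerA mulrC.
  rewrite dl_Treg scalerDr sc dl_Treg scalerDr scalerA; congr (_ + _).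
  have -> : dl (slo b) (shi b) *: Npq (slo a) (shi a) (Treg b v) =
     Npq (slo a) (shi a) (dl (slo b) (shi b) *: Treg b v).
    by rewrite NZ permZ_dl !tperm_third.
  by rewrite dl_Treg Nadd NZ permZ_bet ?slo_neq_shi // !tperm_third.
have [rp sp rq sq] : [/\ slo j != slo i, shi j != slo i, slo j != shi i & shi j != shi i].
  by rewrite ![_ == slo i]eq_sym ![_ == shi i]eq_sym.
have sc (y z : Z) (u : Mreg) : y *: (z *: u) = z *: (y *: u) by rewrite !scalerA mulrC.
apply: (dl_reg_inj pq); apply: (dl_reg_inj rs); rewrite /= expand // [RHS]sc expand // N_comm //.
by rewrite [bet _ _ * bet _ _]mulrC [RHS](AC (2*2) ((1*3)*(2*4))).
Qed.

(** Multiplied twice by [a = x_k - x_(k+1)], both sides are combinations of [m] and [N m]. The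
    coefficients agree because [b - b' = a S] and [N^2 = b b' - a^2 R]. *)
Lemma Treg_quad i m :
  Treg i (Treg i m) = sgen (slo i) (shi i) *: Treg i m + Rz (slo i) (shi i) *: m.
Proof.
have pq := slo_neq_shi i; have [Nadd NZ] := N_semilinear pq.
apply: (dl_reg_inj pq); apply: (dl_reg_inj pq).
have sw := bet_swap xz D_sym pq.
have E : dl (slo i) (shi i) *: Npq (slo i) (shi i) (Treg i m) =
     - Npq (slo i) (shi i) (dl (slo i) (shi i) *: Treg i m).
  by rewrite NZ permZ_dl tpermL tpermR (dlN _ (slo i)) scaleNr opprK.
have sc (y z : Z) (u : Mreg) : y *: (z *: u) = z *: (y *: u) by rewrite !scalerA mulrC.
rewrite /= dl_Treg scalerDr sc dl_Treg E dl_Treg Nadd NZ N_sq // permZ_bet // tpermL tpermR.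
set b := bet (slo i) (shi i); set b' := bet (shi i) (slo i); set a := dl (slo i) (shi i).
set S := sgen (slo i) (shi i); set Rr := Rz (slo i) (shi i); set n := nn (slo i) (shi i).
transitivity ((b * b + n) *: m + (b - b') *: Npq (slo i) (shi i) m).
  rewrite scalerDr scalerA opprD opprK !scalerDl scaleNr [LHS](AC (2*2) ((1*4)*(2*3))) /=.
  by rewrite scaleNr.
have -> : a *: (a *: (S *: Treg i m + Rr *: m)) = (a * S) *: (a *: Treg i m) + (a * a * Rr) *: m.
  by rewrite !scalerDr !scalerA; congr (_ *: _ + _); ring.
rewrite dl_Treg scalerDr scalerA addrAC -scalerDl /b' sw.
by congr (_ *: _ + _ *: _); rewrite ?/n /nnorm ?sw /b /a /S /Rr; ring.
Qed.

Lemma TregD i : {morph Treg i : m m' / m + m'}.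
Proof.
move=> m m'; apply: (dl_reg_inj (slo_neq_shi i)); rewrite /= scalerDr !dl_Treg scalerDr.
by rewrite (N_semilinear (slo_neq_shi i)).1 addrACA.
Qed.

Lemma Treg_s i m : Treg i (sgen (slo i) (shi i) *: m) = sgen (slo i) (shi i) *: Treg i m.
Proof.
have pq := slo_neq_shi i; have [_ NZ] := N_semilinear pq; apply: (dl_reg_inj pq).
have sc (y z : Z) (u : Mreg) : y *: (z *: u) = z *: (y *: u) by rewrite !scalerA mulrC.
rewrite /= [RHS]sc !dl_Treg NZ permZ_s // tpermL tpermR.
by rewrite [sdiff Dz (shi i) _]/sdiff !(D_sym _ pq) -/(sgen _ _) scalerDr sc.
Qed.
End Regular.

(** * The elements of the datum placed in two slots *)

Section PlaceB.
Variables (k : fieldType) (F : falgType k) (m m' : nat) (s : 'I_m -> 'I_m').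
Hypothesis s_inj : injective s.

Lemma placeKD (a b : K m) : placeK s (addK a b) = addK (placeK s a) (placeK s b).
Proof.
by apply: eq_from_tnth => i; rewrite !tnth_mktuple; case: pickP => [j _|_]; rewrite ?tnth_mktuple ?addr0.
Qed.

Lemma placeK0 : placeK s (zeroK m) = zeroK m'.
Proof. by apply: eq_from_tnth => i; rewrite !tnth_mktuple; case: pickP => [j _|_]; rewrite ?tnth_mktuple. Qed.

Lemma placeK_unit j : placeK s (unitK j) = unitK (s j).
Proof.
apply: eq_from_tnth => i; rewrite !tnth_mktuple; case: pickP => [l /eqP <-|/(_ j)].
  by rewrite tnth_mktuple (inj_eq s_inj).
by rewrite eq_sym => ->.
Qed.

Lemma placeBE (f : BT F m) y (E : {fset K m}) : {subset finsupp f <= E} ->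
  placeB s f y = \sum_(z <- E | placeK s z == y) placeF s (f z).
Proof.
move=> fE; rewrite [RHS]big_mkcond /=.
rewrite -(supp_sum (G := fun z c => if placeK s z == y then placeF s c else 0) _ fE); last first.
  by move=> z; rewrite placeF0; case: ifP.
rewrite -big_mkcond mkBE; case: ifPn => // yN; rewrite big_seq_cond big1 // => z /andP[zf /eqP zy].
by case/negP: yN; rewrite -zy; apply: in_imfset.
Qed.

Lemma placeBD (f g : BT F m) : placeB s (f + g) = placeB s f + placeB s g.
Proof.
apply: BTP => y; rewrite BTD.
have sub1 : {subset finsupp f <= (finsupp f `|` finsupp g)%fset} by apply/fsubsetP/fsubsetUl.
have sub2 : {subset finsupp g <= (finsupp f `|` finsupp g)%fset} by apply/fsubsetP/fsubsetUr.
have sub3 : {subset finsupp (f + g) <= (finsupp f `|` finsupp g)%fset}.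
  move=> z; rewrite in_fsetU; apply: contraLR; rewrite negb_or => /andP[yf yg].
  by rewrite memNfinsupp BTD !notin_supp ?addr0.
rewrite (placeBE _ sub1) (placeBE _ sub2) (placeBE _ sub3) -big_split /=.
by apply: eq_bigr => z _; rewrite BTD placeFD.
Qed.

Lemma placeB_mon (c : TP F m) z : placeB s (monB c z) = monB (placeF s c) (placeK s z).
Proof.
apply: BTP => y; rewrite (@placeBE _ _ [fset z]%fset); last first.
  by move=> a; rewrite in_fset1; apply: contraTT => /negPf az; rewrite memNfinsupp monBE az.
by rewrite big_mkcond big_seq_fset1 !monBE eqxx eq_sym.
Qed.
End PlaceB.

Record wreath_datum (k : fieldType) (F : falgType k) := WreathDatum {
  wD : 'I_4 -> TP F 2;
  wR : TP F 2;
  wal : TP F 2;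
  wD_frob : forall i, weakFrobSym (wD i);
  wD_central : forall i, centralF (wD i);
  wR_central : centralF wR;
  wR_sym : flipF wR = wR;
  wal_central : centralF wal;
  wD_rel :
    tpmul (placeF (fun j : 'I_2 => widen_ord (isT : (2 <= 3)%N) j) (wD d0))
          (placeF (fun j : 'I_2 => lift ord0 j : 'I_3) (wD d3))
    = tpmul (placeF (fun j : 'I_2 => widen_ord (isT : (2 <= 3)%N) j) (wD d1))
          (placeF (fun j : 'I_2 => lift ord0 j : 'I_3) (wD d2));
  wal_rel : tpmul wal (flipF wal + (wD d2 - wD d1)) = wR
}.

Section Datum.
Variables (k : fieldType) (F : falgType k) (W : wreath_datum F) (d : nat).
Local Notation BT := (BT F d).
Local Notation Z := (center F d).
Implicit Types (p q r : 'I_d).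

Definition Dz i p q : Z := cZ (wD W i) p q.
Definition Rz p q : Z := cZ (wR W) p q.
Definition alz p q : Z := cZ (wal W) p q.
Definition abz p q : Z := cZ (flipF (wal W) + (wD W d2 - wD W d1)) p q.
Local Notation bet := (ybeta Dz (@xZ _ F d)).
Local Notation dl := (xdiff (@xZ _ F d)).
Local Notation sgen := (sdiff Dz).

Lemma Dz_sym i p q : p != q -> Dz i q p = Dz i p q.
Proof. by rewrite /Dz cZ_flip (wD_frob W i).2. Qed.

Lemma Dz_abs i j p q r : p != q -> p != r -> q != r -> Dz i p q * Dz j p r = Dz i p q * Dz j q r.
Proof.
move=> pq pr qr; rewrite [LHS]cZ_absorb ?tpermL ?tperm_third //; try exact: wD_central.
exact: (wD_frob W i).1.
Qed.

Lemma Dz_rel p q r : p != q -> p != r -> q != r -> Dz d0 p q * Dz d3 q r = Dz d1 p q * Dz d2 q r.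
Proof. by apply: cZ_rel (wD_rel W); apply: wD_central. Qed.

Lemma Rz_sym p q : p != q -> Rz q p = Rz p q.
Proof. by rewrite /Rz cZ_flip wR_sym. Qed.

Lemma Rz_abs i p q r : p != q -> p != r -> q != r -> Dz i p q * Rz p r = Dz i p q * Rz q r.
Proof.
move=> pq pr qr; rewrite [LHS]cZ_absorb ?tpermL ?tperm_third //; try exact: wD_central.
  exact: (wD_frob W i).1.
exact: wR_central.
Qed.

Lemma szE p q : p != q -> cZ (wD W d2 - wD W d1) p q = sgen p q.
Proof.
have c := @wD_central _ _ W.
by move=> pq; rewrite cZD ?cZN //; apply: centralF_N.
Qed.

Lemma abzE p q : p != q -> abz p q = alz q p + sgen p q.
Proof.
have c := @wD_central _ _ W.
move=> pq; rewrite /abz cZD //; first by rewrite szE // -cZ_flip.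
  exact/flipF_central/wal_central.
by apply: centralF_D => //; apply: centralF_N.
Qed.

Lemma alz_abz p q : p != q -> alz p q * abz p q = Rz p q.
Proof.
have c := @wD_central _ _ W.
move=> pq; rewrite /alz /abz -cZM ?wal_rel //; first exact: wal_central.
apply: centralF_D; first exact/flipF_central/wal_central.
by apply: centralF_D => //; apply: centralF_N.
Qed.

Lemma permZ_D (w : 'S_d) i p q : p != q -> permZ w (Dz i p q) = Dz i (w p) (w q).
Proof. by move=> pq; apply: permZ_c => //; apply: wD_central. Qed.
Lemma permZ_R (w : 'S_d) p q : p != q -> permZ w (Rz p q) = Rz (w p) (w q).
Proof. by move=> pq; apply: permZ_c => //; apply: wR_central. Qed.
Lemma permZ_al (w : 'S_d) p q : p != q -> permZ w (alz p q) = alz (w p) (w q).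
Proof. by move=> pq; apply: permZ_c => //; apply: wal_central. Qed.
Lemma Dz_absorb i p q c z : p != q -> Dz i p q *: (monB c z : BT) = Dz i p q *: (monB (permF (tperm p q) c) z : BT).
Proof.
move=> pq; apply: cZ_absorb_mon => //; first exact: wD_central.
exact: (wD_frob W i).1.
Qed.

Lemma bet_absorb p q c z : p != q -> bet p q *: (monB c z : BT) = bet p q *: (monB (permF (tperm p q) c) z : BT).
Proof.
move=> pq; rewrite /ybeta /bb !scaler_suml; apply: eq_bigr => i _.
by rewrite mulrC -!scalerA Dz_absorb.
Qed.

Lemma val_Dz i p q : p != q -> val (Dz i p q) = constB (placeF (pairI p q) (wD W i)).
Proof. by move=> pq; apply: val_cZ => //; apply: wD_central. Qed.

Lemma val_bilinear (a b c e x y : Z) : val (a + b * y + c * x + e * (x * y)) =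
  val a + val b * val y + val c * val x + val e * (val x * val y).
Proof. by rewrite !val_ZD !val_ZM. Qed.

Lemma val_bet p q : p != q -> val (bet p q) =
  constB (placeF (pairI p q) (wD W d0)) + constB (placeF (pairI p q) (wD W d1)) * xB F q
  + constB (placeF (pairI p q) (wD W d2)) * xB F p
  + constB (placeF (pairI p q) (wD W d3)) * (xB F p * xB F q).
Proof. by move=> pq; rewrite /ybeta bbE val_bilinear !(val_Dz _ pq) !val_xZ. Qed.

Section Slot.
Variable i : 'I_d.-1.
Local Notation p := (slo i).
Local Notation q := (shi i).

Let pq : p != q := slo_neq_shi i.

Definition btW : Defs.BT F 2 := beta (wD W d0) (wD W d1) (wD W d2) (wD W d3).
Definition rho (f : BT) : BT := rhok btW i f.
Local Notation sg := (sigk (F := F) i).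

Lemma bet_place : placeB (slots i) btW = val (bet p q).
Proof.
have si : injective (slots i) by apply: pairI_inj.
have -> : btW = constB (wD W d0) + constB (wD W d2) * xB F ord0 +
    (constB (wD W d1) * xB F ord_max + constB (wD W d3) * (xB F ord0 * xB F ord_max)) by [].
rewrite !monBM !tpmul1r !add0K.
rewrite !placeBD !placeB_mon placeKD !(placeK_unit si) placeK0.
rewrite val_bet //.
rewrite !monBM !tpmul1r !add0K.
by rewrite -!addrA; congr (_ + _); rewrite addrCA.
Qed.

(** On a monomial [c x^z], absorption replaces the permuted coefficient in [beta sigma(c x^z)] by
    [c]. What remains is [beta] times a difference of two monomials with equal coefficient and
    transposed exponents, which [xB_sub_dvd] divides. *)
Lemma rho_ex lau (f : BT) : inB lau f ->
  exists2 h, inB lau h & dl p q *: h = bet p q *: f - bet p q *: sg f.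
Proof.
move: f; apply: inB_ind => [|f g [h hh hE] [h' hh' hE']|c z hz].
- by exists 0; rewrite ?inB0 // /sigk permB0 !scaler0 subrr.
- exists (h + h'); first exact: inBD.
  by rewrite /sigk permBD !scalerDr hE hE' opprD addrACA.
have [h hh hE] := xB_sub_dvd (k := k) (F := F) c pq hz.
exists (bet p q *: h); last first.
  rewrite scalerA mulrC -scalerA [dl p q *: h]scaleZE /xdiff val_ZB !val_xZ hE scalerBr.
  by rewrite /sigk permB_mon [bet p q *: monB c (Defs.permK _ _)]bet_absorb.
rewrite scaleZE; apply: inBM => //; rewrite val_bet //.
by rewrite !inBD ?inBM ?inB_x ?inB_const.
Qed.

Lemma dl_inj p' q' : p' != q' -> injective (fun f : BT => dl p' q' *: f).
Proof.
move=> ne f g /= /eqP; rewrite -subr_eq0 -scalerBr => /eqP /(scale_xZ_sub_lreg ne) /eqP.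
by rewrite subr_eq0 => /eqP.
Qed.

Lemma rho_spec (f : BT) : dl p q *: rho f = bet p q *: f - bet p q *: sg f.
Proof.
(* [rhok] chooses its quotient among all Laurent elements, so existence is taken with [lau = true].
   [inB_rho] recovers polynomiality afterwards, from uniqueness. *)
have [h _ hE] := @rho_ex true f isT.
have := epsilon_spec (inhabits (zeroB F d))
    (fun q0 : BT => mulB (subB (xB F (slo i)) (xB F (shi i))) q0
              = subB (mulB (placeB (slots i) btW) f) (mulB (sigk i f) (placeB (slots i) btW))).
rewrite -[epsilon _ _]/(rhok btW i f) => spec.
rewrite scaleZE /xdiff val_ZB !val_xZ; apply: (etrans (spec _)).
  exists h; rewrite bet_place; move: hE.
  by rewrite !scaleZE /xdiff val_ZB !val_xZ [val _ * sg f](centralBP _ (valP (bet p q))).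
by rewrite bet_place !scaleZE [val _ * sg f](centralBP _ (valP (bet p q))).
Qed.

Lemma rho_unique (f h : BT) : dl p q *: h = bet p q *: f - bet p q *: sg f -> h = rho f.
Proof. by move=> hE; apply: (dl_inj pq); rewrite /= rho_spec. Qed.

Lemma inB_rho lau (f : BT) : inB lau f -> inB lau (rho f).
Proof. by case/rho_ex => h hh /rho_unique <-. Qed.

Lemma rhoD : {morph rho : f g / f + g}.
Proof.
move=> f g; apply/esym/rho_unique; rewrite scalerDr !rho_spec /sigk permBD !scalerDr.
by rewrite opprD addrACA.
Qed.

Lemma rho0 : rho 0 = 0.
Proof. by apply: (@addrI _ (rho 0)); rewrite -rhoD !addr0. Qed.

Lemma sgK : involutive sg. Proof. exact: permB_tpermK. Qed.

Lemma rho_sg f : rho (sg f) = - rho f.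
Proof. by apply/esym/rho_unique; rewrite scalerN rho_spec opprB sgK. Qed.

Lemma sgZ z f : sg (z *: f) = permZ (tperm p q) z *: sg f.
Proof. exact: permBZ. Qed.

Lemma rhoZ z f : bet p q * permZ (tperm p q) z = bet p q * z -> rho (z *: f) = z *: rho f.
Proof.
move=> h; apply/esym/rho_unique; rewrite sgZ !scalerA h mulrC -!scalerA rho_spec.
by rewrite scalerBr !scalerA ![z * _]mulrC.
Qed.

Lemma rho1 : rho 1 = 0.
Proof. by apply/esym/rho_unique; rewrite /sigk permB1 subrr scaler0. Qed.
End Slot.

Local Notation Mreg := (Mreg d BT).
Definition TregW (i : 'I_d.-1) (m : Mreg) : Mreg :=
  Treg Dz Rz (fun w => permB (k := k) (F := F) w) (fun i => rho i) i m.
Definition mulreg (m : Mreg) (b : BT) : Mreg := [ffun w => m w * b].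

Definition permZr (w : 'S_d) : {rmorphism Z -> Z} := permZ w.

Lemma TregW_braid (i j : 'I_d.-1) m : nat_of_ord j = i.+1 ->
  TregW i (TregW j (TregW i m)) = TregW j (TregW i (TregW j m)).
Proof.
exact: (@Treg_braid d Z BT Dz Rz (@xZ _ F d) permZr (fun w => permB w) (fun i => rho i)
  Dz_sym Dz_abs Dz_rel Rz_sym Rz_abs permZ_D permZ_R (@permZ_x _ _ _) (@permBD _ _ _) (@permBZ _ _ _)
  (@permB_comp _ _ _) (@permB_id _ _ _) rho_spec dl_inj).
Qed.

Lemma TregW_comm (i j : 'I_d.-1) m : (i.+1 < j)%N -> TregW i (TregW j m) = TregW j (TregW i m).
Proof.
exact: (@Treg_comm d Z BT Dz Rz (@xZ _ F d) permZr (fun w => permB w) (fun i => rho i)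
  Dz_sym permZ_D permZ_R (@permZ_x _ _ _) (@permBD _ _ _) (@permBZ _ _ _)
  (@permB_comp _ _ _) rho_spec dl_inj).
Qed.

Lemma TregW_quad i m :
  TregW i (TregW i m) = sgen (slo i) (shi i) *: TregW i m + Rz (slo i) (shi i) *: m.
Proof.
exact: (@Treg_quad d Z BT Dz Rz (@xZ _ F d) permZr (fun w => permB w) (fun i => rho i)
  Dz_sym Rz_sym permZ_D permZ_R (@permZ_x _ _ _) (@permBD _ _ _) (@permBZ _ _ _)
  (@permB_comp _ _ _) (@permB_id _ _ _) rho_spec dl_inj).
Qed.

Lemma TregWD i : {morph TregW i : m m' / m + m'}.
Proof.
exact: (@TregD d Z BT Dz Rz (@xZ _ F d) permZr (fun w => permB w) (fun i => rho i)
  Dz_sym (@permBD _ _ _) (@permBZ _ _ _) rho_spec dl_inj).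
Qed.

Lemma TregW_s i m : TregW i (sgen (slo i) (shi i) *: m) = sgen (slo i) (shi i) *: TregW i m.
Proof.
exact: (@Treg_s d Z BT Dz Rz (@xZ _ F d) permZr (fun w => permB w) (fun i => rho i)
  Dz_sym permZ_D (@permBD _ _ _) (@permBZ _ _ _) rho_spec dl_inj).
Qed.

Lemma TregWE i m w : TregW i m w = rho i (m w)
     + (if asc i w then 0 else sgen (slo i) (shi i) *: sigk i (m w))
     + (if asc i w then Rz (slo i) (shi i) *: sigk i (m (si i w)) else sigk i (m (si i w))).
Proof. by rewrite ffunE. Qed.

(** A twisted Leibniz rule: after multiplication by the difference, the two terms [beta f sigma(b)]
    cancel. *)
Lemma rho_mul i (f b : BT) : rho i (f * sigk i b) + f * rho i b = rho i f * b.
Proof.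
have pq := slo_neq_shi i; apply: (dl_inj pq) => /=.
rewrite scalerDr [X in _ + X]scaleZAr [RHS]scaleZAl !rho_spec /sigk permBM permB_tpermK.
rewrite mulrBl mulrBr -!scaleZAl -!scaleZAr.
by rewrite addrAC addrCA subrr addr0.
Qed.

Lemma TregW_mul i m b :
  mulreg (TregW i m) b = TregW i (mulreg m (sigk i b)) + mulreg m (rho i b).
Proof.
apply/ffunP => w; rewrite ffunE TregWE [RHS]ffunE TregWE !ffunE !mulrDl -rho_mul.
have sm (f : BT) : sigk i (f * sigk i b) = sigk i f * b.
  by rewrite /sigk permBM permB_tpermK.
rewrite !sm; case: ifP => _; rewrite ?mul0r ?scaleZAl ?addr0.
  by rewrite addrAC.
by rewrite [LHS](ACl (1*3*4*2)).
Qed.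
End Datum.

(** * The tensor space *)

Section TensorSpace.
Variables (k : fieldType) (F : falgType k) (W : wreath_datum F) (d n : nat).
Local Notation BT := (BT F d).
Local Notation Z := (center F d).
Local Notation Dz := (Dz W (d := d)).
Local Notation Rz := (Rz W (d := d)).
Local Notation alz := (alz W (d := d)).
Local Notation abz := (abz W (d := d)).
Local Notation bet := (ybeta Dz (@xZ _ F d)).
Local Notation sgen := (sdiff Dz).
Local Notation Vt := (Vt F n d).
Local Notation Mreg := (Mreg d BT).
Local Notation Treg := (TregW W (d := d)).
Implicit Types (m : Mreg) (v : Vt) (w : 'S_d) (p q : 'I_d) (i : 'I_d.-1) (j : d.-tuple 'I_n).

Definition TV i v : Vt :=
  actHV (Rkw (wR W)) (Skw (wD W d1) (wD W d2))
    (fun i => placeFk i (flipF (wal W) + (wD W d2 - wD W d1)))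
    (rhok (btW W)) i v.

HB.instance Definition _ := GRing.Zmodule.on Vt.

Lemma TVE i v j :
  TV i v j = rho W i (v j)
   + (if (tnth j (slo i) < tnth j (shi i))%N then 0
      else if tnth j (slo i) == tnth j (shi i) then abz (slo i) (shi i) *: sigk i (v j)
      else sgen (slo i) (shi i) *: sigk i (v j))
   + (if (tnth j (shi i) < tnth j (slo i))%N then sigk i (v (swapT i j))
      else if (tnth j (slo i) < tnth j (shi i))%N then Rz (slo i) (shi i) *: sigk i (v (swapT i j))
      else 0).
Proof.
have pq := slo_neq_shi i; have cD := @wD_central _ _ W.
have EB Y (f : BT) : centralF Y -> mulB (placeFk i Y) f = cZ Y (slo i) (shi i) *: f.
  by move=> cY; rewrite scaleZE val_cZ.
have cS : centralF (wD W d2 - wD W d1) by apply: centralF_D => //; apply: centralF_N.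
rewrite ffunE /= /Rkw /Skw (EB (wR W)) ?(EB (wD W d2 - wD W d1)) ?EB //; last 2 first.
- by apply: centralF_D => //; apply/flipF_central/wal_central.
- exact: wR_central.
have aE (f g : BT) : addB f g = f + g by [].
rewrite szE // -/(rho W i _) -/(Rz _ _) -/(abz _ _) !aE.
congr (_ + _); case: ifP => _; first by rewrite addr0.
by case: ifP => _ //; exact: addrC.
Qed.

Definition tup (l : 'I_d -> 'I_n) w : d.-tuple 'I_n := [tuple l (w x) | x < d].

Lemma swapT_tup l i w : swapT i (tup l w) = tup l (si i w).
Proof. by apply: eq_from_tnth => x; rewrite !tnth_mktuple permM. Qed.

Definition clam (l : 'I_d -> 'I_n) w : Z :=
  \prod_(ab : 'I_d * 'I_d | [&& (ab.1 < ab.2)%N, l (w ab.1) == l (w ab.2) & (w ab.1 < w ab.2)%N])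
     alz ab.1 ab.2.

Definition flam (l : 'I_d -> 'I_n) v : Mreg := [ffun w : 'S_d => clam l w *: v (tup l w)].

(** The coefficients [clam l w] are not invariant under the exchange of two slots, but multiples of
    [Delta^ij] do not see the change. This is what lets [rho] and [S] pass them. *)
Definition absorbed p q (z : Z) := forall t, Dz t p q * permZ (tperm p q) z = Dz t p q * z.

Lemma absorbed_clam l w p q : p != q -> absorbed p q (clam l w).
Proof.
move=> pq; apply: (big_ind (absorbed p q)) => [t|z z' hz hz' t|ab /andP[ab12 _] t].
- by rewrite rmorph1.
- by rewrite rmorphM /= mulrA hz mulrAC hz' mulrAC mulrA.
have ne : ab.1 != ab.2 by rewrite -(inj_eq val_inj) /= neq_ltn ab12.
rewrite permZ_al // -cZ_absorb //; [exact: wD_central|exact: (wD_frob W t).1|exact: wal_central].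
Qed.

Lemma absorbed_bet p q z : absorbed p q z -> bet p q * permZ (tperm p q) z = bet p q * z.
Proof.
move=> h; rewrite /ybeta /bb !mulr_suml; apply: eq_bigr => t _.
by rewrite mulrAC h mulrAC.
Qed.

Lemma absorbed_s p q z : absorbed p q z -> sgen p q * permZ (tperm p q) z = sgen p q * z.
Proof. by move=> h; rewrite /sdiff !mulrBl !h. Qed.

Lemma permZ_tpermK p q : involutive (permZ (F := F) (tperm p q)).
Proof. by move=> z; apply: val_inj; rewrite !val_permZ permB_tpermK. Qed.

Lemma permZ_clam l i w : permZ (tperm (slo i) (shi i)) (clam l (si i w)) =
  \prod_(ab : 'I_d * 'I_d | [&& (tperm (slo i) (shi i) ab.1 < tperm (slo i) (shi i) ab.2)%N,
      l (w ab.1) == l (w ab.2) & (w ab.1 < w ab.2)%N]) alz ab.1 ab.2.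
Proof.
rewrite rmorph_prod /=; set s := tperm _ _.
have sK : involutive (fun ab : 'I_d * 'I_d => (s ab.1, s ab.2)).
  by case=> a b /=; rewrite !tpermK.
rewrite [LHS](reindex_inj (can_inj sK)) /=; apply: eq_big => -[a b] /=.
  by rewrite !permM -/s !tpermK.
case/andP => ab _; have ne : s a != s b by rewrite -(inj_eq val_inj) /= neq_ltn ab.
by rewrite permZ_al // -/s !tpermK.
Qed.

Lemma tperm_adj i (a b : 'I_d) : (a, b) != (slo i, shi i) -> (a, b) != (shi i, slo i) ->
  (tperm (slo i) (shi i) a < tperm (slo i) (shi i) b)%N = (a < b)%N.
Proof.
rewrite !xpair_eqE -!(inj_eq val_inj) /= => h1 h2.
case: tpermP h1 h2 => [->|->|/eqP + /eqP +]; case: tpermP => [->|->|/eqP + /eqP +];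
  rewrite -?(inj_eq val_inj) /=; lia.
Qed.

(** An adjacent transposition changes the relative order of a single pair of slots, and here that
    pair is not a tie. *)
Lemma clam_neq l i w : l (w (slo i)) != l (w (shi i)) ->
  permZ (tperm (slo i) (shi i)) (clam l (si i w)) = clam l w.
Proof.
move=> ne; rewrite permZ_clam; apply: eq_bigl => -[a b] /=.
have [[-> ->]|h1] := eqVneq (a, b) (slo i, shi i); first by rewrite (negPf ne) !andbF.
have [[-> ->]|h2] := eqVneq (a, b) (shi i, slo i); first by rewrite eq_sym (negPf ne) !andbF.
by rewrite tperm_adj.
Qed.

(** Passing from [si i w] to [w] at a tie adds exactly the pair [(slo i, shi i)] to the index set,
    as [w] ascends there. *)
Lemma clam_eq l i w : l (w (slo i)) = l (w (shi i)) -> asc i w ->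
  clam l w = alz (slo i) (shi i) * permZ (tperm (slo i) (shi i)) (clam l (si i w)).
Proof.
move=> le up; rewrite permZ_clam /clam (bigD1 (slo i, shi i)) /=; last first.
  by rewrite le eqxx -/(asc i w) up !andbT /=.
congr (_ * _); apply: eq_bigl => -[a b] /=.
have [[-> ->]|h1] := eqVneq (a, b) (slo i, shi i).
  by rewrite tpermL tpermR andbF ltnNge leq_eqVlt /= ltnSn orbT.
have [[-> ->]|h2] := eqVneq (a, b) (shi i, slo i).
  by rewrite [(w _ < w _)%N]ltnNge (ltnW up) !andbF.
by rewrite tperm_adj // andbT.
Qed.

Lemma si_K i : involutive (si (d := d) i).
Proof. exact: stpK. Qed.

Lemma asc_si i w : asc i (si i w) = ~~ asc i w.
Proof. by rewrite /asc stp_l stp_r asc_neg // slo_neq_shi. Qed.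

Section Monotone.
Variable l : 'I_d -> 'I_n.
Hypothesis l_mono : forall a b : 'I_d, (a <= b)%N -> (l a <= l b)%N.

(** Monotonicity of [l] makes strict inequalities between entries agree with the ascents of [w]. At
    a tie [V] has the single scalar [abz], while [M] mixes [w] and [si i w]: an ascent needs
    [alz * abz = Rz], a descent [abz p q = alz q p + S]. *)
Lemma flamT i v : flam l (TV i v) = Treg i (flam l v).
Proof.
have pq := slo_neq_shi i; apply/ffunP => w; rewrite ffunE TVE TregWE !ffunE.
have ab := absorbed_clam l w pq; rewrite swapT_tup !tnth_mktuple.
rewrite rhoZ; last exact: absorbed_bet.
rewrite /sigk !permBZ !scalerDr -!addrA; congr (_ + _).
have [lt|gt|eq] := ltngtP (l (w (slo i))) (l (w (shi i))).
- have up : asc i w by rewrite /asc ltnNge; apply/negP => /l_mono; rewrite leqNgt lt.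
  rewrite up scaler0 !add0r clam_neq; last by rewrite -(inj_eq val_inj) neq_ltn lt.
  by rewrite !scalerA mulrC.
- have up : asc i w = false by apply: contraTF gt => /ltnW/l_mono; rewrite -leqNgt.
  have ne : l (w (slo i)) != l (w (shi i)) by rewrite -(inj_eq val_inj) neq_ltn gt orbT.
  rewrite up (negPf ne) clam_neq //.
  by rewrite !scalerA mulrC (absorbed_s ab).
have {}eq := val_inj eq.
rewrite eq eqxx !scaler0 addr0; have -> : tup l (si i w) = tup l w.
  rewrite -swapT_tup; apply: eq_from_tnth => x; rewrite !tnth_mktuple.
  by case: tpermP => [->|->|].
have [up|dn] := boolP (asc i w).
  rewrite add0r scalerA scalerA (clam_eq eq up) mulrAC alz_abz //.
have up' : asc i (si i w) by rewrite asc_si.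
have eq' : l (si i w (slo i)) = l (si i w (shi i)) by rewrite stp_l stp_r.
rewrite (clam_eq eq' up') si_K rmorphM /= permZ_al // tpermL tpermR permZ_tpermK.
rewrite !scalerA (absorbed_s ab) -scalerDl abzE //; congr (_ *: _); ring.
Qed.
End Monotone.

Lemma flamD l : {morph flam l : v v' / v + v'}.
Proof. by move=> v v'; apply/ffunP => w; rewrite !ffunE scalerDr. Qed.

Lemma flam_sep j : exists (l : 'I_d -> 'I_n) w, [/\ forall a b : 'I_d, (a <= b)%N -> (l a <= l b)%N,
  tup l w = j & clam l w = 1].
Proof.
(* A strict total order on slots: by entry, and on ties the larger slot first. [w] is the rank in
   this order, so that [j] composed with the inverse of [w] is sorted. *)
pose lt (a b : 'I_d) := ((tnth j a < tnth j b) || ((tnth j a == tnth j b) && (b < a)))%N.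
have ltT a b c : lt a b -> lt b c -> lt a c.
  rewrite /lt => /orP[h1|/andP[/eqP -> h1]] /orP[h2|/andP[/eqP e2 h2]]; rewrite ?e2 ?h2 //.
  - by rewrite (ltn_trans h1 h2).
  - by rewrite -e2 h1.
  - by rewrite eqxx (ltn_trans h2 h1) orbT.
have ltI a : lt a a = false by rewrite /lt !ltnn andbF.
have tot a b : a != b -> lt a b || lt b a.
  rewrite /lt -!(inj_eq val_inj) /=; lia.
pose rk (a : 'I_d) := #|[set c | lt c a]|.
have rk_lt a : (rk a < d)%N.
  rewrite -[X in (_ < X)%N]card_ord -cardsT; apply: proper_card; rewrite properT.
  by apply/negP => /eqP/setP/(_ a); rewrite !inE ltI.
have rk_mono a b : lt a b -> (rk a < rk b)%N.
  move=> ab; apply: proper_card; apply/properP; split.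
    by apply/subsetP => c; rewrite !inE => ca; apply: ltT ab.
  by exists a; rewrite !inE // ltI.
pose f a := Ordinal (rk_lt a).
have f_inj : injective f.
  move=> a b /(congr1 val) /= e; apply/eqP; apply: contraT => /tot /orP[] /rk_mono;
  by rewrite e ltnn.
pose w := perm f_inj.
have wE a : w a = rk a :> nat by rewrite permE.
exists (fun x => tnth j ((w^-1)%g x)), w; split.
- move=> a b ab; rewrite leqNgt; apply/negP => h.
  have : (w ((w^-1)%g b) < w ((w^-1)%g a))%N by rewrite !wE rk_mono // /lt h.
  by rewrite !permKV ltnNge ab.
- by apply: eq_from_tnth => x; rewrite tnth_mktuple perm.permK.
rewrite /clam big1 // => -[a b] /= /and3P[ab]; rewrite !perm.permK => /eqP e; rewrite !wE.
by rewrite ltnNge ltnW // rk_mono // /lt e eqxx ab orbT.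
Qed.

Lemma flam_inj v v' :
  (forall l : 'I_d -> 'I_n, (forall a b : 'I_d, (a <= b)%N -> (l a <= l b)%N) -> flam l v = flam l v') -> v = v'.
Proof.
move=> h; apply/ffunP => j; have [l [w [lm <- c1]]] := flam_sep j.
by have /ffunP/(_ w) := h l lm; rewrite !ffunE c1 !scale1r.
Qed.

Lemma TVD i : {morph TV i : v v' / v + v'}.
Proof.
by move=> v v'; apply: flam_inj => l lm; rewrite flamT // !flamD TregWD !flamT.
Qed.

Lemma TV_braid (i j : 'I_d.-1) v : nat_of_ord j = i.+1 -> TV i (TV j (TV i v)) = TV j (TV i (TV j v)).
Proof. by move=> ij; apply: flam_inj => l lm; rewrite !flamT // TregW_braid. Qed.

Lemma TV_comm (i j : 'I_d.-1) v : (i.+1 < j)%N -> TV i (TV j v) = TV j (TV i v).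
Proof. by move=> ij; apply: flam_inj => l lm; rewrite !flamT // TregW_comm. Qed.

Lemma flam_actB l v b : flam l (actBV v b) = mulreg (flam l v) b.
Proof. by apply/ffunP => w; rewrite !ffunE -scaleZAl. Qed.

Lemma mulreg_central m (z : Z) : mulreg m (val z) = z *: m.
Proof. by apply/ffunP => w; rewrite !ffunE -(centralBP _ (valP z)). Qed.

Lemma TV_mul i v b : actBV (TV i v) b = TV i (actBV v (sigk i b)) + actBV v (rho W i b).
Proof.
by apply: flam_inj => l lm; rewrite flamD flamT // !flam_actB flamT // TregW_mul.
Qed.

Lemma Skw_val i : Skw (wD W d1) (wD W d2) i = val (sgen (slo i) (shi i)).
Proof.
rewrite -szE ?slo_neq_shi // val_cZ ?slo_neq_shi //.
by apply: centralF_D; [|apply: centralF_N]; apply: wD_central.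
Qed.

Lemma Rkw_val i : Rkw (wR W) i = val (Rz (slo i) (shi i)).
Proof. by rewrite val_cZ ?slo_neq_shi //; apply: wR_central. Qed.

Lemma TV_quad i v : TV i (TV i v) =
  TV i (actBV v (Skw (wD W d1) (wD W d2) i)) + actBV v (Rkw (wR W) i).
Proof.
apply: flam_inj => l lm; rewrite flamD !flamT // !flam_actB Skw_val Rkw_val !mulreg_central.
by rewrite TregW_s TregW_quad.
Qed.

Section Integral.
Variable lau : bool.

Definition inreg m := forall w, inB lau (m w).

Lemma inVP v : reflect (forall j, inB lau (v j)) (inV lau v).
Proof. exact: forallP. Qed.

Lemma inVD v v' : inV lau v -> inV lau v' -> inV lau (v + v').
Proof. by move=> /inVP h /inVP h'; apply/inVP => j; rewrite ffunE inBD. Qed.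

Lemma inVN v : inV lau v -> inV lau (- v).
Proof. by move=> /inVP h; apply/inVP => j; rewrite ffunE inBN. Qed.

Lemma inV0 : inV lau (0 : Vt).
Proof. by apply/inVP => j; rewrite ffunE inB0. Qed.

Lemma inV_actB v b : inV lau v -> inB lau b -> inV lau (actBV v b).
Proof. by move=> /inVP h hb; apply/inVP => j; rewrite ffunE; apply: inBM. Qed.

Lemma inB_cZ Y p q (f : BT) : p != q -> centralF Y -> inB lau f -> inB lau (cZ Y p q *: f).
Proof. by move=> pq cY hf; rewrite scaleZE val_cZ // inBM ?inB_const. Qed.

Lemma inV_TV i v : inV lau v -> inV lau (TV i v).
Proof.
move=> /inVP h; have pq := slo_neq_shi i; have cD := @wD_central _ _ W.
have cS : centralF (wD W d2 - wD W d1) by apply: centralF_D => //; apply: centralF_N.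
have cA : centralF (flipF (wal W) + (wD W d2 - wD W d1)).
  by apply: centralF_D => //; apply/flipF_central/wal_central.
have hs j : inB lau (sigk i (v j)) by apply: inB_perm.
apply/inVP => j; rewrite TVE -szE //; apply: inBD; first apply: inBD.
- exact: inB_rho.
- by do 2?case: ifP => _; rewrite ?inB0 ?inB_cZ.
by do 2?case: ifP => _; rewrite ?inB0 ?inB_cZ //; apply: wR_central.
Qed.

Lemma inreg_flam l v : inV lau v -> inreg (flam l v).
Proof.
move=> /inVP h w; rewrite ffunE scaleZE; apply: inBM => //.
apply: (big_ind (fun z : Z => inB lau (val z))) => [|a b ha hb|ab /andP[lt _]].
- exact: inB1.
- by rewrite val_ZM inBM.
have ne : ab.1 != ab.2 by rewrite -(inj_eq val_inj) /= neq_ltn lt.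
by rewrite val_cZ ?inB_const //; apply: wal_central.
Qed.

End Integral.

Section Weight.
Hypothesis hnd : (d <= n)%N.

Definition l0 (a : 'I_d) : 'I_n := widen_ord hnd a.

Lemma tup_inj : injective (tup l0).
Proof.
move=> w w' h; apply/permP => x; apply/val_inj.
by have := congr1 (fun t => val (tnth t x)) h; rewrite !tnth_mktuple.
Qed.

Definition ext m : Vt := [ffun j => if [pick w | tup l0 w == j] is Some w then m w else 0].

Lemma ext_tup m w : ext m (tup l0 w) = m w.
Proof.
by rewrite ffunE; case: pickP => [w' /eqP/tup_inj -> //|/(_ w)]; rewrite eqxx.
Qed.

Lemma ext_out m j : (forall w, tup l0 w != j) -> ext m j = 0.
Proof. by move=> h; rewrite ffunE; case: pickP => // w hw; have := h w; rewrite hw. Qed.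

Lemma ext_Treg i m : ext (Treg i m) = TV i (ext m).
Proof.
apply/ffunP => j; rewrite TVE; case: (pickP (fun w => tup l0 w == j)) => [w /eqP <-|h].
  rewrite swapT_tup !ext_tup TregWE !tnth_mktuple /= -/(asc i w).
  have ne : (l0 (w (slo i)) == l0 (w (shi i))) = false.
    by apply/negbTE; rewrite -(inj_eq val_inj) /= (inj_eq val_inj) (inj_eq perm_inj) slo_neq_shi.
  rewrite ne (asc_neg w (slo_neq_shi i)) -/(asc i w).
  by case: (asc i w).
have out w : tup l0 w != j by rewrite h.
have out' w : tup l0 w != swapT i j.
  apply/negP => /eqP e; have /eqP[] := out (si i w).
  rewrite -swapT_tup e; apply: eq_from_tnth => x.
  by rewrite !tnth_mktuple tpermK.
rewrite !ext_out // rho0 /sigk permB0 !scaler0 add0r.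
by do 4?case: ifP => _; rewrite ?addr0.
Qed.

Lemma inV_ext lau m : inreg lau m -> inV lau (ext m).
Proof. by move=> h; apply/inVP => j; rewrite ffunE; case: pickP => // _; rewrite inB0. Qed.

Lemma extD : {morph ext : m m' / m + m'}.
Proof.
by move=> m m'; apply/ffunP => j; rewrite !ffunE; case: pickP => [w _|_]; rewrite ?ffunE ?addr0.
Qed.

Lemma ext_actB m b : ext (mulreg m b) = actBV (ext m) b.
Proof.
by apply/ffunP => j; rewrite !ffunE; case: pickP => [w _|_]; rewrite ?ffunE //; apply/esym/mul0B.
Qed.

(** [l0] is injective, so there are no ties and [clam] is an empty product. *)
Lemma flam_ext m : flam l0 (ext m) = m.
Proof.
apply/ffunP => w; rewrite ffunE ext_tup /clam big_pred0 ?scale1r // => -[a b] /=.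
rewrite -(inj_eq val_inj) /= (inj_eq val_inj) (inj_eq perm_inj).
by case: eqP => [->|]; rewrite ?ltnn ?andbF.
Qed.

Definition eb w0 : Mreg := [ffun w => if w == w0 then 1 else 0].

(** No coefficient appears: [rho] kills [1], and at the descent [si i w] the component coming from
    [w] has coefficient one. *)
Lemma Treg_eb i w : asc i w -> Treg i (eb w) = eb (si i w).
Proof.
move=> up; apply/ffunP => u; rewrite TregWE !ffunE.
have [->|ne] := eqVneq u w.
  rewrite up rho1 addr0 add0r; have wne : w != si i w.
    by apply/negP => /eqP/(congr1 (asc i)); rewrite asc_si up.
  by rewrite [si i w == w]eq_sym (negPf wne) /sigk permB0 scaler0.
rewrite rho0 /sigk permB0 scaler0 if_same !add0r.
rewrite -[u == si i w](inv_eq (@si_K i)); case: eqP => [e|_]; last by rewrite permB0 scaler0; case: ifP.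
by rewrite -[u](si_K i) e asc_si up permB1.
Qed.

Lemma mulreg_eb_sum m : m = \sum_w mulreg (eb w) (m w).
Proof.
apply/ffunP => u; rewrite sum_ffunE (bigD1 u) //= !ffunE eqxx mul1r big1 ?addr0 // => w wu.
by rewrite !ffunE eq_sym (negPf wu) mul0r.
Qed.
End Weight.
End TensorSpace.

(** * Additive endomorphisms as a ring *)

Section EndRing.
Variable U : zmodType.

Record endo := Endo { endo_fun : U -> U; endo_add : {morph endo_fun : u v / u + v} }.

Lemma endoP (f g : endo) : endo_fun f =1 endo_fun g -> f = g.
Proof.
case: f g => [f hf] [g hg] /= /funext fg; subst g; congr Endo.
exact: Prop_irrelevance.
Qed.

HB.instance Definition _ := gen_eqMixin endo.
HB.instance Definition _ := gen_choiceMixin endo.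

Fact endo0_add : {morph (fun _ : U => 0 : U) : u v / u + v}.
Proof. by move=> u v; rewrite addr0. Qed.
Fact endoD_add (f g : endo) : {morph (fun u => endo_fun f u + endo_fun g u) : u v / u + v}.
Proof. by move=> u v; rewrite !endo_add addrACA. Qed.
Fact endoN_add (f : endo) : {morph (fun u => - endo_fun f u) : u v / u + v}.
Proof. by move=> u v; rewrite endo_add opprD. Qed.
Fact endo1_add : {morph (id : U -> U) : u v / u + v}.
Proof. by []. Qed.
Fact endoM_add (f g : endo) : {morph (fun u => endo_fun g (endo_fun f u)) : u v / u + v}.
Proof. by move=> u v; rewrite !endo_add. Qed.

Definition endo0 := Endo endo0_add.
Definition endoD f g := Endo (endoD_add f g).
Definition endoN f := Endo (endoN_add f).
Definition endo1 := Endo endo1_add.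
(* Endomorphisms act on the right: the product applies its left factor first. *)
Definition endoM f g := Endo (endoM_add f g).

Fact endo_addA : associative endoD. Proof. by move=> f g h; apply: endoP => u; apply: addrA. Qed.
Fact endo_addC : commutative endoD. Proof. by move=> f g; apply: endoP => u; apply: addrC. Qed.
Fact endo_add0 : left_id endo0 endoD. Proof. by move=> f; apply: endoP => u; apply: add0r. Qed.
Fact endo_addN : left_inverse endo0 endoN endoD.
Proof. by move=> f; apply: endoP => u; apply: addNr. Qed.
HB.instance Definition _ := GRing.isZmodule.Build endo endo_addA endo_addC endo_add0 endo_addN.

Fact endo_mulA : associative endoM. Proof. by move=> f g h; apply: endoP. Qed.
Fact endo_mul1 : left_id endo1 endoM. Proof. by move=> f; apply: endoP. Qed.
Fact endo_mulr1 : right_id endo1 endoM. Proof. by move=> f; apply: endoP. Qed.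
Fact endo_mulDl : left_distributive endoM +%R.
Proof. by move=> f g h; apply: endoP => u; apply: endo_add. Qed.
Fact endo_mulDr : right_distributive endoM +%R.
Proof. by move=> f g h; apply: endoP. Qed.
HB.instance Definition _ :=
  GRing.Zmodule_isPzRing.Build endo endo_mulA endo_mul1 endo_mulr1 endo_mulDl endo_mulDr.

Lemma endo_sum (I : Type) (r : seq I) (G : I -> endo) u :
  endo_fun (\sum_(i <- r) G i) u = \sum_(i <- r) endo_fun (G i) u.
Proof. by elim/big_rec2: _ => // i x y _ <-. Qed.
End EndRing.

(** * Reduced words *)

Section ReducedWords.
Variables (d : nat) (A : pzRingType) (H : 'I_d.-1 -> A).
Hypothesis H_braid : forall i j : 'I_d.-1, nat_of_ord j = i.+1 -> H i * H j * H i = H j * H i * H j.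
Hypothesis H_comm : forall i j : 'I_d.-1, (i.+1 < j)%N -> H i * H j = H j * H i.
Implicit Types (w : 'S_d) (i j : 'I_d.-1).

(* Strictly decreases along [w |-> s_i w] at a descent [i] of [w]. *)
Definition meas w : nat := (\sum_(p < d) p * (d - w p))%N.

Lemma meas_si i w : ~~ asc i w -> (meas (si i w) < meas w)%N.
Proof.
have pq := slo_neq_shi i; have qp : shi i != slo i by rewrite eq_sym.
rewrite /asc -leqNgt => le.
have lt : (w (shi i) < w (slo i))%N.
  by rewrite ltn_neqAle le andbT (inj_eq val_inj) (inj_eq perm_inj).
rewrite /meas (bigD1 (slo i)) //= (bigD1 (shi i)) //= [X in (_ < X)%N](bigD1 (slo i)) //=.
rewrite [X in (_ < _ + X)%N](bigD1 (shi i)) //= stp_l stp_r.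
set s1 := (\sum_(j < d | _) _)%N; set s2 := (\sum_(j < d | _) _)%N.
have -> : s1 = s2.
  by apply: eq_bigr => j /andP[h1 h2]; rewrite stp_o // eq_sym.
have ab : (d - w (slo i) < d - w (shi i))%N by have := ltn_ord (w (slo i)); lia.
by move: (d - _)%N (d - _)%N ab => a b ab; rewrite !mulSn; lia.
Qed.

(** [N] is fuel. Each removed descent lowers [meas], so fuel [meas w] is enough and any surplus is
    harmless ([Hn_stable]). The word follows whichever descent [pick] returns; independence of this
    choice comes later. *)
Fixpoint Hn (N : nat) w : A :=
  if N is N'.+1 then
    if [pick i | ~~ asc i w] is Some i then Hn N' (si i w) * H i else 1
  else 1.
Definition Hw w := Hn (meas w) w.

Lemma Hn_stable N w : (meas w <= N)%N -> Hn N w = Hw w.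
Proof.
rewrite /Hw; have [m] := ubnP (meas w); elim: m => // m IH in w N * => wm.
case: N => [|N]; case E: (meas w) => [|M] //=.
- move=> _; case: pickP => // i /meas_si; rewrite E ltn0 //.
- move=> le; case: pickP => // i /[dup] di /meas_si; rewrite E => lt.
  by rewrite (IH _ N) ?(IH _ M) //; lia.
Qed.

Lemma Hw_pick w : (forall i, asc i w) \/ (exists2 i, ~~ asc i w & Hw w = Hw (si i w) * H i).
Proof.
rewrite {1}/Hw; case E: (meas w) => [|M] /=.
  by left=> i; apply/negPn/negP => /meas_si; rewrite E.
case: pickP => [i di|none]; last by left=> i; apply/negPn; rewrite none.
right; exists i => //; rewrite Hn_stable //.
by have := meas_si di; rewrite E ltnS.
Qed.

Lemma asc_disjoint i j w : (i.+1 < j)%N || (j.+1 < i)%N -> asc j (si i w) = asc j w.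
Proof.
move=> ij; rewrite /asc !stp_o //; apply/negP => /eqP/(congr1 val) /=; lia.
Qed.

Lemma si_comm i j w : (i.+1 < j)%N -> si i (si j w) = si j (si i w).
Proof.
move=> ij; rewrite /si /stp !mulgA; congr (_ * _)%g.
by rewrite [RHS]conjgC tpermJ !tperm_third //; apply/negP => /eqP/(congr1 val) /=; lia.
Qed.

Lemma si_braid i j w : nat_of_ord j = i.+1 -> si i (si j (si i w)) = si j (si i (si j w)).
Proof.
move=> ij; rewrite /si /stp !mulgA; congr (_ * _)%g; rewrite -(shi_eq_slo ij).
apply: tperm_braid; first exact: slo_neq_shi.
  by apply/negP => /eqP/(congr1 val) /=; lia.
by rewrite (shi_eq_slo ij) slo_neq_shi.
Qed.

(* Matsumoto: the product over a reduced word depends only on the permutation. *)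
Lemma Hw_descent i w : ~~ asc i w -> Hw w = Hw (si i w) * H i.
Proof.
have [m] := ubnP (meas w); elim: m => // m IH in w i * => wm di.
have IHs u j : (meas u < meas w)%N -> ~~ asc j u -> Hw u = Hw (si j u) * H j.
  by move=> um; apply: IH; lia.
have main i1 i2 : (i1 < i2)%N -> ~~ asc i1 w -> ~~ asc i2 w ->
    Hw (si i1 w) * H i1 = Hw (si i2 w) * H i2.
  move=> lt a1 a2; have m1 := meas_si a1; have m2 := meas_si a2.
  have [far|near] := ltnP i1.+1 i2.
    have b1 : ~~ asc i2 (si i1 w) by rewrite asc_disjoint ?far.
    have b2 : ~~ asc i1 (si i2 w) by rewrite asc_disjoint ?far ?orbT.
    by rewrite (IHs _ _ m1 b1) (IHs _ _ m2 b2) (si_comm w far) -!mulrA (H_comm far).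
  (* Two neighbouring descents mean that [w] reverses three consecutive slots. Both products can
     then be continued to the same permutation by three generators each, and these match by the
     braid relation. *)
  have E : nat_of_ord i2 = i1.+1 by apply/eqP; rewrite eqn_leq near lt.
  have e := shi_eq_slo E; have ne := slo_neq_shi i1; have ne2 := slo_neq_shi i2.
  have ne3 : slo i1 != shi i2 by apply/negP => /eqP/(congr1 val) /=; lia.
  have ne4 : slo i2 != slo i1 by rewrite -e eq_sym.
  have ne5 : shi i2 != slo i1 by rewrite eq_sym.
  have ne6 : shi i1 != shi i2 by rewrite e.
  have ev1 u : (si i1 u (slo i1) = u (shi i1)) * (si i1 u (shi i1) = u (slo i1))
    * (si i1 u (shi i2) = u (shi i2)) by rewrite stp_l stp_r stp_o.
  have ev2 u : (si i2 u (slo i1) = u (slo i1)) * (si i2 u (shi i1) = u (shi i2))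
    * (si i2 u (shi i2) = u (shi i1)) by rewrite e stp_l stp_r stp_o.
  have a1E u : asc i1 u = (u (slo i1) < u (shi i1))%N by [].
  have a2E u : asc i2 u = (u (shi i1) < u (shi i2))%N by rewrite e.
  move: (a1) (a2); rewrite a1E a2E -!leqNgt => l1 l2; have l3 := leq_trans l2 l1.
  have b1 : ~~ asc i2 (si i1 w) by rewrite a2E !ev1 -leqNgt.
  have b2 : ~~ asc i1 (si i2 w) by rewrite a1E !ev2 -leqNgt.
  have c1 : ~~ asc i1 (si i2 (si i1 w)) by rewrite a1E !(ev2, ev1) -leqNgt.
  have c2 : ~~ asc i2 (si i1 (si i2 w)) by rewrite a2E !(ev2, ev1) -leqNgt.
  rewrite (IHs _ _ m1 b1) (IHs _ _ m2 b2).
  rewrite (IHs _ _ (ltn_trans (meas_si b1) m1) c1) (IHs _ _ (ltn_trans (meas_si b2) m2) c2).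
  by rewrite (si_braid w E) -!mulrA; congr (_ * _); rewrite !mulrA (H_braid E).
have [up|[j dj ->]] := Hw_pick w; first by rewrite up in di.
have [lt|lt|eq] := ltngtP j i; [exact: main|exact/esym/main|].
by rewrite (val_inj eq).
Qed.

(** Strict growth gives [x <= w x] for all [x]. Hence the preimage of [p] is at most [p], and a
    smaller one would be a fixed point by induction. *)
Lemma asc_all_id w : (forall i, asc i w) -> w = 1%g.
Proof.
move=> up; have ge m (hm : (m < d)%N) : (m <= w (Ordinal hm))%N.
  elim: m hm => // m IH hm; have hm' : (m < d.-1)%N by lia.
  have := up (Ordinal hm'); rewrite /asc.
  have -> : shi (Ordinal hm') = Ordinal hm by apply/val_inj.
  have -> : slo (Ordinal hm') = Ordinal (ltnW hm) by apply/val_inj.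
  by apply: leq_trans; rewrite ltnS IH.
apply/permP => p; rewrite perm1; have [m] := ubnP (nat_of_ord p).
elim: m => // m IH in p * => pm; apply/eqP/negPn/negP => ne.
pose x := (w^-1)%g p; have wx : w x = p by rewrite permKV.
have xp : (x <= p)%N.
  have := ge x (ltn_ord x); have -> : Ordinal (ltn_ord x) = x by apply/val_inj.
  by rewrite wx.
move: xp; rewrite leq_eqVlt => /orP[/eqP/val_inj xE|lt]; first by rewrite -{1}xE wx eqxx in ne.
by have := IH x (leq_trans lt pm); rewrite wx => pE; rewrite -pE ltnn in lt.
Qed.

Lemma Hw1 : Hw 1%g = 1.
Proof.
have [//|[i di _]] := Hw_pick 1%g; last first.
  by move: di; rewrite /asc !perm1 /= ltnSn.
rewrite /Hw; case: (meas _) => //= M up; case: pickP => // i.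
by rewrite up.
Qed.
End ReducedWords.

(** * Induction over the wreath algebra *)

Section Generation.
Variables (k : fieldType) (F : falgType k) (W : wreath_datum F) (d : nat) (lau : bool).
Local Notation BT := (BT F d).
Variables (A : pzRingType) (iota : BT -> A) (H : 'I_d.-1 -> A).

Definition wreath_relsW (A' : pzRingType) (iota' : BT -> A') (H' : 'I_d.-1 -> A') : Prop :=
  wreath_rels lau (Rkw (d := d) (wR W)) (Skw (wD W d1) (wD W d2)) (rhok (btW W)) iota' H'.

Hypothesis hA : is_wreath lau (Rkw (d := d) (wR W)) (Skw (wD W d1) (wD W d2))
   (rhok (btW W)) iota H.

Section Sub.
Variable P : A -> Prop.
Hypotheses (P1 : P 1) (PB : forall a b, P a -> P b -> P (a - b))
  (PM : forall a b, P a -> P b -> P (a * b)) (Pi : forall b, inB lau b -> P (iota b))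
  (PH : forall i, P (H i)).

Definition gpred : {pred A} := [pred a | `[< P a >]].
Lemma gpred_closed : subring_closed gpred.
Proof.
split=> [|a b /asboolP ha /asboolP hb|a b /asboolP ha /asboolP hb]; apply/asboolP;
  [exact: P1|exact: PB|exact: PM].
Qed.

Record gsub := Gsub { gval : A; _ : gval \in gpred }.
HB.instance Definition _ := [isSub for gval].
HB.instance Definition _ := [Choice of gsub by <:].
HB.instance Definition _ := GRing.SubChoice_isSubPzRing.Build A gpred gsub gpred_closed.

(** [insubd] makes the map total; the relations are tested only on [inB], where [val_giota]
    identifies the value. *)
Definition giota (b : BT) : gsub := insubd (0 : gsub) (iota b).
Definition gH i : gsub := insubd (0 : gsub) (H i).

Lemma val_giota b : inB lau b -> val (giota b) = iota b.
Proof. by move=> hb; apply: insubdK; apply/asboolP/Pi. Qed.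
Lemma val_gH i : val (gH i) = H i.
Proof. by apply: insubdK; apply/asboolP/PH. Qed.

Lemma gval_D (a b : gsub) : val (a + b) = val a + val b. Proof. exact: rmorphD. Qed.
Lemma gval_M (a b : gsub) : val (a * b) = val a * val b. Proof. exact: rmorphM. Qed.
Lemma gval_1 : val (1 : gsub) = 1. Proof. exact: rmorph1. Qed.

Lemma gsub_rels : wreath_relsW giota gH.
Proof.
case: hA => -[[hD hM h1] [hbr hc hq hm]] _; split; split.
- by move=> f g hf hg; apply: val_inj; rewrite gval_D !val_giota ?hD //; apply: inBD.
- by move=> f g hf hg; apply: val_inj; rewrite gval_M !val_giota ?hM //; apply: inBM.
- by apply: val_inj; rewrite gval_1 val_giota //; apply: inB1.
- by move=> i j ij; apply: val_inj; rewrite !gval_M !val_gH hbr.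
- by move=> i j ij; apply: val_inj; rewrite !gval_M !val_gH hc.
- move=> i; apply: val_inj; rewrite gval_D !gval_M !val_gH !val_giota ?hq //.
  + exact: inB_const.
  + exact: inB_const.
- move=> i f hf; apply: val_inj; rewrite gval_D !gval_M !val_gH !val_giota ?hm //.
  + exact: (@inB_rho _ _ W).
  + exact: inB_perm.
Qed.

(* The map from [A] to the subring followed by the inclusion is the identity, by initiality. *)
Lemma wreath_gen a : P a.
Proof.
have [h [[hi hH] _]] := hA.2 _ _ _ gsub_rels.
have [f [_ uniq]] := hA.2 _ _ _ hA.1.
have e1 := uniq idfun (fun _ _ => erefl) (fun _ => erefl) a.
pose g : {rmorphism A -> A} := (val : gsub -> A) \o h.
have e2 : g a = f a.
  apply: uniq => [b hb|i] /=; first by rewrite hi // -val_giota.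
  by rewrite hH -val_gH.
have -> : a = val (h a) by rewrite -[LHS]/(idfun a) e1 -e2.
exact/asboolP/(valP (h a)).
Qed.
End Sub.
End Generation.

(** * The wreath relations on the tensor space *)

Section Representation.
Variables (k : fieldType) (F : falgType k) (W : wreath_datum F) (n d : nat) (lau : bool).
Local Notation BT := (BT F d).
Local Notation Vt := (Vt F n d).
Implicit Types (v : Vt) (b f g : BT).

Lemma addVE v v' : addV v v' = v + v'.
Proof. by apply/ffunP => j; rewrite !ffunE. Qed.

Definition inVpred : {pred Vt} := [pred v | inV lau v].
Lemma inVpred_closed : zmod_closed inVpred.
Proof. by split=> [|u v hu hv]; rewrite inE ?inV0 // inVD // inVN. Qed.

(** Module elements are the [v] with [inV lau v]; an endomorphism ring requires them as an abelian
    group in their own right. *)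
Record tensV := TensV { tensv : Vt; _ : tensv \in inVpred }.
HB.instance Definition _ := [isSub for tensv].
HB.instance Definition _ := [Choice of tensV by <:].
HB.instance Definition _ := GRing.SubChoice_isSubZmodule.Build Vt inVpred tensV inVpred_closed.
Implicit Types u : tensV.

Lemma tens_D u u' : val (u + u') = val u + val u'. Proof. exact: raddfD. Qed.

Definition toT v : tensV := insubd (0 : tensV) v.
Lemma toTK v : inV lau v -> val (toT v) = v. Proof. exact: insubdK. Qed.
Lemma tens_in u : inV lau (val u). Proof. exact: (valP u). Qed.

Lemma actBVD v v' b : actBV (v + v') b = actBV v b + actBV v' b.
Proof. by apply/ffunP => j; rewrite !ffunE; apply: mulBDl. Qed.
Lemma actBV_D v b b' : actBV v (addB b b') = actBV v b + actBV v b'.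
Proof. by apply/ffunP => j; rewrite !ffunE; apply: mulBDr. Qed.
Lemma actBV_M v b b' : actBV v (mulB b b') = actBV (actBV v b) b'.
Proof. by apply/ffunP => j; rewrite !ffunE; apply: mulBA. Qed.
Lemma actBV1 v : actBV v (oneB F d) = v.
Proof. by apply/ffunP => j; rewrite !ffunE; apply: mulB1. Qed.

(** Multiplication by an element outside [inB] may leave [tensV]; the zero endomorphism stands in
    there. *)
Lemma iotaE_subproof b :
  {f : endo tensV | inB lau b -> forall u, val (endo_fun f u) = actBV (val u) b}.
Proof.
have [hb|hb] := boolP (inB lau b); last by exists 0.
pose mulT u : tensV := toT (actBV (val u) b).
have val_mulT u : val (mulT u) = actBV (val u) b by rewrite toTK // inV_actB // tens_in.
have mulT_add : {morph mulT : u u' / u + u'}.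
  by move=> u u'; apply: val_inj; rewrite tens_D !val_mulT tens_D actBVD.
by exists (Endo mulT_add).
Qed.

Lemma HE_subproof i : {f : endo tensV | forall u, val (endo_fun f u) = TV W i (val u)}.
Proof.
pose TT u : tensV := toT (TV W i (val u)).
have val_TT u : val (TT u) = TV W i (val u) by rewrite toTK // inV_TV // tens_in.
have TT_add : {morph TT : u u' / u + u'}.
  by move=> u u'; apply: val_inj; rewrite tens_D !val_TT tens_D TVD.
by exists (Endo TT_add).
Qed.

Definition iotaE b : endo tensV := sval (iotaE_subproof b).
Definition HE i : endo tensV := sval (HE_subproof i).

Lemma iotaEE b u : inB lau b -> val (endo_fun (iotaE b) u) = actBV (val u) b.
Proof. by move=> hb; apply: (svalP (iotaE_subproof b)). Qed.
Lemma HEE i u : val (endo_fun (HE i) u) = TV W i (val u).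
Proof. exact: (svalP (HE_subproof i)). Qed.

Lemma endo_fM (x y : endo tensV) u : endo_fun (x * y) u = endo_fun y (endo_fun x u).
Proof. by []. Qed.
Lemma endo_fD (x y : endo tensV) u : endo_fun (x + y) u = endo_fun x u + endo_fun y u.
Proof. by []. Qed.

Lemma endo_rels : wreath_relsW (d := d) W lau iotaE HE.
Proof.
split; split.
- move=> f g hf hg; apply: endoP => u; apply: val_inj; rewrite endo_fD tens_D !iotaEE //.
    exact: actBV_D.
  exact: inBD.
- move=> f g hf hg; apply: endoP => u; apply: val_inj; rewrite endo_fM !iotaEE //.
    exact: actBV_M.
  exact: inBM.
- by apply: endoP => u; apply: val_inj; rewrite iotaEE ?actBV1 //; apply: inB1.
- by move=> i j ij; apply: endoP => u; apply: val_inj; rewrite !endo_fM !HEE (TV_braid _ _ ij).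
- by move=> i j ij; apply: endoP => u; apply: val_inj; rewrite !endo_fM !HEE (TV_comm _ _ ij).
- move=> i; apply: endoP => u; apply: val_inj; rewrite endo_fD tens_D !endo_fM !HEE.
  by rewrite !iotaEE ?TV_quad //; apply: inB_const.
move=> i f hf; apply: endoP => u; apply: val_inj; rewrite endo_fD tens_D !endo_fM.
have hs : inB lau (sigk i f) by apply: inB_perm.
have hr : inB lau (rhok (btW W) i f) by apply: (@inB_rho _ _ W).
by rewrite iotaEE // !HEE !iotaEE // TV_mul.
Qed.
End Representation.

(** * The double centralizer property *)

Section DoubleCentralizer.
Variables (k : fieldType) (F : falgType k) (W : wreath_datum F) (n d : nat) (lau : bool).
Hypothesis hnd : (d <= n)%N.
Local Notation BT := (BT F d).
Local Notation Vt := (Vt F n d).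
Local Notation Mreg := (Mreg d BT).
Local Notation Treg := (TregW W (d := d)).
Local Notation Sk := (Skw (d := d) (wD W d1) (wD W d2)).
Local Notation Rk := (Rkw (d := d) (wR W)).
Local Notation tensV := (tensV F n d lau).
Variables (A : pzRingType) (iota : BT -> A) (H : 'I_d.-1 -> A).
Hypothesis hA : is_wreath lau Rk Sk (rhok (btW W)) iota H.
Implicit Types (m : Mreg) (b f g : BT) (i : 'I_d.-1) (w : 'S_d) (u : tensV).

Lemma iotaD f g : inB lau f -> inB lau g -> iota (f + g) = iota f + iota g.
Proof. by case: hA => -[[h _ _] _] _; apply: h. Qed.
Lemma iotaM f g : inB lau f -> inB lau g -> iota (f * g) = iota f * iota g.
Proof. by case: hA => -[[_ h _] _] _; apply: h. Qed.
Lemma iota1 : iota 1 = 1.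
Proof. by case: hA => -[[_ _ h] _] _. Qed.
Lemma iota0 : iota 0 = 0.
Proof. by apply: (@addrI _ (iota 0)); rewrite -iotaD ?inB0 // !addr0. Qed.
Lemma iotaN f : inB lau f -> iota (- f) = - iota f.
Proof. by move=> hf; apply: (@addrI _ (iota f)); rewrite -iotaD ?inBN // !subrr iota0. Qed.
Lemma Hquad i : H i * H i = iota (Sk i) * H i + iota (Rk i).
Proof. by case: hA => -[_ [_ _ h _]] _. Qed.
Lemma Hmul i f : inB lau f -> H i * iota f = iota (sigk i f) * H i + iota (rho W i f).
Proof. by case: hA => -[_ [_ _ _ h]] _; apply: h. Qed.
Lemma Hbraid (i j : 'I_d.-1) : nat_of_ord j = i.+1 -> H i * H j * H i = H j * H i * H j.
Proof. by case: hA => -[_ [h _ _ _]] _; apply: h. Qed.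
Lemma Hcomm (i j : 'I_d.-1) : (i.+1 < j)%N -> H i * H j = H j * H i.
Proof. by case: hA => -[_ [_ h _ _]] _; apply: h. Qed.

(** The commutation relation solved for the other order, by [sigma^2 = 1] and [rho sigma = - rho].
    It is needed because [theta] keeps its coefficients to the right of [Hw w]. *)
Lemma iota_H i f : inB lau f -> iota f * H i = H i * iota (sigk i f) + iota (rho W i f).
Proof.
move=> hf; rewrite Hmul; last exact: inB_perm.
by rewrite sgK rho_sg iotaN ?subrK //; apply: inB_rho.
Qed.

(** [S] is invariant under its slot exchange, hence [rho] kills it. *)
Lemma H_S i : iota (Sk i) * H i = H i * iota (Sk i).
Proof.
have pq := slo_neq_shi i; rewrite Hmul ?inB_const //.
have E : sigk i (Sk i) = Sk i.
  rewrite Skw_val /sigk -val_permZ; congr (val _).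
  by rewrite /sdiff rmorphB /= !permZ_D // tpermL tpermR !(Dz_sym _ _ pq).
rewrite E; have -> : rho W i (Sk i) = 0.
  by apply/esym/rho_unique; rewrite E subrr scaler0.
by rewrite iota0 addr0.
Qed.

Local Notation Hw := (Hw H).
Definition theta m : A := \sum_w Hw w * iota (m w).

Lemma Hw_asc i w : asc i w -> Hw w * H i = Hw (si i w).
Proof.
move=> up; rewrite [RHS](Hw_descent Hbraid Hcomm (i := i)) ?asc_si ?up //.
by rewrite si_K.
Qed.

Lemma Hw_desc i w : ~~ asc i w -> Hw w * H i = Hw w * iota (Sk i) + Hw (si i w) * iota (Rk i).
Proof.
move=> dn; have E := Hw_descent Hbraid Hcomm dn.
by rewrite {1}E -mulrA Hquad mulrDr H_S !mulrA -E.
Qed.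

Lemma theta_T i m : inreg lau m -> theta (Treg i m) = theta m * H i.
Proof.
move=> hm; have pq := slo_neq_shi i.
have hs w : inB lau (sigk i (m w)) by apply: inB_perm.
have hr w : inB lau (rho W i (m w)) by apply: inB_rho.
have E w : iota (Treg i m w) = iota (rho W i (m w))
    + (if asc i w then 0 else iota (Sk i) * iota (sigk i (m w)))
    + (if asc i w then iota (Rk i) else 1) * iota (sigk i (m (si i w))).
  rewrite TregWE !scaleZE -Skw_val -Rkw_val.
  have hSs : inB lau (Sk i * sigk i (m w)) by apply: inBM => //; apply: inB_const.
  have hRs : inB lau (Rk i * sigk i (m (si i w))) by apply: inBM => //; apply: inB_const.
  case: (asc i w).
    by rewrite !addr0 iotaD // iotaM //; apply: inB_const.
  have hD : inB lau (rho W i (m w) + Sk i * sigk i (m w)) by apply: inBD.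
  by rewrite mul1r !iotaD // iotaM //; apply: inB_const.
rewrite /theta mulr_suml; under eq_bigr do rewrite E !mulrDr.
(* The contributions to component [w] that come from [si i w] are reindexed along this involution,
   so that both sides are compared at one coefficient [m w]. *)
rewrite big_split /= [X in _ + X](reindex_inj (inv_inj (si_K i))) /= -big_split /=.
apply: eq_bigr => w _; rewrite si_K asc_si -mulrA iota_H // mulrDr mulrA [RHS]addrC -addrA.
congr (_ + _); have [up|dn] := boolP (asc i w).
  by rewrite /= mulr0 add0r mulr1 mulrA Hw_asc.
by rewrite /= [RHS]mulrA Hw_desc // mulrDl !mulrA.
Qed.

Lemma theta_mul m b : inreg lau m -> inB lau b -> theta (mulreg m b) = theta m * iota b.
Proof.
by move=> hm hb; rewrite /theta mulr_suml; apply: eq_bigr => w _; rewrite ffunE iotaM // mulrA.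
Qed.

Lemma thetaD m m' : inreg lau m -> inreg lau m' -> theta (m + m') = theta m + theta m'.
Proof.
by move=> hm hm'; rewrite /theta -big_split; apply: eq_bigr => w _; rewrite ffunE iotaD // mulrDr.
Qed.

Lemma theta_eb1 : theta (eb F 1%g) = 1.
Proof.
rewrite /theta (bigD1 1%g) //= ffunE eqxx iota1 mulr1 Hw1 big1 ?addr0 // => w w1.
by rewrite ffunE (negPf w1) iota0 mulr0.
Qed.

Lemma inreg_eb w : inreg lau (eb F w).
Proof. by move=> v; rewrite ffunE; case: ifP => _; [apply: inB1|apply: inB0]. Qed.

Variable Fr : {rmorphism A -> endo tensV}.
Hypothesis Fr_iota : forall b, inB lau b -> Fr (iota b) = iotaE n lau b.
Hypothesis Fr_H : forall i, Fr (H i) = HE W n lau i.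

Definition ract u (a : A) : tensV := endo_fun (Fr a) u.

Lemma ractM u (a b : A) : ract u (a * b) = ract (ract u a) b.
Proof. by rewrite /ract rmorphM. Qed.
Lemma ract1 u : ract u 1 = u.
Proof. by rewrite /ract rmorph1. Qed.
Lemma ractD u (a b : A) : ract u (a + b) = ract u a + ract u b.
Proof. by rewrite /ract rmorphD. Qed.
Lemma ractB u (a b : A) : ract u (a - b) = ract u a - ract u b.
Proof. by rewrite /ract rmorphB. Qed.
Lemma ractDl u u' a : ract (u + u') a = ract u a + ract u' a.
Proof. exact: endo_add. Qed.
Lemma ract_iota u b : inB lau b -> val (ract u (iota b)) = actBV (val u) b.
Proof. by move=> hb; rewrite /ract Fr_iota // iotaEE. Qed.
Lemma ract_H u i : val (ract u (H i)) = TV W i (val u).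
Proof. by rewrite /ract Fr_H HEE. Qed.

Local Notation l0 := (l0 hnd).
Local Notation ext := (ext (F := F) hnd).
(** [flam W l0] is the projection to the weight space of [v_omega], so this is an [A]-linear left
    inverse of [a |-> v_omega a]. *)
Definition thetaV u : A := theta (flam W l0 (val u)).

Lemma thetaV_D u u' : thetaV (u + u') = thetaV u + thetaV u'.
Proof. by rewrite /thetaV tens_D flamD thetaD //; apply: inreg_flam; apply: tens_in. Qed.

Lemma thetaV_act u a : thetaV (ract u a) = thetaV u * a.
Proof.
have hin u0 : inreg lau (flam W l0 (val u0)) by apply: inreg_flam; apply: tens_in.
have thN u0 : thetaV (- u0) = - thetaV u0.
  apply: (@addrI _ (thetaV u0)); rewrite -thetaV_D !subrr.
  by apply: (@addrI _ (thetaV 0)); rewrite -thetaV_D !addr0.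
move: u; apply: (@wreath_gen _ _ _ _ _ _ _ _ hA (fun a => forall u, thetaV (ract u a) = thetaV u * a)) => {a}.
- by move=> u; rewrite ract1 mulr1.
- by move=> a b ha hb u; rewrite ractB thetaV_D thN ha hb mulrBr.
- by move=> a b ha hb u; rewrite ractM hb ha mulrA.
- by move=> b hb u; rewrite /thetaV ract_iota // flam_actB theta_mul.
- by move=> i u; rewrite /thetaV ract_H flamT // theta_T.
Qed.

Definition uw : tensV := toT lau (ext (eb F 1%g)).

Lemma val_uw : val uw = ext (eb F 1%g).
Proof. by rewrite toTK // inV_ext //; apply: inreg_eb. Qed.

Lemma thetaV_uw : thetaV uw = 1.
Proof. by rewrite /thetaV val_uw flam_ext theta_eb1. Qed.

(** A reduced word climbs from the identity through ascents only, and ascents act on the vectors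
    [eb] without coefficients. *)
Lemma uw_Hw w : val (ract uw (Hw w)) = ext (eb F w).
Proof.
have [N] := ubnP (meas w); elim: N => // N IH in w * => wN.
have [/asc_all_id ->|[i di ->]] := Hw_pick H w; first by rewrite Hw1 ract1 val_uw.
rewrite ractM ract_H IH; last by have := meas_si di; lia.
by rewrite -ext_Treg Treg_eb ?asc_si // si_K.
Qed.

Lemma tens_sum (I : finType) (G : I -> tensV) : val (\sum_i G i) = \sum_i val (G i).
Proof. exact: raddf_sum. Qed.

Lemma ext_sum (I : finType) (G : I -> Mreg) : ext (\sum_i G i) = \sum_i ext (G i).
Proof.
have e0 : ext 0 = 0 by apply: (@addrI _ (ext 0)); rewrite -extD !addr0.
exact: (big_morph ext (extD hnd) e0).
Qed.

Lemma uw_theta m : inreg lau m -> val (ract uw (theta m)) = ext m.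
Proof.
move=> hm; rewrite /ract /theta rmorph_sum /= endo_sum tens_sum [in RHS](mulreg_eb_sum m) ext_sum.
apply: eq_bigr => w _; rewrite -/(ract _ _) ractM ract_iota // uw_Hw.
by rewrite ext_actB.
Qed.

Definition act (v : Vt) (a : A) : Vt := val (ract (toT lau v) a).

Lemma act_in v a : inV lau (act v a). Proof. exact: tens_in. Qed.
Lemma toT_val u : toT lau (val u) = u. Proof. exact: valKd. Qed.
Lemma toT_act v a : toT lau (act v a) = ract (toT lau v) a. Proof. exact: valKd. Qed.
Lemma toT_D (v v' : Vt) : inV lau v -> inV lau v' -> toT lau (v + v') = toT lau v + toT lau v'.
Proof. by move=> hv hv'; apply: val_inj; rewrite tens_D !toTK // inVD. Qed.

Lemma act_module : is_module lau iota H (fun i => TV W i) act.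
Proof.
split; split.
- by move=> v a _; apply: act_in.
- by move=> v hv; rewrite /act ract1 toTK.
- by move=> v a b hv; rewrite /act ractM toT_val.
- by move=> v a b hv; rewrite /act ractD tens_D addVE.
- by move=> v w a hv hw; rewrite !addVE /act toT_D // ractDl tens_D.
- by move=> v b hv hb; rewrite /act ract_iota // toTK.
- by move=> v i hv; rewrite /act ract_H toTK.
Qed.

(* [n >= d] enters here: [V] has the weight space [v_omega A], a free module of rank one. *)
Lemma act_faithful a a' : (forall v, inV lau v -> act v a = act v a') -> a = a'.
Proof.
move=> h; have E x : x = thetaV (ract uw x) by rewrite thetaV_act thetaV_uw mul1r.
rewrite (E a) (E a'); congr thetaV; apply: val_inj; exact: h (inV_ext hnd (inreg_eb _)).
Qed.

Definition phi_left (a : A) (v : Vt) : Vt := act (val uw) (a * thetaV (toT lau v)).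

Lemma phi_left_End a : is_EndA lau act (phi_left a).
Proof.
split=> [v _|v w hv hw|v b hv]; first exact: act_in.
  by rewrite !addVE /phi_left toT_D // thetaV_D mulrDr /act ractD tens_D.
by rewrite /phi_left toT_act thetaV_act mulrA /act ractM !toT_val.
Qed.

Section Sep.
Variable l : 'I_d -> 'I_n.
Hypothesis l_mono : forall x y : 'I_d, (x <= y)%N -> (l x <= l y)%N.

(** Followed by [ext], the map [f_l] becomes an endomorphism of [V] itself, so [psi] commutes with
    it. *)
Definition phi_lam (v : Vt) : Vt := ext (flam W l v).

Lemma phi_lam_in v : inV lau v -> inV lau (phi_lam v).
Proof. by move=> hv; apply: inV_ext; apply: inreg_flam. Qed.

Lemma phi_lam_act u a : phi_lam (val (ract u a)) = val (ract (toT lau (phi_lam (val u))) a).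
Proof.
have hin u0 : inV lau (phi_lam (val u0)) by apply: phi_lam_in; apply: tens_in.
have phD u0 u1 : phi_lam (val (u0 + u1)) = phi_lam (val u0) + phi_lam (val u1).
  by rewrite /phi_lam tens_D flamD extD.
have phN u0 : phi_lam (val (- u0)) = - phi_lam (val u0).
  apply: (@addrI _ (phi_lam (val u0))); rewrite -phD !subrr.
  by apply: (@addrI _ (phi_lam (val (0 : tensV)))); rewrite -phD !addr0.
move: u; apply: (@wreath_gen _ _ _ _ _ _ _ _ hA
  (fun a => forall u, phi_lam (val (ract u a)) = val (ract (toT lau (phi_lam (val u))) a))) => {a}.
- by move=> u; rewrite !ract1 toTK.
- move=> a b ha hb u; rewrite !ractB phD phN ha hb.
  by rewrite raddfB.
- by move=> a b ha hb u; rewrite !ractM hb ha toT_val.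
- by move=> b hb u; rewrite !ract_iota // toTK // /phi_lam flam_actB ext_actB.
- by move=> i u; rewrite !ract_H toTK // /phi_lam flamT // ext_Treg.
Qed.

Lemma phi_lam_End : is_EndA lau act phi_lam.
Proof.
split=> [v|v w hv hw|v a hv]; first exact: phi_lam_in.
  by rewrite !addVE /phi_lam flamD extD.
by rewrite /act phi_lam_act toTK.
Qed.
End Sep.

Lemma act_full psi : is_EndS lau act psi ->
  exists a : A, forall v, inV lau v -> psi v = act v a.
Proof.
case=> psi_in _ psi_comm; pose a := thetaV (toT lau (psi (val uw))); exists a.
(* As [thetaV uw = 1], the endomorphism [phi_left (theta m)] sends [v_omega] to [ext m]; commuting
   with it determines [psi (ext m)] from [psi] at [v_omega]. *)
have on_ext m : inreg lau m -> psi (ext m) = act (ext m) a.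
  move=> hm; have hv := inV_ext hnd hm.
  have E : phi_left (theta m) (val uw) = ext m.
    by rewrite /phi_left /act !toT_val thetaV_uw mulr1 uw_theta.
  rewrite -{1}E psi_comm ?tens_in //; last exact: phi_left_End.
  rewrite /phi_left /act toT_val ractM; congr (val (ract _ _)).
  by apply: val_inj; rewrite uw_theta // toTK.
move=> v hv; apply: (flam_inj (W := W)) => l lm.
have PE := phi_lam_End lm; have hf := inreg_flam W l hv.
have : phi_lam l (psi v) = phi_lam l (act v a).
  rewrite -psi_comm // [phi_lam l v]/(ext _) on_ext //.
  by case: PE => _ _ ->.
by move/(congr1 (flam W l0)); rewrite !flam_ext.
Qed.
End DoubleCentralizer.

Theorem theorem7 (k : fieldType) (F : falgType k) (lau : bool) (n d : nat)
    (D00 D01 D10 D11 R alpha : TP F 2)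
    (* polynomial type *)
    (hd : (2 <= d)%N) (hnd : (d <= n)%N)
    (hRc : centralF R) (hRs : flipF R = R)
    (hD00 : weakFrobSym D00) (hD01 : weakFrobSym D01)
    (hD10 : weakFrobSym D10) (hD11 : weakFrobSym D11)
    (hD3 : tpmul (placeF (fun j : 'I_2 => widen_ord (isT : (2 <= 3)%N) j) D00)
                 (placeF (fun j : 'I_2 => lift ord0 j : 'I_3) D11)
         = tpmul (placeF (fun j : 'I_2 => widen_ord (isT : (2 <= 3)%N) j) D01)
                 (placeF (fun j : 'I_2 => lift ord0 j : 'I_3) D10))
    (* (C1) *)
    (hC1 : tpmul alpha (flipF alpha + (D10 - D01)) = R)
    (* (C2) *)
    (hC2 : [/\ centralF alpha, centralF D00, centralF D01, centralF D10 & centralF D11])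
    (* (C3) *)
    (hC3 : nzdB lau (addB (mulB (constB alpha) (subB (xB F ord0) (xB F ord_max)))
                          (beta D00 D01 D10 D11)))
    (A : pzRingType) (iota : BT F d -> A) (H : 'I_d.-1 -> A)
    (hA : is_wreath lau (Rkw (d := d) R) (Skw D01 D10)
            (rhok (beta D00 D01 D10 D11)) iota H) :
  exists act : Vt F n d -> A -> Vt F n d,
    [/\ is_module lau iota H
          (actHV (Rkw R) (Skw D01 D10)
             (fun i => placeFk i (flipF alpha + (D10 - D01)))
             (rhok (beta D00 D01 D10 D11))) act,
        (* the natural map a |-> (v |-> v.a) lands in End_{S_{n,d}}(V) *)
        (forall a : A, is_EndS lau act (fun v => act v a)),
        (* it is injective *)
        (forall a a' : A, (forall v, inV lau v -> act v a = act v a') -> a = a') &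
        (* and surjective onto End_{S_{n,d}}(V) *)
        (forall psi, is_EndS lau act psi ->
           exists a : A, forall v, inV lau v -> psi v = act v a)].
Proof.
case: hC2 => cal c00 c01 c10 c11.
pose D (i : 'I_4) : TP F 2 := if i == 0 :> nat then D00 else if i == 1 :> nat then D01
  else if i == 2 :> nat then D10 else D11.
have D_frob i : weakFrobSym (D i) by rewrite /D; do 3?case: ifP.
have D_cent i : centralF (D i) by rewrite /D; do 3?case: ifP.
pose W := @WreathDatum k F D R alpha D_frob D_cent hRc hRs cal hD3 hC1.
have hAW : is_wreath lau (Rkw (d := d) (wR W)) (Skw (wD W d1) (wD W d2)) (rhok (btW W)) iota H by exact: hA.
(* Initiality of [A], applied to the operators on [V], produces the action. *)
have [Fr [[Fr_i Fr_H] _]] := hAW.2 _ _ _ (endo_rels W n d lau).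
have modP := act_module Fr_i Fr_H.
exists (act Fr); split; first exact: modP.
- move=> a; case: modP => -[h1 h2 h3] [h4 h5 h6 h7]; split=> [v|v w|phi [_ _ hphi] v hv].
  + exact: h1.
  + exact: h5.
  + by rewrite hphi.
- exact: (act_faithful hnd hAW Fr_i Fr_H).
- exact: (act_full hnd hAW Fr_i Fr_H).
Qed.
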